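(* Let $G_A$ be a standard oscillator group and let $L\subset V_A=C^\infty(A)$ be a dense real linear subspace which is invariant under both $D$ and $\gamma$ and which is equipped with the subspace topology. Consider the oscillator group $G_L:=\mathrm{Heis}(L,\omega_A)\rtimes_\gamma\mathbb R\subset G_A$ with Lie algebra $\mathfrak g_L=\mathbb R\times L\times\mathbb R$, and assume $\exp_{G_A}(\mathfrak g_L)\subset G_L$. Let $\pi_L:G_L\to U(\mathcal H)$ be a smooth unitary representation. Then: (a) $\pi_L$ extends uniquely to a smooth representation $\pi:G_A\to U(\mathcal H)$. (b) If $D(L)\subset L$ is dense and $B(I_{\pi_L})^0\supset W_d\cap\mathfrak g_L$ holds for some $d\in\mathbb R\cup\{\infty\}$, then $\pi$ is semibounded with $B(I_\pi)^0\supset W_d$.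
   Context: Standard oscillator group: let $H_A\neq 0$ be a complex Hilbert space (inner product linear in the first argument), $A\ge 0$ self-adjoint on $H_A$ with $\ker A=0$, $\gamma(t)=e^{itA}$, $V_A=C^\infty(A)=\bigcap_k\mathcal D(A^k)$ with the $C^\infty$-topology (seminorms $\|A^kx\|$), $D=iA|_{V_A}$, $\omega_A(x,y)=\mathrm{Im}\langle Ax,y\rangle$. $G_A=\mathbb R\times V_A\times\mathbb R$ with $(t,x,s)(t',x',s')=(t+t'+\frac12\omega_A(x,\gamma(s)x'),x+\gamma(s)x',s+s')$; its Lie algebra is $\mathfrak g_A=\mathbb R\times V_A\times\mathbb R$, and $\exp_{G_A}(z,x,s)=\big(z+\frac12\int_0^1\int_0^1\omega_A(\gamma(stt')x,\gamma(st)x)\,t\,dt'dt,\ \int_0^1\gamma(st)x\,dt,\ s\big)$. $\mathrm{Heis}(L,\omega_A)=\mathbb R\times L$ with $(t,x)(t',x')=(t+t'+\frac12\omega_A(x,x'),x+x')$. Cones: $W_\infty=\mathbb R\times V_A\times\,]0,\infty[$ and, for $d\in\mathbb R$, $W_d=\{(t,x,s)\in W_\infty: t-\frac1{2s}\|x\|^2+ds>0\}$. Semibounded representations: a unitary representation $\pi:G\to U(\mathcal H)$ on a complex Hilbert space, of a Lie group with exponential map, is smooth if $\mathcal H^\infty=\{v: g\mapsto\pi(g)v \text{ smooth}\}$ is dense. For $x\in\mathfrak g$, $\mathtt{d}\pi(x)v=\frac{d}{dt}|_{t=0}\pi(\exp(tx))v$ on $\mathcal H^\infty$ is essentially skew-adjoint;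 spectra refer to closures. $s_\pi:\mathfrak g\to\mathbb R\cup\{\infty\}$, $s_\pi(x)=\sup\mathrm{Spec}(i\,\mathtt{d}\pi(x))$ (so $\mathcal H\ne\{0\}$). A smooth $\pi$ is semibounded if $s_\pi$ is bounded on some non-empty open subset of $\mathfrak g$. $B(I_\pi)=\{x\in\mathfrak g: s_\pi(x)<\infty\}$ and $B(I_\pi)^0$ is its interior in $\mathfrak g$. *)

(* Defs.v *)
From HB Require Import structures.
From mathcomp Require Import all_boot all_order all_algebra sesquilinear.
From mathcomp Require Import complex.
From mathcomp Require Import all_classical all_reals all_analysis.

Set Implicit Arguments.
Unset Strict Implicit.
Unset Printing Implicit Defensive.
Import Order.TTheory GRing.Theory Num.Theory.
Import numFieldNormedType.Exports.

Local Open Scope classical_set_scope.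
Local Open Scope ring_scope.
Local Open Scope complex_scope.

(* [0 +i* 1] is used for the imaginary unit throughout, rather than the abstract
   [Num.imaginary] of the library, so as to match [complex.Re] and [complex.Im]. *)

(* [{dot H for conj}] is the library's type of positive definite hermitian
   forms: linear in the first argument, antilinear in the second. *)
HB.mixin Record CompleteNormedModule_isHilbert (R : realType) H
    & CompleteNormedModule R[i] H := {
  dotp : {dot H for (@Num.conj R[i])} ;
  dotp_norm : forall x : H, `|x| ^+ 2 = dotp x x
}.

#[short(type="hilbertType")]
HB.structure Definition Hilbert (R : realType) :=
  {H of CompleteNormedModule R[i] H & CompleteNormedModule_isHilbert R H}.

(* The derivative at 0 of a curve in a complex normed space, with respect to
   its real parameter. *)
Definition real_deriv0 (R : realType) (F : normedModType R[i]) (c : R -> F) (w : F) :=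
  (t^-1)%:C *: (c t - c 0) @[t --> 0^'] --> w.

(* A possibly unbounded operator; the values of [app] off [dom] are junk. *)
Record operator (R : realType) (H : hilbertType R) := Operator {
  dom : set H ;
  app :> H -> H
}.

Section Operators.
Context (R : realType) (H : hilbertType R).
Implicit Types (A : operator H) (T : set (H * H)).

Record linear_densely_defined A : Prop := {
  dom0 : dom A 0 ;
  dom_lin : forall (c : R[i]) x y, dom A x -> dom A y -> dom A (c *: x + y) ;
  app_lin : forall (c : R[i]) x y, dom A x -> dom A y ->
    A (c *: x + y) = c *: A x + A y ;
  dom_dense : dense (dom A)
}.

(* A = A^*: the pairs (y, A^* y), characterised by the left-hand side, are the
   pairs (y, A y) with y in dom A. *)
Definition selfadjoint A := linear_densely_defined A /\
  forall y z, (forall x, dom A x -> dotp (A x) y = dotp x z) <->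
              (dom A y /\ z = A y).

(* C^oo(A); [iter k A x] is A^k x. *)
Definition Csmooth A : set H := [set x | forall k, dom A (iter k A x)].

Definition unitary (U : H -> H) :=
  [/\ linear U, forall x y, dotp (U x) (U y) = dotp x y &
      forall y, exists x, U x = y].

(* gamma(t) = e^{itA}: the strongly continuous unitary one-parameter group with
   infinitesimal generator iA, with equality of generators including domains.
   There is exactly one for self-adjoint A, by Stone's theorem. *)
Definition is_exp_itA A (gamma : R -> H -> H) :=
  [/\ forall t, unitary (gamma t),
      forall s t x, gamma (s + t) x = gamma s (gamma t x),
      forall x, continuous (fun t => gamma t x) &
      forall x y, real_deriv0 (fun t => gamma t x) y <-> (dom A x /\ y = (0 +i* 1) *: A x)].

(* Spectral theory of closed operators, given by their graph T. *)
Definition resolvent_set T : set R[i] := [set lam |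
  (forall w, exists! v, T (v, w + lam *: v)) /\
  exists C : R, forall v w, T (v, w) -> `|v| <= C%:C * `|w - lam *: v| ].

Definition spectrum T : set R[i] := ~` resolvent_set T.

(* The Pettis integral over [0, 1]. *)
Definition integral01 (f : R -> H) : H := xget 0 [set y | forall z,
  dotp y z = (\int[lebesgue_measure]_(t in `[0%R, 1%R]) complex.Re (dotp (f t) z))
          +i* (\int[lebesgue_measure]_(t in `[0%R, 1%R]) complex.Im (dotp (f t) z))].

(* H_A <> 0, and A is a positive injective self-adjoint operator *)
Record standard_oscillator A (gamma : R -> H -> H) : Prop := {
  osc_neq0 : exists x : H, x != 0 ;
  osc_sa : selfadjoint A ;
  osc_ge0 : forall x, dom A x -> 0 <= dotp (A x) x ;
  osc_ker0 : forall x, dom A x -> A x = 0 -> x = 0 ;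
  osc_gamma : is_exp_itA A gamma
}.

Definition omegaA A (x y : H) : R := complex.Im (dotp (A x) y).

Definition real_subspace (L : set H) :=
  L 0 /\ forall (r : R) x y, L x -> L y -> L (r%:C *: x + y).

End Operators.

(* H as a real vector space, with the initial topology for the maps x |-> A^k x,
   k : nat, into H. Only its restriction to C^oo(A) is meaningful, where it is
   the C^oo-topology. *)
Definition cinf (R : realType) (H : hilbertType R) (A : operator H) : Type := H.

Section Cinf.
Context (R : realType) (H : hilbertType R) (A : operator H).
Local Notation V := (cinf A).

HB.instance Definition _ := GRing.Zmodule.copy V H.

Let scaleV (r : R) (x : V) : V := (r%:C *: (x : H)).

Let scaleVA a b v : scaleV a (scaleV b v) = scaleV (a * b) v.
Proof. by rewrite /scaleV scalerA rmorphM. Qed.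

Let scaleV1 : left_id 1 scaleV.
Proof. by move=> x; rewrite /scaleV rmorph1 scale1r. Qed.

Let scaleVDr : right_distributive scaleV +%R.
Proof. by move=> a x y; rewrite /scaleV scalerDr. Qed.

Let scaleVDl v : {morph scaleV^~ v : a b / a + b}.
Proof. by move=> a b; rewrite /scaleV rmorphD scalerDl. Qed.

HB.instance Definition _ := GRing.Zmodule_isLmodule.Build R V
  scaleVA scaleV1 scaleVDr scaleVDl.

HB.instance Definition _ := Topological.copy V
  (initial_topology (fun (x : H) => (fun k => iter k A x) : {ptws nat -> H})).

(* density of L in M for the C^oo-topology, where L and M lie in C^oo(A) *)
Definition cinf_dense (L M : set V) := M `<=` closure L.

End Cinf.

(* The join instances on products, such as [preTopologicalLmodType]. *)
HB.saturate prod.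

(* C^n-maps in the sense of Michal and Bastiani, from a real linear subspace S
   of E with the subspace topology into a complex normed space; [df (x, h)] is
   the real directional derivative of f at x along h. *)
Fixpoint MB_C (R : realType) (F : normedModType R[i]) (n : nat)
    (E : preTopologicalLmodType R) (S : set E) (f : E -> F) : Prop :=
  {within S, continuous f} /\
  if n is m.+1 then
    exists df : E * E -> F,
      (forall x h, S x -> S h -> real_deriv0 (fun t : R => f (x + t *: h)) (df (x, h))) /\
      MB_C m (S `*` S) df
  else True.

Definition MB_smooth (R : realType) (F : normedModType R[i])
    (E : preTopologicalLmodType R) (S : set E) (f : E -> F) :=
  forall n, MB_C n S f.

(* The underlying space both of the group G_A and of its Lie algebra g_A. *)
Definition osc (R : realType) (H : hilbertType R) (A : operator H) :
  preTopologicalLmodType R := (R^o * cinf A * R^o)%type.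

Section OscillatorGroup.
Context (R : realType) (HA : hilbertType R) (A : operator HA).
Context (gamma : R -> HA -> HA).
Implicit Types (L : set HA) (g h : osc A).

(* R x L x R, as a subset of R x V_A x R. *)
Definition osc_of L : set (osc A) := [set g | L g.1.2].

Definition osc_mul g h : osc A :=
  (g.1.1 + h.1.1 + 2^-1 * omegaA A g.1.2 (gamma g.2 h.1.2),
   (g.1.2 : HA) + gamma g.2 h.1.2 : cinf A,
   g.2 + h.2).

Definition osc_exp (X : osc A) : osc A :=
  let: (z, x, s) := X in
  (z + 2^-1 * \int[lebesgue_measure]_(t in `[0%R, 1%R])
       \int[lebesgue_measure]_(t' in `[0%R, 1%R])
         (omegaA A (gamma (s * t * t') x) (gamma (s * t) x) * t),
   integral01 (fun t => gamma (s * t) x) : cinf A,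
   s).

(* W_d, where [d = +oo%E] is allowed *)
Definition W (d : \bar R) : set (osc A) := [set g |
  let: (t, x, s) := g in
  [/\ Csmooth A x, 0 < s &
      match d with
      | d%:E => 0 < t - (2 * s)^-1 * complex.Re (`|x : HA| ^+ 2) + d * s
      | +oo%E => True
      | -oo%E => False
      end]].

Section Representations.
Context (K : hilbertType R).

(* Everything below is relative to the group G_L = R x L x R with Lie algebra
   R x L x R; G_A is the case L = Csmooth A. *)
Context (L : set HA) (pi : osc A -> K -> K).
Local Notation gL := (osc_of L).

Definition unitary_rep :=
  (forall g, gL g -> unitary (pi g)) /\
  (forall g h, gL g -> gL h -> forall v, pi (osc_mul g h) v = pi g (pi h v)).

Definition smooth_vectors : set K :=
  [set v | MB_smooth gL (fun g => pi g v)].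

Definition smooth_rep := unitary_rep /\ dense smooth_vectors.

(* The graph of d pi(X), defined on the smooth vectors. *)
Definition dpi (X : osc A) : set (K * K) := [set p |
  smooth_vectors p.1 /\
  real_deriv0 (fun t : R => pi (osc_exp (t *: X)) p.1) p.2].

Definition i_dpi (X : osc A) : set (K * K) :=
  [set (p.1, (0 +i* 1) *: p.2) | p in dpi X].

(* s_pi(X) = sup Spec(i d pi(X)), the spectrum being that of the closure; it is
   a set of reals since d pi(X) is essentially skew-adjoint. *)
Definition s_pi (X : osc A) : \bar R :=
  ereal_sup [set r%:E | r in [set r : R | spectrum (closure (i_dpi X)) r%:C]].

Definition semibounded := smooth_rep /\
  exists (U : set (osc A)) (C : R), [/\ open U, U `&` gL !=set0 &
    forall X, U X -> gL X -> (`|s_pi X| <= C%:E)%E].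

Definition BI : set (osc A) := [set X | gL X /\ (s_pi X < +oo)%E].

(* The interior of BI in R x L x R. *)
Definition BI_interior : set (osc A) :=
  [set X | gL X /\ \forall Y \near X, gL Y -> BI Y].

End Representations.
End OscillatorGroup.

(* Main.v *)
(* (a) For a smooth vector [v] of [pi_L], each iterated differential of the orbit map
   [g |-> pi_L(g) v] is equivariant under [G_L] and homogeneous under dilations of
   its tangent directions. Moving the base point to 0 by equivariance and shrinking
   the directions by homogeneity reduces everything to a neighbourhood of 0, where
   continuity gives Lipschitz bounds. Hence all the differentials are locally
   uniformly Cauchy and extend continuously from [G_L] to [G_A].

   (b) For [s > 0] and [y] in [V_A], the adjoint orbit of the element
   [(t - |x|^2/(2s), 0, s)], which lies in [g_L], passes through elements
   [(t', s i A y, s)] that approximate [(t, x, s)], because the range of [D] is dense.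
   So the bounds [<i dpi(X) v, v> <= M |v|^2] spread from the plane [x = 0] to all
   of [W_d]. They bound the spectrum since [i dpi(X)] is essentially self-adjoint on
   the smooth vectors when [X = (t, x, s)] with [s > 0]: the conjugates of
   [r |-> (r t', 0, r s)] preserve the smooth vectors and their generators approximate
   [X], so a deficiency vector would produce an exponentially growing, yet bounded,
   matrix coefficient. *)

Require Import Defs.
From HB Require Import structures.
From mathcomp Require Import all_boot all_order all_algebra sesquilinear.
From mathcomp Require Import complex.
From mathcomp Require Import all_classical all_reals all_analysis.
From mathcomp Require Import ring lra.
Import Order.TTheory GRing.Theory Num.Theory.
Import numFieldNormedType.Exports.
Set Implicit Arguments.
Unset Strict Implicit.
Unset Printing Implicit Defensive.
Local Open Scope classical_set_scope.
Local Open Scope ring_scope.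
Local Open Scope complex_scope.

(** The obstacle in (a) is that continuity on a dense subspace gives no uniformity near a point of
    [V_A] outside [L]: the admissible radii may shrink to 0 along an approximating sequence. Hence a
    single neighbourhood has to serve for all points. Each extension spends one order of
    differentiability, which is harmless for smooth vectors. The iterated tangent spaces are kept
    abstract ([tdata]), so that the induction can replace a space and a map by the tangent space and
    the differential. In (b), bounds are carried by numerical ranges rather than spectra, because
    these behave well under sums, limits and the adjoint action. Passing from spectrum to numerical
    range uses symmetry only; the way back needs the deficiency argument. There the approximants
    [y], with [i A y] close to [x / s], come without any control of their norm, since 0 may lie in
    the spectrum of [A]. Only [gamma(r) y - y] matters, and its norm is at most [|r| |A y|]. The
    lower bound on [s_pi] that semiboundedness demands comes from one nonzero smooth vector. *)

Notation "r *^ x" := ((r : _)%:C *: x) (at level 40, left associativity).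
Notation im := (0 +i* 1).

(** * Real inner product and calculus in a complex Hilbert space *)

Section RealInnerProduct.
Context (R : realType) (H : hilbertType R).
Implicit Types (x y z u : H) (r e : R).

Definition rdot x y : R := complex.Re (dotp x y).
Definition nm x : R := Num.sqrt (rdot x x).

Lemma dotpC x y : dotp y x = (dotp x y)^*%C.
Proof.
have := hermC (@dotp R H) y x; rewrite expr0 mul1r => -> /=.
by [].
Qed.

Lemma dotpDl x y z : dotp (x + y) z = dotp x z + dotp y z.
Proof. exact: linearDl. Qed.
Lemma dotpZl (c : R[i]) x z : dotp (c *: x) z = c * dotp x z.
Proof. exact: linearZl_LR. Qed.
Lemma dotpZr (c : R[i]) x z : dotp z (c *: x) = c^*%C * dotp z x.
Proof. exact: linearZr_LR. Qed.

Lemma rdotC x y : rdot x y = rdot y x.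
Proof. by rewrite /rdot (dotpC y x); case: (dotp y x). Qed.

Lemma rdotDl x y z : rdot (x + y) z = rdot x z + rdot y z.
Proof. by rewrite /rdot dotpDl; case: (dotp x z) (dotp y z) => [a b] []. Qed.
Lemma rdotDr x y z : rdot z (x + y) = rdot z x + rdot z y.
Proof. by rewrite rdotC rdotDl !(rdotC _ z). Qed.
Lemma rdotZl r x z : rdot (r *^ x) z = r * rdot x z.
Proof. by rewrite /rdot dotpZl; case: (dotp x z) => a b /=; rewrite mul0r subr0. Qed.
Lemma rdotZr r x z : rdot z (r *^ x) = r * rdot z x.
Proof. by rewrite rdotC rdotZl rdotC. Qed.
Lemma rdotNl x z : rdot (- x) z = - rdot x z.
Proof. by rewrite -[- x]scaleN1r -(rmorph1 (real_complex R)) -rmorphN rdotZl mulN1r. Qed.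
Lemma rdotNr x z : rdot z (- x) = - rdot z x.
Proof. by rewrite rdotC rdotNl rdotC. Qed.
Lemma rdotBl x y z : rdot (x - y) z = rdot x z - rdot y z.
Proof. by rewrite rdotDl rdotNl. Qed.
Lemma rdotBr x y z : rdot z (x - y) = rdot z x - rdot z y.
Proof. by rewrite rdotDr rdotNr. Qed.
Lemma rdot0l z : rdot 0 z = 0.
Proof. by rewrite -(subrr z) rdotBl subrr. Qed.
Lemma rdot0r z : rdot z 0 = 0.
Proof. by rewrite rdotC rdot0l. Qed.
Lemma rdot_iNr x y : rdot (im *: x) y = - rdot x (im *: y).
Proof.
by rewrite /rdot dotpZl dotpZr; case: (dotp x y) => a b /=; simpc; rewrite /= ?opprK.
Qed.
Lemma rdot_ii x y : rdot (im *: x) (im *: y) = rdot x y.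
Proof.
rewrite rdot_iNr scalerA.
have -> : im * im = (-1)%:C :> R[i] by simpc.
by rewrite rdotZr mulN1r opprK.
Qed.

Lemma imII x : im *: (im *: x) = - x.
Proof. by rewrite scalerA -[RHS]scaleN1r; congr (_ *: _); simpc. Qed.

Lemma scaleCA (r : R) (c : R[i]) x : c *: (r *^ x) = r *^ (c *: x).
Proof. by rewrite !scalerA mulrC. Qed.

Lemma dotpRI x y : dotp x y = rdot x y +i* rdot x (im *: y).
Proof. by rewrite /rdot dotpZr; case: (dotp x y) => a b /=; simpc. Qed.

Lemma rdot_ge0 x : 0 <= rdot x x.
Proof. by have := dnorm_ge0 (@dotp R H) x; rewrite lecE => /andP[]. Qed.

Lemma rdotxx x : rdot x x = nm x ^+ 2.
Proof. by rewrite sqr_sqrtr // rdot_ge0. Qed.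

Lemma nm_ge0 x : 0 <= nm x. Proof. exact: sqrtr_ge0. Qed.

Lemma normE x : `|x| = (nm x)%:C.
Proof.
apply/eqP; rewrite -(@eqrXn2 _ 2) //; last by rewrite ler0c nm_ge0.
rewrite dotp_norm -rmorphXn /= -rdotxx.
have : dotp x x \is Num.real by rewrite realE dnorm_ge0.
by move=> /RRe_real <-.
Qed.

Lemma nm_eq0 x : nm x = 0 -> x = 0.
Proof. by move=> h; apply/normr0_eq0; rewrite normE h. Qed.
Lemma nm0 : nm 0 = 0.
Proof. by apply: (@complexI R); rewrite -normE normr0. Qed.
Lemma nmN x : nm (- x) = nm x.
Proof. by rewrite /nm rdotNl rdotNr opprK. Qed.
Lemma nmBC x y : nm (x - y) = nm (y - x).
Proof. by rewrite -nmN opprB. Qed.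
Lemma nmD x y : nm (x + y) <= nm x + nm y.
Proof. by rewrite -lecR rmorphD /= -!normE ler_normD. Qed.
Lemma nmZ r x : nm (r *^ x) = `|r| * nm x.
Proof.
by rewrite /nm rdotZl rdotZr mulrA -expr2 sqrtrM ?sqr_ge0 // sqrtr_sqr.
Qed.
Lemma nm_i x : nm (im *: x) = nm x.
Proof. by rewrite /nm rdot_ii. Qed.
Lemma nmB_tri z x y : nm (x - y) <= nm (x - z) + nm (z - y).
Proof. by apply: le_trans (nmD _ _); rewrite addrA subrK. Qed.
Lemma nm_tri x y : nm x <= nm (x - y) + nm y.
Proof. by apply: le_trans (nmD _ _); rewrite subrK. Qed.

Lemma rdot_le x y : rdot x y <= nm x * nm y.
Proof.
have [/nm_eq0 ->|ny] := eqVneq (nm y) 0; first by rewrite rdot0r nm0 mulr0.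
have py : 0 < nm y by rewrite lt_def ny nm_ge0.
have := rdot_ge0 ((nm y) *^ x - (nm x) *^ y).
rewrite rdotBl !rdotBr !rdotZl !rdotZr !rdotxx (rdotC y x) => h.
have [hx|px] := leP (nm x) 0.
  have -> : x = 0 by apply: nm_eq0; apply/eqP; rewrite eq_le hx nm_ge0.
  by rewrite rdot0l nm0 mul0r.
have : 0 <= nm x * nm y * (2 * (nm x * nm y - rdot x y)).
  by apply: le_trans h _; rewrite le_eqVlt; apply/orP; left; apply/eqP; ring.
by rewrite !pmulr_rge0 ?mulr_gt0 // subr_ge0.
Qed.

Lemma rdot_abs x y : `|rdot x y| <= nm x * nm y.
Proof.
rewrite ler_norml rdot_le andbT lerNl -rdotNl.
by apply: le_trans (rdot_le _ _) _; rewrite nmN.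
Qed.

Lemma nm_le_test x e : 0 <= e -> (forall u, rdot x u <= e * nm u) -> nm x <= e.
Proof.
move=> e0 h; have := h x; rewrite rdotxx expr2 => h1.
have [hx|px] := leP (nm x) 0; first exact: le_trans hx e0.
by rewrite -(ler_pM2r px).
Qed.

Lemma nm_parallelogram x y :
  nm (x + y) ^+ 2 + nm (x - y) ^+ 2 = 2 * nm x ^+ 2 + 2 * nm y ^+ 2.
Proof.
by rewrite -!rdotxx !rdotDl !rdotDr !rdotNl !rdotNr (rdotC y x); ring.
Qed.

Lemma eq_nm x y : (forall e, 0 < e -> nm (x - y) < e) -> x = y.
Proof.
move=> h; apply/eqP; rewrite -subr_eq0; apply/eqP/nm_eq0.
apply/eqP; rewrite eq_le nm_ge0 andbT leNgt; apply/negP => /h.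
by rewrite ltxx.
Qed.

Lemma cvg_nm (T : Type) (F : set_system T) (FF : Filter F) (f : T -> H) y :
  f @ F --> y <-> forall e : R, 0 < e -> \forall t \near F, nm (f t - y) < e.
Proof.
split.
  move=> /cvgrPdist_lt h e e0.
  have /h : (0 : R[i]) < e%:C by rewrite ltcR.
  by apply: filterS => t; rewrite normE ltcR nmBC.
move=> h; apply/cvgrPdist_lt => e e0.
have er : e = (complex.Re e)%:C by rewrite RRe_real // realE ltW.
have : 0 < complex.Re e by rewrite -ltcR -er.
by move=> /h; apply: filterS => t; rewrite er normE ltcR nmBC.
Qed.

Lemma nbhs_nm (x : H) (Q : set H) :
  nbhs x Q <-> exists2 e : R, 0 < e & forall y, nm (y - x) < e -> Q y.
Proof.
split.
  move=> /nbhs_normP [e /= e0 h].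
  have er : e = (complex.Re e)%:C by rewrite RRe_real // realE ltW.
  exists (complex.Re e); first by rewrite -ltcR -er.
  by move=> y hy; apply: h; rewrite /ball_ /= er normE ltcR nmBC.
move=> [e e0 h]; apply/nbhs_normP; exists e%:C => /=; first by rewrite ltcR.
by move=> y; rewrite /ball_ /= normE ltcR nmBC; apply: h.
Qed.

Lemma rdot_ext x y : (forall u, rdot x u = rdot y u) -> x = y.
Proof.
move=> h; apply/eqP; rewrite -subr_eq0; apply/eqP/nm_eq0/eqP.
by rewrite -sqrf_eq0 -rdotxx rdotBl h subrr.
Qed.

End RealInnerProduct.

(** Identities between real combinations of vectors become polynomial identities over [R] after
    pairing with an arbitrary vector, where [ring] applies; [rdot_iNr] moves a factor [im] onto that
    vector. *)
Ltac hring := apply: rdot_ext => ?; rewrite ?(rdotDl, rdotNl, rdotZl, rdot0l, rdot_iNr); ring.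

(** * Derivatives of curves and mean value inequalities *)

Section RealDerivatives.
Context (R : realType).

(** The non-strict inequality is trivial at [h = 0], so later estimates need neither punctured
    neighbourhoods nor division by [h]. *)
Definition hasdR (f : R -> R) (t l : R) :=
  forall e : R, 0 < e -> exists2 d : R, 0 < d &
    forall h, `|h| < d -> `|f (t + h) - f t - h * l| <= e * `|h|.

Lemma hasdR_is_derive (f : R -> R) (t l : R) : hasdR f t l -> is_derive t 1 f l.
Proof.
move=> hf.
have hc : h^-1 *: ((f \o shift t) (h *: (1 : R)) - f t) @[h --> 0^'] --> l.
  apply/cvgrPdist_lt => e e0.
  have [d d0 hd] := hf (e / 2) (divr_gt0 e0 (ltr0Sn _ 1)).
  apply/nbhs_ballP; exists d => //= h.
  rewrite /ball /= sub0r normrN => hhd h0.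
  have /= hh := hd _ hhd.
  have h0' : 0 < `|h| by rewrite normr_gt0.
  rewrite /shift /= [h *: 1]mulr1 distrC -(ltr_pM2r h0') -normrM.
  rewrite mulrBl -[_ *: _]/(_ * _) mulrAC mulVf // mul1r (addrC h t) (mulrC l).
  apply: le_lt_trans hh _; rewrite ltr_pM2r //.
  by rewrite ltr_pdivrMr // ltr_pMr // ltr1n.
apply: DeriveDef; first exact: cvgP hc.
exact: cvg_lim hc.
Qed.

Lemma mvt_der (f f' : R -> R) (a b M : R) : a <= b ->
  (forall t, a <= t <= b -> is_derive t 1 f (f' t)) ->
  (forall t, a <= t <= b -> `|f' t| <= M) -> `|f b - f a| <= M * (b - a).
Proof.
rewrite le_eqVlt => /orP[/eqP -> _ _|ab hd hM].
  by rewrite !subrr normr0 mulr0.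
have [||c] := @MVT R f f' a b ab.
- by move=> x; rewrite in_itv /= => /andP[/ltW ax /ltW xb]; apply: hd; rewrite ax xb.
- apply: derivable_within_continuous => x; rewrite in_itv /= => hx.
  by have := hd _ hx; case.
rewrite in_itv /= => /andP[/ltW ac /ltW cb] ->.
have ba : 0 <= b - a by rewrite subr_ge0 ltW.
by rewrite normrM (ger0_norm ba) ler_wpM2r // hM // ac cb.
Qed.

Lemma mvt_R (f f' : R -> R) (a b M : R) : a <= b ->
  (forall t, a <= t <= b -> hasdR f t (f' t)) ->
  (forall t, a <= t <= b -> `|f' t| <= M) -> `|f b - f a| <= M * (b - a).
Proof.
by move=> ab hf; apply: mvt_der ab _ => t /hf; apply: hasdR_is_derive.
Qed.

End RealDerivatives.

Lemma invSn_small (R : realType) (e : R) : 0 < e ->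
  exists N : nat, forall n, (N <= n)%N -> n.+1%:R^-1 < e.
Proof.
move=> e0; have [N _ hN] := near_infty_natSinv_lt (PosNum e0).
by exists N => n /hN.
Qed.

Section HilbertCalculus.
Context (R : realType) (K : hilbertType R).
Implicit Types (x y z u v w : K).

Definition hasd (c : R -> K) (t : R) w :=
  forall e : R, 0 < e -> exists2 d : R, 0 < d &
    forall h, `|h| < d -> nm (c (t + h) - c t - h *^ w) <= e * `|h|.

Lemma real_deriv0P (c : R -> K) w : real_deriv0 c w <-> hasd c 0 w.
Proof.
rewrite /real_deriv0 cvg_nm; split=> h e e0.
  have := h _ e0 => /nbhs_ballP [d /= d0 hd].
  exists d => // t td; have [->|t0] := eqVneq t 0.
    by rewrite addr0 subrr rmorph0 scale0r subrr nm0 normr0 mulr0.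
  have := hd t; rewrite /ball /= sub0r normrN => /(_ td t0) h1.
  have -> : c (0 + t) - c 0 - t *^ w = t *^ (t^-1 *^ (c t - c 0) - w).
    by rewrite add0r scalerBr scalerA -rmorphM /= divff // scale1r.
  by rewrite nmZ mulrC ler_wpM2r // ltW.
have [d d0 hd] := h (e / 2) (divr_gt0 e0 (ltr0Sn _ 1)).
apply/nbhs_ballP; exists d => //= t.
rewrite /ball /= sub0r normrN => td t0.
have h0 : 0 < `|t| by rewrite normr_gt0.
rewrite -(ltr_pM2l h0) -nmZ.
have -> : t *^ (t^-1 *^ (c t - c 0) - w) = c (0 + t) - c 0 - t *^ w.
  by rewrite add0r scalerBr scalerA -rmorphM /= divff // scale1r.
apply: le_lt_trans (hd _ td) _; rewrite mulrC ltr_pM2l //.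
by rewrite ltr_pdivrMr // ltr_pMr // ltr1n.
Qed.

Lemma hasd_rdot (c : R -> K) t w u : hasd c t w -> hasdR (fun t => rdot (c t) u) t (rdot w u).
Proof.
move=> hc e e0.
have n0 : 0 < nm u + 1 by rewrite ltr_wpDl ?nm_ge0.
have [d d0 hd] := hc _ (divr_gt0 e0 n0).
exists d => // h /hd hh.
rewrite -rdotZl -!rdotBl; apply: le_trans (rdot_abs _ _) _.
apply: le_trans (ler_wpM2r (nm_ge0 _) hh) _.
rewrite mulrAC ler_wpM2r // -mulrA ger_pMr // mulrC ler_pdivrMr // mul1r.
by rewrite lerDl.
Qed.

Lemma hasd_lin (c : R -> K) t w u : hasd c t w -> hasd (fun t => c t - t *^ u) t (w - u).
Proof.
move=> hc e /hc [d d0 hd]; exists d => // h /hd; congr (nm _ <= _).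
by hring.
Qed.

(** Pairing [c t - t *^ w] with a test vector [u] reduces the claim to the real mean value
    inequality with bound [M * nm u]. *)
Lemma mvt_nm (c c' : R -> K) w (a b M : R) : a <= b ->
  (forall t, a <= t <= b -> hasd c t (c' t)) ->
  (forall t, a <= t <= b -> nm (c' t - w) <= M) ->
  nm (c b - c a - (b - a) *^ w) <= M * (b - a).
Proof.
move=> ab hc hM.
have M0 : 0 <= M by apply: le_trans (nm_ge0 _) (hM a _); rewrite lexx ab.
apply: nm_le_test; first by rewrite mulr_ge0 // subr_ge0.
move=> u.
have := @mvt_R _ (fun t => rdot (c t - t *^ w) u) (fun t => rdot (c' t - w) u)
  a b (M * nm u) ab.
have h1 t : a <= t <= b -> hasdR (fun t => rdot (c t - t *^ w) u) t (rdot (c' t - w) u).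
  by move=> /hc ht; apply: hasd_rdot; apply: hasd_lin.
have h2 t : a <= t <= b -> `|rdot (c' t - w) u| <= M * nm u.
  by move=> /hM ht; apply: le_trans (rdot_abs _ _) _; apply: ler_wpM2r; rewrite ?nm_ge0.
move=> /(_ h1 h2) h3.
have -> : c b - c a - (b - a) *^ w = (c b - b *^ w) - (c a - a *^ w).
  by hring.
rewrite rdotBl mulrAC; apply: le_trans h3; exact: ler_norm.
Qed.

Lemma cauchy_nm (u : nat -> K) :
  (forall e : R, 0 < e -> exists N, forall m n, (N <= m)%N -> (N <= n)%N -> nm (u m - u n) < e) ->
  exists l, forall e : R, 0 < e -> exists N, forall n, (N <= n)%N -> nm (u n - l) < e.
Proof.
move=> hu.
have hc : cvg (u @ \oo).
  apply: cauchy_cvg; apply/cauchy_ballP => e e0.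
  have er : e = (complex.Re e)%:C by rewrite RRe_real // realE ltW.
  have e0' : 0 < complex.Re e by rewrite -ltcR -er.
  have [N hN] := hu _ e0'.
  rewrite !near_simpl; exists ([set n | (N <= n)%N], [set n | (N <= n)%N]) => /=.
    by split; exists N.
  move=> [m n] [/= hm hn]; rewrite -ball_normE /ball_ /= er normE ltcR.
  exact: hN.
have hl : u @ \oo --> limn u by [].
exists (limn u) => e e0; move/cvg_nm : hl => /(_ _ e0) [N _ hN]; by exists N => n /hN.
Qed.

(* Hilbert projection: a minimising sequence for the distance to [M] is Cauchy by
   the parallelogram identity. *)
Lemma complete_subspace (M : set K) :
  (forall (r : R) x y, M x -> M y -> M (r *^ x + y)) -> M 0 ->
  (forall y, (forall e : R, 0 < e -> exists2 m, M m & nm (m - y) < e) -> M y) ->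
  (forall w, (forall m, M m -> rdot m w = 0) -> w = 0) -> forall y, M y.
Proof.
move=> Mlin M0 Mcl Mperp y.
pose D : set R := [set nm (y - m) | m in M].
have hD : has_inf D.
  split; first by exists (nm (y - 0)), 0.
  by exists 0 => _ [m _ <-]; apply: nm_ge0.
pose d := inf D.
have dle m : M m -> d <= nm (y - m).
  by move=> Mm; apply: inf_lbound; [case: hD | exists m].
have d0 : 0 <= d.
  apply: lb_le_inf; first by case: hD.
  by move=> _ [m _ <-]; apply: nm_ge0.
have near_inf (n : nat) : exists2 m, M m & nm (y - m) < d + n.+1%:R^-1.
  have [_ [m Mm <-] hm] := inf_adherent (ltac:(by rewrite invr_gt0 ltr0Sn) : 0 < n.+1%:R^-1 :> R) hD.
  by exists m.
have /choice [u hu] : forall n : nat, exists m, M m /\ nm (y - m) < d + n.+1%:R^-1.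
  by move=> n; have [m ? ?] := near_inf n; exists m.
have half x : (2^-1 : R) *^ x + (2^-1 : R) *^ x = x.
  by apply: rdot_ext => ?; rewrite ?(rdotDl, rdotZl); field.
(* The midpoint of [m] and [n] lies in [M], hence at distance at least [d] from [y]; the
   parallelogram identity then forces [m] and [n] together. *)
have key m n e : 0 <= e -> M m -> M n -> nm (y - m) <= d + e -> nm (y - n) <= d + e ->
    nm (m - n) ^+ 2 <= 4 * (2 * d * e + e ^+ 2).
  move=> e0 Mm Mn hm hn.
  have := nm_parallelogram (y - m) (y - n).
  have -> : y - m - (y - n) = n - m by rewrite opprB addrC addrA subrK.
  have -> : y - m + (y - n) = (2 : R) *^ (y - ((2^-1 : R) *^ m + (2^-1 : R) *^ n)).
    by apply: rdot_ext => ?; rewrite ?(rdotDl, rdotNl, rdotZl); field.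
  rewrite nmZ ger0_norm // (nmBC m n) => hp.
  have hd : d <= nm (y - ((2^-1 : R) *^ m + (2^-1 : R) *^ n)).
    apply: dle; apply: (Mlin) => //; rewrite -[X in M X]addr0; exact: Mlin.
  have p1 := nm_ge0 (y - m); have p2 := nm_ge0 (y - n).
  set q := nm (y - (_ + _)) in hp hd; nra.
have [m hm] : exists l, forall e : R, 0 < e -> exists N, forall n, (N <= n)%N -> nm (u n - l) < e.
  apply: cauchy_nm => e e0.
  have [eta eta0 heta] : exists2 eta : R, 0 < eta & 4 * (2 * d * eta + eta ^+ 2) < e ^+ 2.
    pose b := 1 + d + e.
    have b0 : 0 < b by rewrite /b; lra.
    have e2 : 0 < e ^+ 2 by rewrite exprn_gt0.
    (* Since [d <= b] and [t <= 1 <= b], the factor [8 d + 4 t] below is at most [12 b], hence less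
       than [16 b b]. *)
    pose t := e ^+ 2 / (16 * b * b).
    have hb : 0 < 16 * b * b by rewrite !mulr_gt0.
    have t0 : 0 < t by rewrite divr_gt0.
    have ht : t * (16 * b * b) = e ^+ 2 by rewrite /t divfK // gt_eqF.
    have t1 : t <= 1 by rewrite /t ler_pdivrMr // mul1r /b; nra.
    exists t => //; rewrite -ht.
    have : d <= b by rewrite /b; lra.
    have : 1 <= b by rewrite /b; lra.
    move=> b1 db.
    have -> : 4 * (2 * d * t + t ^+ 2) = t * (8 * d + 4 * t) by ring.
    rewrite ltr_pM2l //; nra.
  have [N hN'] := invSn_small eta0.
  have hN n : (N <= n)%N -> n.+1%:R^-1 <= eta by move=> /hN' /ltW.
  exists N => i j /hN hi /hN hj.
  have [Mi hi'] := hu i; have [Mj hj'] := hu j.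
  rewrite -(@ltr_pXn2r _ 2) // ?nnegrE ?nm_ge0 // ?ltW //.
  apply: le_lt_trans heta; apply: key => //; first exact: ltW.
    by apply: le_trans (ltW hi') _; rewrite lerD2l.
  by apply: le_trans (ltW hj') _; rewrite lerD2l.
have Mm : M m.
  by apply: Mcl => e /hm [N hN]; exists (u N); [case: (hu N) | apply: hN].
have dm0 (e : R) : 0 < e -> nm (y - m) <= d + e.
  move=> e0.
  have e2 : 0 < e / 2 by rewrite divr_gt0.
  have [N hN] := hm _ e2.
  have [N2 hN2] := invSn_small e2.
  pose N' := maxn N N2.
  have h1 := hN N' (leq_maxl _ _).
  have [_ h2] := hu N'.
  have h3 := hN2 N' (leq_maxr _ _).
  have {h2 h3} h4 : nm (y - u N') < d + e / 2 by apply: lt_trans h2 _; rewrite ltrD2l.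
  have := nmB_tri (u N') y m; move: h1 h4; clear; lra.
have dm : nm (y - m) <= d by apply/ler_addgt0Pr.
suff : y - m = 0 by move=> /eqP; rewrite subr_eq0 => /eqP ->.
apply: Mperp => n Mn; rewrite rdotC.
set w := y - m in dm *.
have hq (t : R) : 0 <= t ^+ 2 * nm n ^+ 2 - 2 * t * rdot w n.
  have : d <= nm (w - t *^ n).
    by rewrite /w -addrA -opprD; apply: dle; rewrite addrC; apply: Mlin.
  move=> h; have : nm w ^+ 2 <= nm (w - t *^ n) ^+ 2.
    by rewrite lerXn2r ?nnegrE ?nm_ge0 // (le_trans dm).
  clearbody w.
  rewrite -(rdotxx (w - _)) rdotBl !rdotBr !rdotZl !rdotZr !rdotxx (rdotC n w).
  clear; lra.
have hn : 0 < nm n ^+ 2 + 1 by rewrite ltr_wpDl // exprn_ge0 // nm_ge0.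
(* The quadratic is minimal at [rdot w n / nm n ^+ 2]. The added 1 avoids the case [n = 0], and the
   value is still negative unless [rdot w n = 0]. *)
have := hq (rdot w n / (nm n ^+ 2 + 1)).
set p := rdot w n; set q := nm n ^+ 2 in hn *.
have -> : (p / (q + 1)) ^+ 2 * q - 2 * (p / (q + 1)) * p = - (p ^+ 2 * ((q + 2) / (q + 1) ^+ 2)).
  by field; rewrite gt_eqF.
rewrite oppr_ge0 pmulr_lle0; last by rewrite divr_gt0 ?exprn_gt0 //; lra.
by move=> h; apply/eqP; rewrite -sqrf_eq0 eq_le h sqr_ge0.
Qed.

End HilbertCalculus.

(** * Spaces graded by an increasing sequence of seminorms *)

Lemma min_lel (R : realDomainType) (x y : R) : Num.min x y <= x.
Proof. by rewrite ge_min lexx. Qed.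
Lemma min_ler (R : realDomainType) (x y : R) : Num.min x y <= y.
Proof. by rewrite ge_min lexx orbT. Qed.

Definition sublin (R : realType) (E : lmodType R) (S : set E) :=
  S 0 /\ forall (r : R) x y, S x -> S y -> S (r *: x + y).

Section Sublin.
Context (R : realType) (E : lmodType R) (S : set E) (hS : sublin S).
Lemma sublin0 : S 0. Proof. by case: hS. Qed.
Lemma sublinZ (r : R) x : S x -> S (r *: x).
Proof. by move=> Sx; case: hS => S0 h; rewrite -[_ *: _]addr0; apply: h. Qed.
Lemma sublinD x y : S x -> S y -> S (x + y).
Proof. by move=> Sx Sy; case: hS => S0 h; rewrite -[x]scale1r; apply: h. Qed.
Lemma sublinN x : S x -> S (- x).
Proof. by move=> Sx; rewrite -scaleN1r; apply: sublinZ. Qed.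
Lemma sublinB x y : S x -> S y -> S (x - y).
Proof. by move=> Sx Sy; apply: sublinD => //; apply: sublinN. Qed.
End Sublin.

Lemma sublinX (R : realType) (E E' : lmodType R) (S : set E) (S' : set E') :
  sublin S -> sublin S' -> sublin (S `*` S').
Proof.
move=> [S0 hS] [S0' hS']; split => // r x y [/= ? ?] [/= ? ?].
by split; [apply: hS | apply: hS'].
Qed.

(* [P] induces the given topology only on [V]; off [V] its values are junk. *)
Record graded (R : realType) (E : preTopologicalLmodType R) (V : set E)
    (P : nat -> E -> R) : Prop := Graded {
  grV : sublin V ;
  gr_ge0 : forall k x, 0 <= P k x ;
  grD : forall k x y, V x -> V y -> P k (x + y) <= P k x + P k y ;
  grZ : forall k r x, V x -> P k (r *: x) = `|r| * P k x ;
  gr_mono : forall k l x, (k <= l)%N -> P k x <= P l x ;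
  gr_nbhs : forall p Q, V p -> within V (nbhs p) Q <->
    exists k, exists2 d : R, 0 < d & forall q, V q -> P k (q - p) < d -> Q q
}.

(** The point [p] may lie outside [S]; limits at such points are the values of the extensions. *)
Definition tends (R : realType) (K : hilbertType R) (E : preTopologicalLmodType R)
    (P : nat -> E -> R) (S : set E) (f : E -> K) (p : E) (w : K) :=
  forall e : R, 0 < e -> exists k, exists2 d : R, 0 < d &
    forall q, S q -> P k (q - p) < d -> nm (f q - w) < e.

Definition cont (R : realType) (K : hilbertType R) (E : preTopologicalLmodType R)
    (P : nat -> E -> R) (S : set E) (f : E -> K) :=
  forall p, S p -> tends P S f p (f p).

Definition has_dir (R : realType) (K : hilbertType R) (E : preTopologicalLmodType R)
    (S : set E) (f : E -> K) (df : E * E -> K) :=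
  forall x h, S x -> S h -> hasd (fun t : R => f (x + t *: h)) 0 (df (x, h)).

Definition sumP (R : realType) (E E' : Type) (P : nat -> E -> R) (P' : nat -> E' -> R) k
  (x : E * E') := P k x.1 + P' k x.2.

Section GradedTheory.
Context (R : realType) (E : preTopologicalLmodType R) (V : set E) (P : nat -> E -> R).
Hypothesis gE : graded V P.

Lemma gr0 k : P k 0 = 0.
Proof. by rewrite -(scale0r 0) (grZ gE) ?normr0 ?mul0r //; apply: sublin0 (grV gE). Qed.
Lemma grN k x : V x -> P k (- x) = P k x.
Proof. by move=> Vx; rewrite -scaleN1r (grZ gE) // normrN normr1 mul1r. Qed.
Lemma grBC k x y : V x -> V y -> P k (x - y) = P k (y - x).
Proof. by move=> Vx Vy; rewrite -grN ?opprB //; apply: sublinB (grV gE) _ _ _ _. Qed.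
Lemma grB_tri k z x y : V x -> V y -> V z -> P k (x - y) <= P k (x - z) + P k (z - y).
Proof.
move=> Vx Vy Vz; have -> : x - y = (x - z) + (z - y) by rewrite addrA subrK.
by apply: (grD gE); apply: (sublinB (grV gE)).
Qed.
Lemma gr_tri k x y : V x -> V y -> P k x <= P k (x - y) + P k y.
Proof.
move=> Vx Vy; rewrite -{1}(subrK y x); apply: (grD gE) => //.
by apply: (sublinB (grV gE)).
Qed.

Lemma tends_uniq (K : hilbertType R) S (f : E -> K) p w w' :
  (forall k (e : R), 0 < e -> exists2 q, S q & P k (q - p) < e) ->
  tends P S f p w -> tends P S f p w' -> w = w'.
Proof.
move=> dens h h'; apply: eq_nm => e e0.
have e2 : 0 < e / 2 by rewrite divr_gt0.
have [k [d d0 hd]] := h _ e2; have [k' [d' d0' hd']] := h' _ e2.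
have [|q Sq hq] := dens (maxn k k') (Num.min d d'); first by rewrite lt_min d0 d0'.
have := hd q Sq (le_lt_trans (gr_mono gE _ (leq_maxl k k')) (lt_le_trans hq (min_lel _ _))).
have := hd' q Sq (le_lt_trans (gr_mono gE _ (leq_maxr k k')) (lt_le_trans hq (min_ler _ _))).
have := nmB_tri (f q) w w'; rewrite (nmBC w (f q)); move: e0; clear; lra.
Qed.

Lemma tendsP (K : hilbertType R) S (f : E -> K) p w : S `<=` V -> V p ->
  (f @ within S (nbhs p) --> w) <-> tends P S f p w.
Proof.
move=> SV Vp; split => [/cvg_nm|] h.
  move=> e e0.
  have h1 : nbhs p (fun q => S q -> nm (f q - w) < e) := h e e0.
  have : within V (nbhs p) [set q | S q -> nm (f q - w) < e].
    by apply: filterS h1 => q hq _.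
  by move=> /(gr_nbhs gE _ Vp) [k [d d0 hd]]; exists k, d => // q Sq hq; exact: (hd q (SV _ Sq) hq Sq).
apply/cvg_nm => e /h [k [d d0 hd]].
have : within V (nbhs p) [set q | S q -> nm (f q - w) < e].
  by apply/(gr_nbhs gE _ Vp); exists k, d => // q Vq hq Sq; exact: hd.
move=> h1; suff : nbhs p (fun q => S q -> nm (f q - w) < e) by [].
have h2 : nbhs p (fun q => V q -> S q -> nm (f q - w) < e) := h1.
by apply: filterS h2 => q h3 Sq; exact: (h3 (SV _ Sq) Sq).
Qed.

Lemma contP (K : hilbertType R) S (f : E -> K) : S `<=` V ->
  {within S, continuous f} <-> cont P S f.
Proof.
move=> SV; rewrite subspace_continuousP; split => h p Sp.
  by apply/tendsP => //; [apply: SV | apply: h].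
by apply/tendsP => //; [apply: SV | apply: h].
Qed.

End GradedTheory.

Lemma gradedX (R : realType) (E E' : preTopologicalLmodType R) V P V' P' :
  @graded R E V P -> @graded R E' V' P' -> graded (V `*` V') (sumP P P').
Proof.
move=> g g'; split.
- exact: sublinX (grV g) (grV g').
- by move=> k x; rewrite addr_ge0 // (gr_ge0 g, gr_ge0 g').
- move=> k x y [/= ? ?] [/= ? ?]; rewrite /sumP addrACA lerD //; first exact: grD g _ _ _ _ _.
  exact: grD g' _ _ _ _ _.
- by move=> k r x [/= ? ?]; rewrite /sumP mulrDr; congr (_ + _); [apply: (grZ g) | apply: (grZ g')].
- by move=> k l x kl; rewrite lerD // (gr_mono g, gr_mono g').
- move=> [p p'] Q [/= Vp Vp']; split.
    move=> [[/= A B] [hA hB] hAB].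
    have : within V (nbhs p) A by apply: filterS hA => q Aq _.
    move=> /(gr_nbhs g _ Vp) [k [d d0 hd]].
    have : within V' (nbhs p') B by apply: filterS hB => q Aq _.
    move=> /(gr_nbhs g' _ Vp') [k' [d' d0' hd']].
    exists (maxn k k'), (Num.min d d'); first by rewrite lt_min d0 d0'.
    move=> [q q'] [/= Vq Vq']; rewrite /sumP /= => hq.
    apply: (hAB (q, q')); split => //=.
      apply: hd => //; apply: le_lt_trans (lt_le_trans hq (min_lel _ _)).
      apply: le_trans (gr_mono g _ (leq_maxl k k')) _; by rewrite lerDl (gr_ge0 g').
    apply: hd' => //; apply: le_lt_trans (lt_le_trans hq (min_ler _ _)).
    apply: le_trans (gr_mono g' _ (leq_maxr k k')) _; by rewrite lerDr (gr_ge0 g).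
  move=> [k [d d0 hd]].
  have d2 : 0 < d / 2 by rewrite divr_gt0.
  have hA : within V (nbhs p) [set q | P k (q - p) < d / 2].
    by apply/(gr_nbhs g _ Vp); exists k, (d / 2).
  have hB : within V' (nbhs p') [set q | P' k (q - p') < d / 2].
    by apply/(gr_nbhs g' _ Vp'); exists k, (d / 2).
  exists ([set q | V q -> P k (q - p) < d / 2], [set q | V' q -> P' k (q - p') < d / 2]) => //=.
  move=> [q q'] [/= h1 h2] [/= Vq Vq']; apply: hd => //.
  by rewrite /sumP /= [ltRHS](splitr d) ltrD // (h1, h2).
Qed.

(** * Directional derivatives on graded spaces *)

Section Directional.
Context (R : realType) (K : hilbertType R).

Lemma hasd_unique (c : R -> K) t w w' : hasd c t w -> hasd c t w' -> w = w'.
Proof.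
move=> h h'; apply: eq_nm => e e0.
have e4 : 0 < e / 4 by rewrite divr_gt0.
have [d d0 hd] := h _ e4; have [d' d0' hd'] := h' _ e4.
pose s := Num.min d d' / 2.
have m0 : 0 < Num.min d d' by rewrite lt_min d0 d0'.
have s0 : 0 < s by rewrite divr_gt0.
have hs : `|s| < Num.min d d' by rewrite gtr0_norm // /s ltr_pdivrMr // ltr_pMr // ltr1n.
have := hd s (lt_le_trans hs (min_lel _ _)); have := hd' s (lt_le_trans hs (min_ler _ _)).
rewrite gtr0_norm // -(ltr_pM2r s0) => h1 h2.
have : nm (s *^ (w - w')) <= e / 4 * s + e / 4 * s.
  have -> : s *^ (w - w') = (c (t + s) - c t - s *^ w') - (c (t + s) - c t - s *^ w) by hring.
  by apply: le_trans (nmD _ _) _; rewrite nmN lerD.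
rewrite nmZ gtr0_norm // [s * _]mulrC; move: s0 e0; clear; nra.
Qed.

Lemma hasd_scale (c : R -> K) (a : R) w : hasd c 0 w -> hasd (fun t => c (a * t)) 0 (a *^ w).
Proof.
move=> h e e0.
have a0 : 0 < `|a| + 1 by rewrite ltr_wpDl.
have [d d0 hd] := h _ (divr_gt0 e0 a0).
exists (d / (`|a| + 1)); first by rewrite divr_gt0.
move=> t ht; have := hd (a * t); rewrite !add0r mulr0 => hh.
have -> : t *^ (a *^ w) = (a * t) *^ w by hring.
have le1 : `|a * t| <= (`|a| + 1) * `|t| by rewrite normrM ler_wpM2r // lerDl.
apply: le_trans (hh _) _.
  by apply: le_lt_trans le1 _; rewrite mulrC -ltr_pdivlMr.
apply: le_trans (ler_wpM2l _ le1) _; first by rewrite divr_ge0 ?ltW.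
by rewrite mulrA divfK // gt_eqF.
Qed.

Context (E : preTopologicalLmodType R) (V S : set E) (P : nat -> E -> R).
Hypothesis gE : graded V P.
Hypothesis hS : sublin S.
Hypothesis SV : S `<=` V.
Variables (f : E -> K) (df : E * E -> K).
Hypothesis hf : has_dir S f df.

Lemma has_dir_line x h (t : R) : S x -> S h ->
  hasd (fun t : R => f (x + t *: h)) t (df (x + t *: h, h)).
Proof.
move=> Sx Sh e e0.
have Sxt : S (x + t *: h) by apply: sublinD => //; apply: sublinZ.
have [d d0 hd] := hf Sxt Sh e0; exists d => // s /hd.
by rewrite add0r scale0r addr0 (scalerDl h t s) (addrA x).
Qed.

Lemma mvt_dir x h w M : S x -> S h ->
  (forall t : R, 0 <= t <= 1 -> nm (df (x + t *: h, h) - w) <= M) ->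
  nm (f (x + h) - f x - w) <= M.
Proof.
move=> Sx Sh hM.
have := @mvt_nm _ _ (fun t => f (x + t *: h)) (fun t => df (x + t *: h, h)) w 0 1 M ler01.
rewrite scale1r scale0r addr0 subr0 rmorph1 scale1r mulr1; apply => // t _.
exact: has_dir_line.
Qed.

Lemma dirZ x h (c : R) : S x -> S h -> df (x, c *: h) = c *^ df (x, h).
Proof.
move=> Sx Sh; apply: (@hasd_unique (fun t => f (x + t *: (c *: h))) 0).
  by apply: hf => //; apply: sublinZ.
have := hasd_scale c (hf Sx Sh).
by congr (hasd _ _ _); apply/funext => t; rewrite scalerA mulrC.
Qed.

(** The mean value inequality on the segment from [x'] to [x' + t h'] turns a limit of [df] at
    [(x, h)] into an estimate of difference quotients uniform in [(x', h')]. Only these approximants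
    have to lie in [S], so it applies at points of [V] where [f] itself is not yet meaningful. *)
Lemma uniform_dir x h w : V x -> V h -> tends (sumP P P) (S `*` S) df (x, h) w ->
  forall e : R, 0 < e -> exists l, exists2 d : R, 0 < d &
  forall t x' h', S x' -> S h' -> P l (x' - x) < d -> P l (h' - h) < d -> `|t| < d ->
    nm (f (x' + t *: h') - f x' - t *^ w) <= e * `|t|.
Proof.
move=> Vx Vh hw e e0.
have [k [d d0 hd]] := hw _ e0.
have c0 : 0 < 2 * (3 + P k h) by rewrite mulr_gt0 // ltr_wpDr // (gr_ge0 gE).
(* The displacement of base point and direction together is at most [d1 * (1 + (P k h + 1) + 1)],
   which is at most [d / 2]. *)
pose d1 := Num.min 1 (d / (2 * (3 + P k h))).
have d10 : 0 < d1 by rewrite lt_min ltr01 divr_gt0.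
have d1d : d1 * (2 * (3 + P k h)) <= d by rewrite -ler_pdivlMr //; exact: min_ler.
have d11 : d1 <= 1 by exact: min_lel.
exists k, d1 => // t x' h' Sx' Sh' hx hh ht.
have Vx' := SV Sx'; have Vh' := SV Sh'.
rewrite mulrC; apply: mvt_dir => //; first exact: sublinZ.
move=> s /andP[s0 s1].
have Sxs : S (x' + s *: (t *: h')) by apply: sublinD => //; apply: sublinZ => //; apply: sublinZ.
rewrite dirZ // -scalerBr nmZ ler_wpM2l //; apply: ltW; apply: hd => //.
rewrite /sumP /=.
have h1 : P k (x' + s *: (t *: h') - x) <= P k (x' - x) + `|t| * P k h'.
  have -> : x' + s *: (t *: h') - x = (x' - x) + (s * t) *: h' by rewrite scalerA addrAC.
  apply: le_trans (grD gE _ _ _) _; rewrite ?(grZ gE) //.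
  - exact: sublinB (grV gE) _ _ _ _.
  - exact: sublinZ (grV gE) _ _ _.
  rewrite lerD2l ler_wpM2r ?(gr_ge0 gE) // normrM ger0_norm // ler_piMl //.
have h2 := gr_tri gE k Vh' Vh.
have h3 := gr_ge0 gE k h; have h4 := gr_ge0 gE k h'; have h5 := gr_ge0 gE k (h' - h).
have h6 : `|t| * P k h' <= d1 * (P k h + 1).
  apply: ler_pM => //; first exact: ltW.
  apply: le_trans h2 _; rewrite addrC lerD2l; exact: le_trans (ltW hh) d11.
move: h1 h2 h6 hx hh d10 d1d h3; set a := P k _; set b := P k _; set c := P k _; set q := P k h.
clear; nra.
Qed.

(** The increment along [h + k] is split into one along [h] from [x] and one along [k] from
    [x + t h]. The second base point moves with [t], which is why the uniform estimate, and with it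
    continuity of [df], is needed. *)
Lemma dirD x h k : cont (sumP P P) (S `*` S) df -> S x -> S h -> S k ->
  df (x, h + k) = df (x, h) + df (x, k).
Proof.
move=> hc Sx Sh Sk; apply: (@hasd_unique (fun t => f (x + t *: (h + k))) 0).
  by apply: hf => //; apply: sublinD.
have Vx := SV Sx; have Vh := SV Sh; have Vk := SV Sk.
move=> e e0; have e2 : 0 < e / 2 by rewrite divr_gt0.
have [l [d d0 hd]] := uniform_dir Vx Vh (hc (x, h) (conj Sx Sh)) e2.
have [l' [d' d0' hd']] := uniform_dir Vx Vk (hc (x, k) (conj Sx Sk)) e2.
have hp : 0 < P l' h + 1 by rewrite ltr_wpDl // (gr_ge0 gE).
pose d1 := d' / (P l' h + 1).
have hd1 : d1 * (P l' h + 1) = d' by rewrite divfK // gt_eqF.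
exists (Num.min d (Num.min d' d1)); first by rewrite !lt_min d0 d0' divr_gt0.
move=> t; rewrite !lt_min => /andP[td /andP[td' td1]].
rewrite add0r scale0r addr0.
have -> : f (x + t *: (h + k)) - f x - t *^ (df (x, h) + df (x, k)) =
  (f ((x + t *: h) + t *: k) - f (x + t *: h) - t *^ df (x, k)) +
  (f (x + t *: h) - f x - t *^ df (x, h)).
  by rewrite scalerDr addrA; hring.
apply: le_trans (nmD _ _) _; rewrite [e]splitr mulrDl lerD //.
  apply: hd' => //; first by apply: sublinD => //; apply: sublinZ.
    rewrite addrAC subrr add0r (grZ gE) //.
    apply: le_lt_trans (_ : `|t| * (P l' h + 1) < _); first by rewrite ler_wpM2l // lerDl.
    by rewrite -hd1 ltr_pM2r.
  by rewrite subrr (gr0 gE).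
by apply: hd => //; rewrite subrr (gr0 gE).
Qed.

End Directional.

(** * Continuous extension from a dense subspace *)

Section Extension.
Context (R : realType) (K : hilbertType R) (E : preTopologicalLmodType R).
Context (V S : set E) (P : nat -> E -> R).
Hypothesis gE : graded V P.
Hypothesis hS : sublin S.
Hypothesis SV : S `<=` V.
Hypothesis dS : forall p k (e : R), V p -> 0 < e -> exists2 q, S q & P k (q - p) < e.

Definition locally_cauchy (f : E -> K) := forall p (e : R), V p -> 0 < e ->
  exists k, exists2 d : R, 0 < d & forall q q', S q -> S q' ->
    P k (q - p) < d -> P k (q' - p) < d -> nm (f q - f q') < e.

Definition extends (f g : E -> K) := forall p, V p -> tends P S f p (g p).

(** The approximant [u n] is within [n.+1^-1] for the [n]-th seminorm, so the sequence converges for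
    all seminorms at once. Completeness of [K] gives a limit along it, which the Cauchy condition
    makes the limit along all of [S]. *)
Lemma extension (f : E -> K) : locally_cauchy f -> exists g, extends f g.
Proof.
move=> hf; suff : forall p, exists w, V p -> tends P S f p w.
  by move=> /choice [g hg]; exists g.
move=> p; have [Vp|nV] := pselect (V p); last by exists 0 => /nV.
have /choice [u hu] : forall n : nat, exists q, S q /\ P n (q - p) < n.+1%:R^-1.
  move=> n; have [|q Sq hq] := dS n Vp (_ : 0 < n.+1%:R^-1); first by rewrite invr_gt0 ltr0Sn.
  by exists q.
have near_u k (d : R) : 0 < d -> exists N, forall n, (N <= n)%N -> P k (u n - p) < d.
  move=> d0; have [N hN] := invSn_small d0; exists (maxn N k) => n.
  rewrite geq_max => /andP[Nn kn].
  exact: (le_lt_trans (gr_mono gE _ kn) (lt_trans (hu n).2 (hN _ Nn))).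
have [w hw] : exists l, forall e : R, 0 < e -> exists N, forall n, (N <= n)%N -> nm (f (u n) - l) < e.
  apply: cauchy_nm => e e0; have [k [d d0 hd]] := hf p e Vp e0.
  have [N hN] := near_u k d d0; exists N => m n hm hn.
  by apply: hd; [exact: (hu m).1 | exact: (hu n).1 | exact: hN | exact: hN].
exists w => _ e e0; have e2 : 0 < e / 2 by rewrite divr_gt0.
have [k [d d0 hd]] := hf p _ Vp e2.
exists k, d => // q Sq hq.
have [N hN] := near_u k d d0; have [N' hN'] := hw _ e2.
have h1 := hN _ (leq_maxl N N'); have h2 := hN' _ (leq_maxr N N').
have h3 := hd q _ Sq (hu _).1 hq h1.
have := nmB_tri (f (u (maxn N N'))) (f q) w; lra.
Qed.

Lemma extends_cont (f g : E -> K) : extends f g -> cont P V g.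
Proof.
move=> hg p Vp e e0; have e2 : 0 < e / 2 by rewrite divr_gt0.
have [k [d d0 hd]] := hg p Vp _ e2.
have d2 : 0 < d / 2 by rewrite divr_gt0.
exists k, (d / 2) => // q Vq hq.
have [k' [d' d0' hd']] := hg q Vq _ e2.
have m0 : 0 < Num.min d' (d / 2) by rewrite lt_min d0' d2.
have [q' Sq'] := dS (maxn k k') Vq m0; rewrite lt_min => /andP[h1 h2].
have h3 := hd' q' Sq' (le_lt_trans (gr_mono gE _ (leq_maxr k k')) h1).
have h4 := le_lt_trans (gr_mono gE _ (leq_maxl k k')) h2.
have h5 := grB_tri gE k (SV Sq') Vp Vq.
have h7 : P k (q' - p) < d by lra.
have h6 := hd q' Sq' h7.
have := nmB_tri (f q') (g q) (g p); rewrite (nmBC (g q) (f q')); lra.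
Qed.

Lemma extends_uniq (f g : E -> K) p w : extends f g -> V p -> tends P S f p w -> g p = w.
Proof.
move=> hg Vp hw; apply: (tends_uniq gE _ (hg _ Vp) hw) => k e e0.
exact: dS.
Qed.

(** For fixed [t], the uniform estimate on difference quotients at nearby points of [S] passes to
    the limit, because its right-hand side does not depend on these points. *)
Lemma extends_dir f df g dg : has_dir S f df -> extends f g ->
  (forall p, (V `*` V) p -> tends (sumP P P) (S `*` S) df p (dg p)) -> has_dir V g dg.
Proof.
move=> hf hg hdg x h Vx Vh e e0.
have [l [d d0 hd]] := uniform_dir gE hS SV hf Vx Vh (hdg (x, h) (conj Vx Vh)) e0.
exists d => // t td; rewrite add0r scale0r addr0.
apply/ler_addgt0Pr => eta0 eta00.
have {eta00} [eta eta00 ->] : exists2 eta : R, 0 < eta & eta0 = eta by exists eta0.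
have e2 : 0 < eta / 2 by rewrite divr_gt0.
have Vxt : V (x + t *: h) by apply: (sublinD (grV gE)) => //; apply: (sublinZ (grV gE)).
have [k1 [d1 d10 hd1]] := hg _ Vxt _ e2.
have [k2 [d2 d20 hd2]] := hg _ Vx _ e2.
pose k := maxn l (maxn k1 k2).
have lk : (l <= k)%N by exact: leq_maxl.
have k1k : (k1 <= k)%N by apply: leq_trans (leq_maxr _ _); exact: leq_maxl.
have k2k : (k2 <= k)%N by apply: leq_trans (leq_maxr _ _); exact: leq_maxr.
have t1 : 0 < `|t| + 1 by rewrite ltr_wpDl.
have d12 : 0 < d1 / 2 by rewrite divr_gt0.
have [|x' Sx'] := dS k Vx (_ : 0 < Num.min d (Num.min (d1 / 2) d2)); first by rewrite !lt_min d0 d12.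
rewrite !lt_min => /andP[hx1 /andP[hx2 hx3]].
have [|h' Sh'] := dS k Vh (_ : 0 < Num.min d (d1 / 2 / (`|t| + 1))).
  by rewrite !lt_min d0 divr_gt0.
rewrite !lt_min => /andP[hh1 hh2].
have Vx' := SV Sx'; have Vh' := SV Sh'.
have Sxt : S (x' + t *: h') by apply: sublinD => //; apply: sublinZ.
have c1 := hd t x' h' Sx' Sh' (le_lt_trans (gr_mono gE _ lk) hx1) (le_lt_trans (gr_mono gE _ lk) hh1) td.
have c2 := hd2 x' Sx' (le_lt_trans (gr_mono gE _ k2k) hx3).
have c3 : nm (f (x' + t *: h') - g (x + t *: h)) < eta / 2.
  apply: hd1 => //; apply: le_lt_trans (gr_mono gE _ k1k) _.
  have -> : x' + t *: h' - (x + t *: h) = (x' - x) + t *: (h' - h).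
    by rewrite scalerBr opprD addrACA.
  have Vhh : V (h' - h) by apply: (sublinB (grV gE)).
  apply: le_lt_trans (grD gE _ _ _) _; first exact: (sublinB (grV gE)).
    exact: (sublinZ (grV gE)).
  rewrite (grZ gE) // [d1]splitr ltr_leD //.
  apply: le_trans (_ : (`|t| + 1) * P k (h' - h) <= _).
    by rewrite ler_wpM2r ?(gr_ge0 gE) // lerDl.
  by rewrite mulrC -ler_pdivlMr // ltW.
have -> : g (x + t *: h) - g x - t *^ dg (x, h) =
  (f (x' + t *: h') - f x' - t *^ dg (x, h)) + ((f x' - g x) - (f (x' + t *: h') - g (x + t *: h))).
  by hring.
apply: le_trans (nmD _ _) _; rewrite lerD //.
apply: le_trans (nmD _ _) _; rewrite nmN [eta]splitr lerD // ltW //.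
Qed.

End Extension.

(** * Extension of orbit maps along dense subgroups *)

(* [(E, tV)] models an iterated tangent space of the group [(G, VG)], with dense
   subspace [tS]: [tb] is the base point, [tact] the action by left translation,
   [tlin] its linear part, and [tdil] the dilation of the tangent directions. *)
Record tdata (R : realType) (G E : preTopologicalLmodType R) := TData {
  tV : set E ; tS : set E ; tP : nat -> E -> R ;
  tb : E -> G ; tact : G -> E -> E ; tlin : G -> E -> E ; tdil : R -> E -> E }.

Section TangentData.
Context (R : realType) (K : hilbertType R) (G : preTopologicalLmodType R).
Context (VG SG : set G) (PG : nat -> G -> R) (inv : G -> G).
Hypothesis grG : forall k l x, (k <= l)%N -> PG k x <= PG l x.

Definition jointly_cont (E : preTopologicalLmodType R) (V : set E) (P : nat -> E -> R)
    (a : G -> E -> E) :=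
  forall g p k (e : R), VG g -> V p -> 0 < e -> exists l, exists2 d : R, 0 < d &
    forall g' p', VG g' -> V p' -> PG l (g' - g) < d -> P l (p' - p) < d ->
      P k (a g' p' - a g p) < e.

(** Translations are affine along lines, so their derivative in direction [q] is [tlin g q] at every
    base point; this lets [tprod] act on new directions by [tlin] alone. [tdil_le0] is the
    contraction that dilations provide once the base point is 0. *)
Record tlaws (E : preTopologicalLmodType R) (D : tdata G E) : Prop := TLaws {
  tgr : graded (tV D) (tP D) ;
  tSl : sublin (tS D) ;
  tSV : tS D `<=` tV D ;
  tdense : forall p k (e : R), tV D p -> 0 < e -> exists2 q, tS D q & tP D k (q - p) < e ;
  tact_line : forall g p q (t : R), VG g -> tV D p -> tV D q ->
    tact D g (p + t *: q) = tact D g p + t *: tlin D g q ;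
  tlin_line : forall g p q (t : R), VG g -> tV D p -> tV D q ->
    tlin D g (p + t *: q) = tlin D g p + t *: tlin D g q ;
  tactS : forall g p, SG g -> tS D p -> tS D (tact D g p) ;
  tlinS : forall g p, SG g -> tS D p -> tS D (tlin D g p) ;
  tactV : forall g p, VG g -> tV D p -> tV D (tact D g p) ;
  tlinV : forall g p, VG g -> tV D p -> tV D (tlin D g p) ;
  tbS : forall p, tS D p -> SG (tb D p) ;
  tbV : forall p, tV D p -> VG (tb D p) ;
  tb0 : forall p, tV D p -> tb D (tact D (inv (tb D p)) p) = 0 ;
  tb_le : forall k p q, PG k (tb D p - tb D q) <= tP D k (p - q) ;
  tactK : forall g p, VG g -> tV D p -> tact D g (tact D (inv g) p) = p ;
  tlinK : forall g p, VG g -> tV D p -> tlin D g (tlin D (inv g) p) = p ;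
  tactC : jointly_cont (tV D) (tP D) (tact D) ;
  tlinC : jointly_cont (tV D) (tP D) (tlin D) ;
  tdilS : forall l p, tS D p -> tS D (tdil D l p) ;
  tdilV : forall l p, tV D p -> tV D (tdil D l p) ;
  tdil_line : forall l p q (t : R), tdil D l (p + t *: q) = tdil D l p + t *: tdil D l q ;
  tdil_le : forall k (l : R) p, 0 <= l <= 1 -> tV D p -> tP D k (tdil D l p) <= tP D k p ;
  tdil_le0 : forall k (l : R) p, 0 <= l <= 1 -> tV D p -> tb D p = 0 ->
    tP D k (tdil D l p) <= l * tP D k p
}.

(** A new direction is scaled by [l] on top of the dilation of its own components, which raises the
    degree of homogeneity of the differential by one. *)
Definition tprod (E : preTopologicalLmodType R) (D : tdata G E) : tdata G (E * E)%type :=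
  TData (tV D `*` tV D) (tS D `*` tS D) (sumP (tP D) (tP D)) (fun p => tb D p.1)
    (fun g p => (tact D g p.1, tlin D g p.2)) (fun g p => (tlin D g p.1, tlin D g p.2))
    (fun l p => (tdil D l p.1, l *: tdil D l p.2)).

Lemma jointly_contX (E : preTopologicalLmodType R) (V : set E) P a b :
  graded V P ->
  jointly_cont V P a -> jointly_cont V P b ->
  jointly_cont (V `*` V) (sumP P P) (fun g p => (a g p.1, b g p.2)).
Proof.
move=> gE ha hb g [p q] k e Vg [/= Vp Vq] e0.
have e2 : 0 < e / 2 by rewrite divr_gt0.
have [l [d d0 hd]] := ha g p k _ Vg Vp e2; have [l' [d' d0' hd']] := hb g q k _ Vg Vq e2.
exists (maxn l l'), (Num.min d d'); first by rewrite lt_min d0 d0'.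
move=> g' [p' q'] Vg' [/= Vp' Vq'] hg; rewrite /sumP /= => hpq.
have m1 := leq_maxl l l'; have m2 := leq_maxr l l'.
rewrite [ltRHS]splitr ltrD //.
  apply: hd => //; first exact: (le_lt_trans (grG _ m1) (lt_le_trans hg (min_lel _ _))).
  apply: le_lt_trans (gr_mono gE _ m1) _.
  by apply: le_lt_trans (lt_le_trans hpq (min_lel _ _)); rewrite lerDl (gr_ge0 gE).
apply: hd' => //; first exact: (le_lt_trans (grG _ m2) (lt_le_trans hg (min_ler _ _))).
apply: le_lt_trans (gr_mono gE _ m2) _.
by apply: le_lt_trans (lt_le_trans hpq (min_ler _ _)); rewrite lerDr (gr_ge0 gE).
Qed.

Lemma tlawsX (E : preTopologicalLmodType R) (D : tdata G E) : tlaws D -> tlaws (tprod D).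
Proof.
move=> h; split => /=.
- exact: (gradedX (tgr h) (tgr h)).
- exact: (sublinX (tSl h) (tSl h)).
- by move=> p [/= ? ?]; split; apply: (tSV h).
- move=> [p q] k e [/= Vp Vq] e0; have e2 : 0 < e / 2 by rewrite divr_gt0.
  have [p' Sp' hp'] := tdense h k Vp e2; have [q' Sq' hq'] := tdense h k Vq e2.
  by exists (p', q') => //; rewrite /sumP /= [ltRHS]splitr ltrD.
- move=> g [p p'] [q q'] t Vg [/= ? ?] [/= ? ?].
  by congr (_, _) => /=; [apply: (tact_line h) | apply: (tlin_line h)].
- move=> g [p p'] [q q'] t Vg [/= ? ?] [/= ? ?].
  by congr (_, _) => /=; apply: (tlin_line h).
- by move=> g [p q] Sg [/= ? ?]; split => /=; [apply: (tactS h) | apply: (tlinS h)].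
- by move=> g [p q] Sg [/= ? ?]; split => /=; apply: (tlinS h).
- by move=> g [p q] Sg [/= ? ?]; split => /=; [apply: (tactV h) | apply: (tlinV h)].
- by move=> g [p q] Sg [/= ? ?]; split => /=; apply: (tlinV h).
- by move=> [p q] [/= ? ?]; apply: (tbS h).
- by move=> [p q] [/= ? ?]; apply: (tbV h).
- by move=> [p q] [/= ? ?]; apply: (tb0 h).
- move=> k [p p'] [q q'] /=; rewrite /sumP /=; apply: le_trans (tb_le h _ _ _) _.
  by rewrite lerDl (gr_ge0 (tgr h)).
- by move=> g [p q] Vg [/= ? ?]; rewrite (tactK h) // (tlinK h).
- by move=> g [p q] Vg [/= ? ?]; rewrite !(tlinK h).
- exact: (jointly_contX (tgr h) (tactC h) (tlinC h)).
- exact: (jointly_contX (tgr h) (tlinC h) (tlinC h)).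
- by move=> l [p q] [/= ? ?]; split => /=; [|apply: (sublinZ (tSl h))]; apply: (tdilS h).
- by move=> l [p q] [/= ? ?]; split => /=; [|apply: (sublinZ (grV (tgr h)))]; apply: (tdilV h).
- move=> l [p p'] [q q'] t /=; rewrite !(tdil_line h); congr (_, _).
  by rewrite /= scalerDr !scalerA (mulrC l).
- move=> k l [p q] hl [/= Vp Vq]; rewrite /sumP /= lerD //; first exact: (tdil_le h).
  rewrite (grZ (tgr h)); last exact: (tdilV h).
  case/andP: (hl) => l0 l1; rewrite ger0_norm //.
  by apply: le_trans (tdil_le h k hl Vq); rewrite ler_piMl // (gr_ge0 (tgr h)).
- move=> k l [p q] hl [/= Vp Vq] hb; rewrite /sumP /= mulrDr lerD //; first exact: (tdil_le0 h).
  rewrite (grZ (tgr h)); last exact: (tdilV h).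
  by case/andP: (hl) => l0 l1; rewrite ger0_norm // ler_wpM2l // (tdil_le h).
Qed.

Hypothesis invS : forall g, SG g -> SG (inv g).
Hypothesis invV : forall g, VG g -> VG (inv g).
Hypothesis invC : forall g k (e : R), VG g -> 0 < e -> exists l, exists2 d : R, 0 < d &
  forall g', VG g' -> PG l (g' - g) < d -> PG k (inv g' - inv g) < e.
Hypothesis SVG : SG `<=` VG.

Variable pi : G -> K -> K.
Hypothesis pi_iso : forall g v w, SG g -> nm (pi g v - pi g w) = nm (v - w).
Hypothesis pi_lin : forall g (r : R) v w, SG g -> pi g (r *^ v + w) = r *^ pi g v + pi g w.
Hypothesis pi_cauchy : forall v g (e : R), VG g -> 0 < e -> exists k, exists2 d : R, 0 < d &
  forall g1 g2, SG g1 -> SG g2 -> PG k (g1 - g) < d -> PG k (g2 - g) < d ->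
    nm (pi g1 v - pi g2 v) < e.

Lemma pi_hasd (c : R -> K) t w g : SG g -> hasd c t w -> hasd (fun t => pi g (c t)) t (pi g w).
Proof.
move=> Sg hc e /hc [d d0 hd]; exists d => // h /hd.
have piB v w' : pi g (v - w') = pi g v - pi g w'.
  have := pi_lin (-1) w' v Sg; rewrite rmorphN1 !scaleN1r ![- _ + _]addrC //.
have p0 : pi g 0 = 0 by have := piB 0 0; rewrite !subrr.
have piZ (r : R) v : pi g (r *^ v) = r *^ pi g v.
  by have := pi_lin r v 0 Sg; rewrite p0 !addr0.
have piN v : nm (pi g v) = nm v by have := pi_iso v 0 Sg; rewrite p0 !subr0.
by rewrite -piZ -!piB piN.
Qed.

Section Orbit.
Context (E : preTopologicalLmodType R) (D : tdata G E) (hD : tlaws D).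
Variables (f : E -> K) (n : nat).
Hypothesis f_equi : forall g p, SG g -> tS D p -> f (tact D g p) = pi g (f p).
Hypothesis f_homog : forall (l : R) p, 0 < l <= 1 -> tS D p ->
  f (tdil D l p) = (l ^+ n) *^ f p.

(* [tact D (inv (tb D q)) q] is [q] translated to base point 0. *)
Lemma normalize_cont p k (e : R) : tV D p -> 0 < e -> exists l, exists2 d : R, 0 < d &
  forall q, tV D q -> tP D l (q - p) < d ->
    tP D k (tact D (inv (tb D q)) q - tact D (inv (tb D p)) p) < e.
Proof.
move=> Vp e0.
have Vb := tbV hD Vp.
have [l [d d0 hd]] := tactC hD k (invV Vb) Vp e0.
have [l' [d' d0' hd']] := invC l Vb d0.
exists (maxn l l'), (Num.min d d'); first by rewrite lt_min d0 d0'.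
move=> q Vq; rewrite lt_min => /andP[h1 h2]; apply: hd => //.
- exact: (invV (tbV hD Vq)).
- apply: hd'; first exact: (tbV hD Vq).
  apply: le_lt_trans (tb_le hD _ _ _) (le_lt_trans _ h2).
  exact: (gr_mono (tgr hD) _ (leq_maxr _ _)).
- exact: (le_lt_trans (gr_mono (tgr hD) _ (leq_maxl _ _)) h1).
Qed.

Variable df : E * E -> K.
Hypothesis f_dir : has_dir (tS D) f df.
Hypothesis df_cont : cont (sumP (tP D) (tP D)) (tS D `*` tS D) df.

Lemma dir_equi g p : SG g -> tS (tprod D) p -> df (tact (tprod D) g p) = pi g (df p).
Proof.
case: p => p q Sg [/= Sp Sq].
apply: (@hasd_unique _ _ (fun t : R => f (tact D g p + t *: tlin D g q)) 0).
  by apply: f_dir; [apply: (tactS hD) | apply: (tlinS hD)].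
have := pi_hasd Sg (f_dir Sp Sq); congr (hasd _ _ _); apply/funext => t.
rewrite -f_equi //; last first.
  by apply: (sublinD (tSl hD)) => //; apply: (sublinZ (tSl hD)).
by rewrite (tact_line hD) //; [apply: SVG | apply: (tSV hD) | apply: (tSV hD)].
Qed.

(** The curve [tdil l p + t (l tdil l q)] equals [tdil l (p + t l q)]: homogeneity of [f]
    contributes [l ^+ n], the inner derivative one further [l]. *)
Lemma dir_homog (l : R) p : 0 < l <= 1 -> tS (tprod D) p ->
  df (tdil (tprod D) l p) = (l ^+ n.+1) *^ df p.
Proof.
case: p => p q hl [/= Sp Sq].
apply: (@hasd_unique _ _ (fun t : R => f (tdil D l p + t *: (l *: tdil D l q))) 0).
  by apply: f_dir; [|apply: (sublinZ (tSl hD))]; apply: (tdilS hD).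
have := hasd_scale l (f_dir Sp Sq).
move=> h e e0; have ln0 : 0 < l ^+ n by case/andP: hl => l0 _; rewrite exprn_gt0.
have [d d0 hd] := h _ (divr_gt0 e0 ln0); exists d => // t /hd.
rewrite add0r mulr0 !scale0r !addr0 !scalerA => ht.
rewrite -(tdil_line hD) !f_homog //; last first.
  by apply: (sublinD (tSl hD)) => //; apply: (sublinZ (tSl hD)).
have -> : (l ^+ n) *^ f (p + (t * l) *: q) - (l ^+ n) *^ f p - (t%:C * (l ^+ n.+1)%:C) *: df (p, q) =
   (l ^+ n) *^ (f (p + (l * t) *: q) - f p - t *^ (l *^ df (p, q))).
  by rewrite -rmorphM /= (mulrC l t) exprS; hring.
rewrite nmZ gtr0_norm // mulrC -ler_pdivlMr // [e * _ / _]mulrAC.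
by move: ht; rewrite -(scalerA t%:C).
Qed.

(** The differential vanishes at [(0, 0)], so it is bounded on a small ball, and its homogeneity in
    the direction turns this into a Lipschitz estimate for [f] near 0. Over the base point 0 a
    dilation brings any ball into the small one, at the price of a factor [(l ^+ n)^-1]. The
    seminorm [k] does not depend on [rho]: in [orbit_cauchy] the radius is itself measured by
    [k]. *)
Lemma lipschitz_base0 : exists k, forall rho : R, exists2 C : R, 0 <= C &
  forall p q, tS D p -> tS D q -> tb D p = 0 -> tb D q = 0 ->
    tP D k p <= rho -> tP D k q <= rho -> nm (f p - f q) <= C * tP D k (p - q).
Proof.
have S0 := sublin0 (tSl hD).
have [k [eta eta0 heta]] := df_cont (conj S0 S0 : (tS D `*` tS D) (0, 0)) ltr01.
have df0 : df (0, 0) = 0.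
  by rewrite -[X in df (_, X)](scale0r 0) (dirZ (tSl hD) f_dir) // rmorph0 scale0r.
have bd p h : tS D p -> tS D h -> tP D k p < eta / 2 -> nm (df (p, h)) <= 4 / eta * tP D k h.
  move=> Sp Sh hp; apply/ler_addgt0Pr => e e0.
  have {e0} [e1 e0 ->] : exists2 e1 : R, 0 < e1 & e = 4 / eta * e1.
    by exists (e * eta / 4); [rewrite divr_gt0 ?mulr_gt0 | field; rewrite gt_eqF].
  rewrite -mulrDr; set b := tP D k h + e1.
  have b0 : 0 < b by rewrite ltr_wpDl // (gr_ge0 (tgr hD)).
  (* The direction is rescaled to fit into the ball of radius [eta], where [df] has norm less than
     1. *)
  pose c := eta / 4 / b.
  have c0 : 0 < c by rewrite !divr_gt0.
  have hc : sumP (tP D) (tP D) k ((p, c *: h) - (0, 0)) < eta.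
    rewrite /sumP /= !subr0 (grZ (tgr hD)) ?gtr0_norm //; last exact: (tSV hD Sh).
    rewrite [ltRHS]splitr ltrD //; apply: le_lt_trans (_ : c * b < _).
      by apply: ler_wpM2l; [exact: ltW | rewrite lerDl; exact: ltW].
    by rewrite /c divfK ?gt_eqF // ltr_pdivrMr // mulrAC ltr_pdivlMr //; lra.
  have Sch : (tS D `*` tS D) (p, c *: h) by split => //=; apply: (sublinZ (tSl hD)).
  have := heta _ Sch hc; rewrite df0 (dirZ (tSl hD) f_dir) // => hh.
  have {}hh : c * nm (df (p, h)) < 1 by rewrite -(gtr0_norm c0) -nmZ -[X in nm X]subr0.
  have -> : 4 / eta * b = 1 / c by rewrite /c; field; rewrite !gt_eqF.
  by rewrite ler_pdivlMr // mulrC ltW.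
have lip p q : tS D p -> tS D q -> tP D k p < eta / 2 -> tP D k q < eta / 2 ->
    nm (f p - f q) <= 4 / eta * tP D k (p - q).
  move=> Sp Sq hp hq; have Spq := sublinB (tSl hD) Sp Sq.
  have Vp := tSV hD Sp; have Vq := tSV hD Sq.
  have := @mvt_dir _ _ _ _ (tSl hD) _ _ f_dir q (p - q) 0 (4 / eta * tP D k (p - q)) Sq Spq.
  rewrite subr0 [q + (p - q)]addrC subrK; apply => t /andP[t0 t1]; rewrite subr0; apply: bd => //.
    by apply: (sublinD (tSl hD)) => //; apply: (sublinZ (tSl hD)).
  have -> : q + t *: (p - q) = (1 - t) *: q + t *: p.
    by rewrite scalerBr scalerBl scale1r addrA addrAC.
  apply: le_lt_trans (grD (tgr hD) _ _ _) _; try exact: (sublinZ (grV (tgr hD))).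
  rewrite !(grZ (tgr hD)) // !ger0_norm ?subr_ge0 //.
  have h1 := gr_ge0 (tgr hD) k p; have h2 := gr_ge0 (tgr hD) k q.
  pose m := Num.max (tP D k p) (tP D k q).
  have m0 : m < eta / 2 by rewrite gt_max hp hq.
  apply: le_lt_trans m0; have -> : m = (1 - t) * m + t * m by ring.
  by rewrite lerD // ler_wpM2l // ?subr_ge0 // le_max lexx ?orbT.
exists k => rho.
pose b := `|rho| + 1; have b0 : 0 < b by rewrite ltr_wpDl.
pose l := Num.min 1 (eta / 4 / b).
have l0 : 0 < l by rewrite lt_min ltr01 !divr_gt0.
have l1 : l <= 1 by exact: min_lel.
have hl : 0 < l <= 1 by rewrite l0 l1.
have hl' : 0 <= l <= 1 by rewrite ltW.
have lb : l * b < eta / 2.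
  apply: le_lt_trans (_ : eta / 4 / b * b < _); first by apply: ler_wpM2r; [exact: ltW | exact: min_ler].
  by rewrite divfK ?gt_eqF // ltr_pdivrMr // mulrAC ltr_pdivlMr //; lra.
have ln0 : 0 < l ^+ n by rewrite exprn_gt0.
exists ((l ^+ n)^-1 * (4 / eta)); first by rewrite ltW // mulr_gt0 ?invr_gt0 ?divr_gt0.
move=> p q Sp Sq bp bq hp hq.
have small x : tS D x -> tb D x = 0 -> tP D k x <= rho -> tP D k (tdil D l x) < eta / 2.
  move=> Sx bx hx; apply: le_lt_trans lb; apply: le_trans (tdil_le0 hD k hl' (tSV hD Sx) bx) _.
  apply: ler_wpM2l; first exact: ltW.
  apply: le_trans hx _; rewrite /b; have := ler_norm rho; lra.
have := lip _ _ (tdilS hD l Sp) (tdilS hD l Sq) (small p Sp bp hp) (small q Sq bq hq).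
rewrite !f_homog // -scalerBr nmZ gtr0_norm // => h1.
rewrite -mulrA mulrC ler_pdivlMr // mulrC; apply: le_trans h1 _.
apply: ler_wpM2l; first by rewrite divr_ge0 // ltW.
have -> : tdil D l p - tdil D l q = tdil D l (p - q).
  by rewrite -scaleN1r -(tdil_line hD) scaleN1r.
by apply: (tdil_le hD) => //; apply: (sublinB (grV (tgr hD))); apply: (tSV hD).
Qed.

(** Equivariance writes [f q] as [pi (tb q) (f (N q))] with [N q] over the base point 0. The vectors
    [f (N q)] are controlled in norm by [lipschitz_base0], the operators [pi (tb q)] only strongly,
    so a fixed vector has to be inserted between them. *)
Lemma orbit_cauchy : locally_cauchy (tV D) (tS D) (tP D) f.
Proof.
move=> p e Vp e0.
have [k lip] := lipschitz_base0.
pose N q := tact D (inv (tb D q)) q.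
have NS q : tS D q -> tS D (N q) by move=> Sq; apply: (tactS hD) => //; apply: invS; apply: (tbS hD).
have NV q : tV D q -> tV D (N q) by move=> Sq; apply: (tactV hD) => //; apply: invV; apply: (tbV hD).
have fN q : tS D q -> f q = pi (tb D q) (f (N q)).
  move=> Sq; rewrite -f_equi; [|exact: (tbS hD Sq)|exact: NS].
  by rewrite (tactK hD) //; [apply: (tbV hD) |]; apply: (tSV hD).
have [C C0 hC] := lip (tP D k (N p) + 1).
have C1 : 0 < 8 * (C + 1) by rewrite mulr_gt0 // ltr_wpDl.
pose eta := Num.min 1 (e / (8 * (C + 1))).
have eta0 : 0 < eta by rewrite lt_min ltr01 divr_gt0.
have etaC : eta * (8 * (C + 1)) <= e by rewrite -ler_pdivlMr //; exact: min_ler.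
have eta1 : eta <= 1 by exact: min_lel.
have [l [d d0 hd]] := normalize_cont k Vp eta0.
have Nle q : tS D q -> tP D l (q - p) < d -> tP D k (N q) <= tP D k (N p) + 1.
  move=> Sq hq; apply: le_trans (gr_tri (tgr hD) k (NV _ (tSV hD Sq)) (NV _ Vp)) _.
  by rewrite addrC lerD2l; apply: le_trans eta1; apply/ltW/hd => //; apply: (tSV hD).
have fle q q' : tS D q -> tS D q' -> tP D l (q - p) < d -> tP D l (q' - p) < d ->
    nm (f (N q) - f (N q')) <= e / 4.
  move=> Sq Sq' hq hq'; have Vq := tSV hD Sq; have Vq' := tSV hD Sq'.
  apply: le_trans (hC _ _ _ _ _ _ _ _) _; rewrite ?(tb0 hD) //; try exact: NS; try exact: Nle.
  have h1 := hd _ Vq hq; have h2 := hd _ Vq' hq'.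
  rewrite -/(N _) -/(N p) in h1 h2.
  have h3 := grB_tri (tgr hD) k (NV _ Vq) (NV _ Vq') (NV _ Vp).
  rewrite (grBC (tgr hD) k (NV _ Vp) (NV _ Vq')) in h3.
  apply: le_trans (_ : C * (eta + eta) <= _); last by lra.
  by apply: ler_wpM2l => //; lra.
(* [N p] need not lie in [tS], so [f (N p)] cannot be that fixed vector; a point [p0] of [tS] near
   [p] takes its place. *)
have [p0 Sp0 hp0] := tdense hD l Vp d0.
have e4 : 0 < e / 4 by rewrite divr_gt0.
have [k' [d' d0' hd']] := pi_cauchy (f (N p0)) (tbV hD Vp) e4.
exists (maxn l k'), (Num.min d d'); first by rewrite lt_min d0 d0'.
move=> q q' Sq Sq'; rewrite !lt_min => /andP[h1 h2] /andP[h1' h2'].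
have m1 := leq_maxl l k'; have m2 := leq_maxr l k'.
have {}h1 := le_lt_trans (gr_mono (tgr hD) _ m1) h1.
have {}h1' := le_lt_trans (gr_mono (tgr hD) _ m1) h1'.
have {}h2 := le_lt_trans (gr_mono (tgr hD) _ m2) h2.
have {}h2' := le_lt_trans (gr_mono (tgr hD) _ m2) h2'.
rewrite (fN q Sq) (fN q' Sq').
have Sb := tbS hD Sq; have Sb' := tbS hD Sq'.
have a1 : nm (pi (tb D q) (f (N q)) - pi (tb D q) (f (N p0))) <= e / 4 by rewrite pi_iso // fle.
have a2 : nm (pi (tb D q') (f (N p0)) - pi (tb D q') (f (N q'))) <= e / 4 by rewrite pi_iso // fle.
have a3 : nm (pi (tb D q) (f (N p0)) - pi (tb D q') (f (N p0))) < e / 4.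
  by apply: hd' => //; apply: le_lt_trans (tb_le hD _ _ _) _.
have a4 := nmB_tri (pi (tb D q) (f (N p0))) (pi (tb D q) (f (N q))) (pi (tb D q') (f (N q'))).
have a5 := nmB_tri (pi (tb D q') (f (N p0))) (pi (tb D q) (f (N p0))) (pi (tb D q') (f (N q'))).
lra.
Qed.

End Orbit.

(** One order is lost because the extension of each map relies on continuity of its differential.
    The induction passes from [f] on [D] to [df] on [tprod D], with the degree [n] raised by one. *)
Lemma orbit_extends m : forall (E : preTopologicalLmodType R) (D : tdata G E) (f : E -> K) n,
  tlaws D -> (forall g p, SG g -> tS D p -> f (tact D g p) = pi g (f p)) ->
  (forall (l : R) p, 0 < l <= 1 -> tS D p -> f (tdil D l p) = (l ^+ n) *^ f p) ->
  MB_C m.+1 (tS D) f ->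
  exists2 g, extends (tV D) (tS D) (tP D) f g & MB_C m (tV D) g.
Proof.
elim: m => [|m IH] E D f n hD fe fh [fc [df [fd hdf]]].
  have {}fd : has_dir (tS D) f df by move=> x h Sx Sh; apply/real_deriv0P/fd.
  have dfc : cont (sumP (tP D) (tP D)) (tS D `*` tS D) df.
    apply/(contP (gradedX (tgr hD) (tgr hD))); last by case: hdf.
    exact: (tSV (tlawsX hD)).
  have [g hg] := extension (tgr hD) (tdense hD) (orbit_cauchy hD fe fh fd dfc).
  exists g => //; split => //.
  by apply/(contP (tgr hD)) => //; apply: extends_cont (tgr hD) (tSV hD) (tdense hD) _ _ hg.
have {}fd : has_dir (tS D) f df by move=> x h Sx Sh; apply/real_deriv0P/fd.
have dfc : cont (sumP (tP D) (tP D)) (tS D `*` tS D) df.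
  apply/(contP (gradedX (tgr hD) (tgr hD))); last by case: hdf.
  exact: (tSV (tlawsX hD)).
have [g hg] := extension (tgr hD) (tdense hD) (orbit_cauchy hD fe fh fd dfc).
have [dg hdg hC] := IH _ _ _ n.+1 (tlawsX hD) (dir_equi hD fe fd) (dir_homog hD fh fd) hdf.
exists g => //; split.
  by apply/(contP (tgr hD)) => //; apply: extends_cont (tgr hD) (tSV hD) (tdense hD) _ _ hg.
exists dg; split; last exact: hC.
move=> x h Vx Vh; apply/real_deriv0P.
exact: (extends_dir (tgr hD) (tSl hD) (tSV hD) (tdense hD) fd hg hdg Vx Vh).
Qed.

End TangentData.

(** * The oscillator group *)

Section CinfTopology.
Context (R : realType) (H : hilbertType R) (A : operator H).

(** Differences of iterates are used because, off [Csmooth A], the iterate of a difference need not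
    be the difference of the iterates. *)
Definition cinf_ball_filter (x : H) : set_system H := [set Q |
  exists k, exists2 d : R, 0 < d &
    forall y, (forall j, (j <= k)%N -> nm (iter j A y - iter j A x) < d) -> Q y].

Lemma cinf_ball_filter_filter x : Filter (cinf_ball_filter x).
Proof.
split.
- by exists 0%N, 1.
- move=> P Q [k [d d0 hd]] [k' [d' d0' hd']].
  exists (maxn k k'), (Num.min d d'); first by rewrite lt_min d0 d0'.
  move=> y hy; split.
    apply: hd => j jk; apply: lt_le_trans (min_lel _ d'); apply: hy.
    exact: leq_trans jk (leq_maxl _ _).
  apply: hd' => j jk; apply: lt_le_trans (min_ler d _); apply: hy.
  exact: leq_trans jk (leq_maxr _ _).
- by move=> P Q PQ [k [d d0 hd]]; exists k, d => // y /hd /PQ.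
Qed.

Lemma cinf_nbhs (x : cinf A) (Q : set (cinf A)) :
  nbhs x Q <-> cinf_ball_filter (x : H) Q.
Proof.
have FF := cinf_ball_filter_filter x.
pose f := (fun (x : H) => (fun k => iter k A x) : {ptws nat -> H}).
split.
  rewrite nbhsE => -[B [[U Uop UB] Bx] BQ].
  have hf : {ptws, f @ cinf_ball_filter x --> f x}.
    apply/pointwise_cvgP => j; apply/cvg_nm => e e0.
    by exists j, e => // y; apply.
  have : nbhs (f x) U by apply: open_nbhs_nbhs; split => //; rewrite -UB in Bx.
  move=> /hf /= h; apply: filterS h => y Uy; apply: BQ; rewrite -UB; exact: Uy.
move=> [k [d d0 hd]].
have cj j : continuous (fun y : cinf A => iter j A (y : H) : H).
  move=> y; apply: (@continuous_comp (cinf A) {ptws nat -> H} H f (proj j)).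
    exact: (@initial_continuous _ _ f).
  exact: proj_continuous.
have : nbhs (x : cinf A) (fun y : cinf A => forall j : 'I_k.+1,
    nm (iter j A (y : H) - iter j A (x : H)) < d).
  apply: (@filter_forall (cinf A) 'I_k.+1
    (fun j y => nm (iter j A (y : H) - iter j A (x : H)) < d) (nbhs (x : cinf A))
    (nbhs_filter (x : cinf A))) => j.
  by have /cvg_nm := cj j x; apply.
apply: filterS => y hy; apply: hd => j jk.
by have := hy (Ordinal (jk : (j < k.+1)%N)).
Qed.

(** Summing over all [j <= k] makes the family increasing in [k], as [graded] requires. *)
Definition cinfP (k : nat) (x : cinf A) : R := \sum_(j < k.+1) nm (iter j A (x : H)).

End CinfTopology.

Section SelfAdjoint.
Context (R : realType) (H : hilbertType R) (A : operator H).
Hypothesis sa : selfadjoint A.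
Implicit Types (x y z : H).

Lemma domL (c : R[i]) x y : dom A x -> dom A y -> dom A (c *: x + y).
Proof. by case: sa => -[_ h _ _] _; apply: h. Qed.
Lemma appL (c : R[i]) x y : dom A x -> dom A y -> A (c *: x + y) = c *: A x + A y.
Proof. by case: sa => -[_ _ h _] _; apply: h. Qed.
Lemma dom_0 : dom A 0. Proof. by case: sa => -[]. Qed.
Lemma app0 : A 0 = 0.
Proof.
have := appL (-1) dom_0 dom_0; rewrite scaler0 addr0 => /eqP.
by rewrite scaleN1r addrC subrr => /eqP.
Qed.
Lemma domZ (c : R[i]) x : dom A x -> dom A (c *: x).
Proof. by move=> dx; have := domL c dx dom_0; rewrite addr0. Qed.
Lemma appZ (c : R[i]) x : dom A x -> A (c *: x) = c *: A x.
Proof. by move=> dx; have := appL c dx dom_0; rewrite app0 !addr0. Qed.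

Lemma app_sym x y : dom A x -> dom A y -> dotp (A x) y = dotp x (A y).
Proof.
move=> dx dy; case: sa => _ /(_ y (A y)) [_ h].
exact: (h (conj dy erefl)).
Qed.

Lemma rapp_sym x y : dom A x -> dom A y -> rdot (A x) y = rdot x (A y).
Proof. by move=> dx dy; rewrite /rdot app_sym. Qed.

(** Closedness of a self-adjoint operator: the conditions [rdot (A v) x = rdot v z] that cut out its
    graph pass to limits. Using them for [i u] as well as [u] recovers the complex pairing. *)
Lemma app_closed x z :
  (forall e : R, 0 < e -> exists2 x', dom A x' & nm (x' - x) < e /\ nm (A x' - z) < e) ->
  dom A x /\ z = A x.
Proof.
move=> h; case: (sa) => _ /(_ x z) [h1 _]; apply: h1 => u du.
have key v : dom A v -> rdot (A v) x = rdot v z.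
  move=> dv; apply/eqP; rewrite -subr_eq0 -normr_eq0 eq_le normr_ge0 andbT.
  suff : forall e : R, 0 < e -> `|rdot (A v) x - rdot v z| <= e.
    by move=> hh; apply/ler_addgt0Pr => e e0; rewrite add0r; apply: hh.
  move=> e e0; have c0 : 0 < nm (A v) + nm v + 1 by rewrite ltr_wpDl // addr_ge0 ?nm_ge0.
  have [x' dx' [h2 h3]] := h _ (divr_gt0 e0 c0).
  have -> : rdot (A v) x - rdot v z = rdot v (A x' - z) - rdot (A v) (x' - x).
    by rewrite !rdotBr (rapp_sym dv dx'); ring.
  apply: le_trans (ler_normB _ _) _.
  apply: le_trans (lerD (rdot_abs _ _) (rdot_abs _ _)) _.
  have a1 := nm_ge0 v; have a2 := nm_ge0 (A v).
  set q := e / _ in h2 h3.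
  have -> : e = q * (nm (A v) + nm v + 1) by rewrite divfK // gt_eqF.
  have := ler_wpM2l a1 (ltW h3); have := ler_wpM2l a2 (ltW h2).
  have : 0 <= q by rewrite divr_ge0 ?ltW.
  lra.
have k2 : rdot (A u) (im *: x) = rdot u (im *: z).
  rewrite -[LHS]opprK -rdot_iNr -appZ // key; last exact: domZ.
  by rewrite rdot_iNr opprK.
by rewrite !dotpRI key // k2.
Qed.

Lemma Csmooth_dom x : Csmooth A x -> dom A x.
Proof. by move=> /(_ 0%N). Qed.
Lemma Csmooth_iter x k : Csmooth A x -> dom A (iter k A x).
Proof. exact. Qed.
Lemma Csmooth_app x : Csmooth A x -> Csmooth A (A x).
Proof. by move=> Vx k; rewrite -iterSr; apply: Vx. Qed.

Lemma iter_appL k (c : R[i]) x y : Csmooth A x -> Csmooth A y ->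
  iter k A (c *: x + y) = c *: iter k A x + iter k A y.
Proof. by move=> Vx Vy; elim: k => //= k ->; rewrite appL. Qed.
Lemma CsmoothL (c : R[i]) x y : Csmooth A x -> Csmooth A y -> Csmooth A (c *: x + y).
Proof. by move=> Vx Vy k; rewrite iter_appL //; apply: domL. Qed.
Lemma iter_app0 k : iter k A 0 = 0.
Proof. by elim: k => //= k ->; apply: app0. Qed.
Lemma Csmooth0 : Csmooth A 0.
Proof. by move=> k; rewrite iter_app0; apply: dom_0. Qed.
Lemma CsmoothZ (c : R[i]) x : Csmooth A x -> Csmooth A (c *: x).
Proof. by move=> Vx; rewrite -[_ *: _]addr0; apply: CsmoothL => //; apply: Csmooth0. Qed.
Lemma iter_appZ k (c : R[i]) x : Csmooth A x -> iter k A (c *: x) = c *: iter k A x.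
Proof.
by move=> Vx; rewrite -[c *: x]addr0 iter_appL ?iter_app0 ?addr0 //; apply: Csmooth0.
Qed.
Lemma iter_appD k x y : Csmooth A x -> Csmooth A y -> iter k A (x + y) = iter k A x + iter k A y.
Proof. by move=> Vx Vy; rewrite -[x]scale1r iter_appL // !scale1r. Qed.
Lemma iter_appB k x y : Csmooth A x -> Csmooth A y -> iter k A (x - y) = iter k A x - iter k A y.
Proof. by move=> Vx Vy; rewrite -(scaleN1r y) addrC iter_appL // scaleN1r addrC. Qed.
Lemma CsmoothD x y : Csmooth A x -> Csmooth A y -> Csmooth A (x + y).
Proof. by move=> Vx Vy; rewrite -[x]scale1r; apply: CsmoothL. Qed.
Lemma CsmoothB x y : Csmooth A x -> Csmooth A y -> Csmooth A (x - y).
Proof. by move=> Vx Vy; rewrite -(scaleN1r y); apply: CsmoothD => //; apply: CsmoothZ. Qed.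

Lemma sublin_Csmooth : @sublin R (cinf A) (Csmooth A).
Proof. split; first exact: Csmooth0. by move=> r x y; apply: CsmoothL. Qed.

Lemma graded_cinf : @graded R (cinf A) (Csmooth A) (@cinfP R H A).
Proof.
split.
- exact: sublin_Csmooth.
- by move=> k x; apply: sumr_ge0 => j _; apply: nm_ge0.
- move=> k x y Vx Vy; rewrite -big_split /=; apply: ler_sum => j _.
  by rewrite (iter_appD _ Vx Vy); apply: nmD.
- move=> k r x Vx; rewrite mulr_sumr; apply: eq_bigr => j _.
  by rewrite -nmZ -iter_appZ.
- move=> k l x kl; rewrite /cinfP.
  rewrite -(subnKC kl) -addSn big_split_ord /= lerDl.
  by apply: sumr_ge0 => j _; apply: nm_ge0.
- move=> p Q Vp; split.
    move=> /cinf_nbhs [k [d d0 hd]]; exists k, d => // q Vq hq; apply: (hd q) => // j jk.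
    rewrite -iter_appB //; apply: le_lt_trans hq.
    rewrite /cinfP (bigD1 (Ordinal (jk : (j < k.+1)%N))) //= lerDl.
    by apply: sumr_ge0 => i _; apply: nm_ge0.
  move=> [k [d d0 hd]]; apply/cinf_nbhs.
  have k0 : 0 < k.+1%:R :> R by rewrite ltr0Sn.
  exists k, (d / k.+1%:R); first by rewrite divr_gt0.
  move=> q hq Vq; apply: hd => //.
  apply: lt_le_trans (_ : \sum_(j < k.+1) d / k.+1%:R <= _).
    apply: ltr_sum; first by apply/hasP; exists ord0 => //; rewrite mem_index_enum.
    by move=> j _; rewrite iter_appB //; apply: hq; rewrite -ltnS.
  by rewrite sumr_const card_ord -[_ *+ _]mulr_natr divfK // gt_eqF.
Qed.

Lemma cinfP_ge k (x : H) j : (j <= k)%N -> nm (iter j A x) <= cinfP k (x : cinf A).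
Proof.
move=> jk; rewrite /cinfP (bigD1 (Ordinal (jk : (j < k.+1)%N))) //= lerDl.
by apply: sumr_ge0 => i _; apply: nm_ge0.
Qed.

End SelfAdjoint.

(** * The unitary group and the symplectic form on smooth vectors *)

Section Oscillator.
Context (R : realType) (HA : hilbertType R) (A : operator HA) (gamma : R -> HA -> HA).
Hypothesis hA : standard_oscillator A gamma.
Implicit Types (x y z : HA) (s t r e : R).
Local Notation V := (Csmooth A).
Local Notation P0 k x := (cinfP k (x : cinf A)).

Let sa : selfadjoint A := osc_sa hA.
Let gc : @graded R (cinf A) V (@cinfP R HA A) := graded_cinf sa.

Lemma gamL t (c : R[i]) x y : gamma t (c *: x + y) = c *: gamma t x + gamma t y.
Proof. by case: (osc_gamma hA) => /(_ t) [h _ _] _ _ _; apply: h. Qed.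
Lemma gamD t x y : gamma t (x + y) = gamma t x + gamma t y.
Proof. by have := gamL t 1 x y; rewrite !scale1r. Qed.
Lemma gam0r t : gamma t 0 = 0.
Proof. by have /eqP := gamD t 0 0; rewrite addr0 -subr_eq0 opprD addrA subrr sub0r oppr_eq0 => /eqP. Qed.
Lemma gamZ t (c : R[i]) x : gamma t (c *: x) = c *: gamma t x.
Proof. by have := gamL t c x 0; rewrite gam0r !addr0. Qed.
Lemma gamN t x : gamma t (- x) = - gamma t x.
Proof. by rewrite -scaleN1r gamZ scaleN1r. Qed.
Lemma gamB t x y : gamma t (x - y) = gamma t x - gamma t y.
Proof. by rewrite gamD gamN. Qed.
Lemma gam_dot t x y : dotp (gamma t x) (gamma t y) = dotp x y.
Proof. by case: (osc_gamma hA) => /(_ t) [_ h _] _ _ _; apply: h. Qed.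
Lemma gam_rdot t x y : rdot (gamma t x) (gamma t y) = rdot x y.
Proof. by rewrite /rdot gam_dot. Qed.
Lemma gam_nm t x : nm (gamma t x) = nm x.
Proof. by rewrite /nm gam_rdot. Qed.
Lemma gam_add s t x : gamma (s + t) x = gamma s (gamma t x).
Proof. by case: (osc_gamma hA). Qed.
Lemma gam_0 x : gamma 0 x = x.
Proof.
apply/eqP; rewrite -subr_eq0; apply/eqP/nm_eq0.
by rewrite -(gam_nm 0) gamB -gam_add addr0 subrr nm0.
Qed.
Lemma gamK t x : gamma t (gamma (- t) x) = x.
Proof. by rewrite -gam_add subrr gam_0. Qed.
Lemma gam_cont x e : 0 < e -> exists2 d : R, 0 < d & forall t, `|t| < d -> nm (gamma t x - x) < e.
Proof.
move=> e0; case: (osc_gamma hA) => _ _ /(_ x 0) /cvg_nm /(_ e e0) h _.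
move/nbhs_ballP : h => [d /= d0 hd]; exists d => // t td.
by rewrite -{2}(gam_0 x); apply: hd; rewrite /ball /= sub0r normrN.
Qed.

Lemma gam_hasd0 x w : hasd (fun t => gamma t x) 0 w <-> dom A x /\ w = im *: A x.
Proof. by rewrite -real_deriv0P; case: (osc_gamma hA) => _ _ _; apply. Qed.

Lemma gam_app t x : dom A x -> dom A (gamma t x) /\ A (gamma t x) = gamma t (A x).
Proof.
move=> dx; have : hasd (fun s => gamma s (gamma t x)) 0 (gamma t (im *: A x)).
  have /gam_hasd0 h : dom A x /\ im *: A x = im *: A x by [].
  move=> e e0; have [d d0 hd] := h e e0; exists d => // s /hd.
  by rewrite -!gam_add !add0r -(addrC t s) gam_0 gam_add -gamZ -!gamB gam_nm.
move=> /gam_hasd0 [h1 h2]; split => //.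
move: h2; rewrite gamZ => /(congr1 (fun v => im *: v)); rewrite !imII => /eqP.
by rewrite eqr_opp => /eqP.
Qed.

Lemma gam_iter t x k : V x -> iter k A (gamma t x) = gamma t (iter k A x).
Proof. by move=> Vx; elim: k => //= k ->; have [_ ->] := gam_app t (Vx k). Qed.
Lemma gam_V t x : V x -> V (gamma t x).
Proof. by move=> Vx k; rewrite gam_iter //; have [] := gam_app t (Vx k). Qed.
Lemma cinfP_gam k t x : V x -> P0 k (gamma t x) = P0 k x.
Proof. by move=> Vx; apply: eq_bigr => j _; rewrite gam_iter // gam_nm. Qed.

Lemma cinfP_gam_cont k x e : V x -> 0 < e -> exists2 d : R, 0 < d &
  forall t, `|t| < d -> P0 k (gamma t x - x) < e.
Proof.
move=> Vx; elim: k e => [|k IH] e e0.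
  have [d d0 hd] := gam_cont x e0; exists d => // t td.
  by rewrite /cinfP big_ord1 /= hd.
have e2 : 0 < e / 2 by rewrite divr_gt0.
have [d d0 hd] := IH _ e2; have [d' d0' hd'] := gam_cont (iter k.+1 A x) e2.
exists (Num.min d d'); first by rewrite lt_min d0 d0'.
move=> t; rewrite lt_min => /andP[/hd h1 /hd' h2].
rewrite /cinfP big_ord_recr [ltRHS]splitr ltrD //.
by rewrite (iter_appB sa) //; [rewrite gam_iter | apply: gam_V].
Qed.

(** Each [gamma t] preserves all the seminorms on [V], which reduces joint continuity to continuity
    of [t |-> gamma t x] at 0. *)
Lemma gam_jcont k s x e : V x -> 0 < e -> exists2 d : R, 0 < d &
  forall s' x', V x' -> `|s' - s| < d -> P0 k (x' - x) < d -> P0 k (gamma s' x' - gamma s x) < e.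
Proof.
move=> Vx e0; have e2 : 0 < e / 2 by rewrite divr_gt0.
have [d d0 hd] := cinfP_gam_cont k Vx e2.
exists (Num.min d (e / 2)); first by rewrite lt_min d0 e2.
move=> s' x' Vx'; rewrite !lt_min => /andP[h1 _] /andP[_ h2].
have -> : gamma s' x' - gamma s x = gamma s' (x' - x) + gamma s (gamma (s' - s) x - x).
  by rewrite !gamB -gam_add (addrC s) subrK addrA subrK.
have V1 : V (x' - x) by apply: (CsmoothB sa).
have V2 : V (gamma (s' - s) x - x) by apply: (CsmoothB sa) => //; apply: gam_V.
apply: le_lt_trans (grD gc k (gam_V s' V1) (gam_V s V2)) _.
by rewrite (cinfP_gam _ _ V1) (cinfP_gam _ _ V2) [ltRHS]splitr ltrD // hd.
Qed.

Local Notation om := (omegaA A).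

Lemma omE x y : om x y = rdot (A x) (im *: y).
Proof. by rewrite /omegaA dotpRI. Qed.
Lemma omDr x y z : om x (y + z) = om x y + om x z.
Proof. by rewrite !omE scalerDr rdotDr. Qed.
Lemma omZr r x y : om x (r *^ y) = r * om x y.
Proof. by rewrite !omE scaleCA rdotZr. Qed.
Lemma omNr x y : om x (- y) = - om x y.
Proof. by rewrite !omE scalerN rdotNr. Qed.
Lemma om0r x : om x 0 = 0.
Proof. by rewrite !omE scaler0 rdot0r. Qed.
Lemma omC x y : V x -> V y -> om x y = - om y x.
Proof.
move=> Vx Vy; have dx := Csmooth_dom Vx; have dy := Csmooth_dom Vy.
by rewrite !omE -(rdot_iNr (A y) x) -(appZ sa _ dy) (rapp_sym sa (domZ sa _ dy) dx) (rdotC (A x)).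
Qed.
Lemma omxx x : V x -> om x x = 0.
Proof. by move=> Vx; have := omC Vx Vx; lra. Qed.
Lemma omDl x y z : V x -> V y -> om (x + y) z = om x z + om y z.
Proof.
by move=> Vx Vy; rewrite !omE -[x]scale1r (appL sa) ?scale1r ?rdotDl //; apply: Csmooth_dom.
Qed.
Lemma omZl r x y : V x -> om (r *^ x) y = r * om x y.
Proof. by move=> Vx; rewrite !omE (appZ sa) ?rdotZl //; apply: Csmooth_dom. Qed.
Lemma omNl x y : V x -> om (- x) y = - om x y.
Proof. by move=> Vx; rewrite !omE -scaleN1r (appZ sa) ?scaleN1r ?rdotNl //; apply: Csmooth_dom. Qed.
Lemma om0l y : om 0 y = 0.
Proof. by rewrite omE (app0 sa) rdot0l. Qed.
Lemma om_gam t x y : V x -> om (gamma t x) (gamma t y) = om x y.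
Proof.
move=> Vx; rewrite !omE -gamZ; have [_ ->] := gam_app t (Csmooth_dom Vx).
exact: gam_rdot.
Qed.
Lemma om_abs x y : `|om x y| <= nm (A x) * nm y.
Proof. by rewrite omE; apply: le_trans (rdot_abs _ _) _; rewrite nm_i. Qed.
Lemma om_le x y : `|om x y| <= P0 1 x * P0 0 y.
Proof.
apply: le_trans (om_abs _ _) _; apply: ler_pM; rewrite ?nm_ge0 //.
  exact: (@cinfP_ge _ _ _ 1 x 1).
exact: (@cinfP_ge _ _ _ 0 y 0).
Qed.

Lemma om_cont x u e : V x -> V u -> 0 < e -> exists2 d : R, 0 < d &
  forall x' u', V x' -> V u' -> P0 1 (x' - x) < d -> P0 0 (u' - u) < d ->
    `|om x' u' - om x u| < e.
Proof.
move=> Vx Vu e0.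
have pu := gr_ge0 gc 0 u; have px := gr_ge0 gc 1 x.
have b0 : 0 < P0 0 u + P0 1 x + 2 by lra.
pose d := Num.min 1 (e / (P0 0 u + P0 1 x + 2)).
have d0 : 0 < d by rewrite lt_min ltr01 divr_gt0.
have d1 : d <= 1 by exact: min_lel.
have db : d * (P0 0 u + P0 1 x + 2) <= e by rewrite -ler_pdivlMr //; exact: min_ler.
exists d => // x' u' Vx' Vu' h1 h2.
have V1 : V (x' - x) by apply: (CsmoothB sa).
have -> : om x' u' - om x u = om (x' - x) u' + om x (u' - u).
  by rewrite omDl ?omDr //; [rewrite omNl // omNr; ring | rewrite -scaleN1r; apply: (CsmoothZ sa)].
apply: le_lt_trans (ler_normD _ _) _.
have a1 := om_le (x' - x) u'; have a2 := om_le x (u' - u).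
have a3 := gr_tri gc 0 Vu' Vu.
have a4 := gr_ge0 gc 1 (x' - x : HA); have a5 := gr_ge0 gc 0 u'.
have b1 : P0 1 (x' - x) * P0 0 u' <= d * (1 + P0 0 u).
  apply: ler_pM => //; first exact: ltW.
  by apply: le_trans a3 _; rewrite lerD2r; apply: ltW; apply: lt_le_trans h2 _.
have b2 : P0 1 x * P0 0 (u' - u) <= P0 1 x * d by apply: ler_wpM2l => //; exact: ltW.
by move: a1 a2 b1 b2 db d0; rewrite /=; lra.
Qed.

End Oscillator.

Lemma gradedR (R : realType) : @graded R R^o setT (fun _ x => `|x|).
Proof.
split => //.
- by move=> k x y _ _; apply: ler_normD.
- by move=> k r x _; apply: normrM.
- move=> p Q _; split.
    move=> h; have h' : nbhs p (fun q => True -> Q q) := h.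
    have : nbhs p Q by apply: filterS h' => q; apply.
    move=> /nbhs_ballP [d d0 hd]; exists 0%N, d => // q _ hq; apply: hd.
    by rewrite /ball /= distrC.
  move=> [k [d d0 hd]]; suff h : nbhs p Q by change (nbhs p (fun q => True -> Q q)); apply: filterS h => q.
  by apply/nbhs_ballP; exists d => // q; rewrite /ball /= distrC => /(hd q I).
Qed.

(** * The group law and its continuity *)

Section OscGroup.
Context (R : realType) (HA : hilbertType R) (A : operator HA) (gamma : R -> HA -> HA).

Definition oscP : nat -> osc A -> R :=
  sumP (sumP (fun _ (x : R^o) => `|x|) (@cinfP R HA A)) (fun _ (x : R^o) => `|x|).

(* The differential of left translation by [g]: [g h = g + osc_lin g h]. *)
Definition osc_lin (g h : osc A) : osc A :=
  (h.1.1 + 2^-1 * omegaA A g.1.2 (gamma g.2 h.1.2), gamma g.2 h.1.2 : cinf A, h.2).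

Definition osc_inv (g : osc A) : osc A :=
  (- g.1.1, - gamma (- g.2) g.1.2 : cinf A, - g.2).

Hypothesis hA : standard_oscillator A gamma.
Local Notation V := (Csmooth A).
Local Notation VO := (osc_of (A := A) V).
Local Notation om := (omegaA A).
Implicit Types (g h p q : osc A) (r t s e : R).

Let sa : selfadjoint A := osc_sa hA.
Let gc : @graded R (cinf A) V (@cinfP R HA A) := graded_cinf sa.

Lemma graded_osc : graded VO oscP.
Proof.
have -> : VO = (setT `*` V) `*` setT.
  by apply/seteqP; split => [[[t x] s]|[[t x] s] [[_]]].
exact: (gradedX (gradedX (@gradedR R) gc) (@gradedR R)).
Qed.

Lemma sublin_osc (L : set HA) : real_subspace L -> @sublin R (osc A) (osc_of L).
Proof. by move=> [L0 hL]; split => // r g h Lg Lh; apply: hL. Qed.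

Lemma osc_mulE g h : osc_mul gamma g h = g + osc_lin g h.
Proof. by case: g h => [[t x] s] [[t' x'] s']; congr (_, _, _); rewrite /= -addrA. Qed.

Lemma osc_linL g r p q : osc_lin g (r *: p + q) = r *: osc_lin g p + osc_lin g q.
Proof.
case: g p q => [[t x] s] [[a y] b] [[a' y'] b']; congr (_, _, _) => /=.
  rewrite -[r *: y]/(r *^ (y : HA)) (gamL hA) omDr omZr -![r *: _]/(r * _).
  by ring.
exact: (gamL hA).
Qed.

Lemma osc_lin_line g p q r : osc_lin g (p + r *: q) = osc_lin g p + r *: osc_lin g q.
Proof. by rewrite addrC osc_linL addrC. Qed.

Lemma osc_mul_line g p q r : osc_mul gamma g (p + r *: q) = osc_mul gamma g p + r *: osc_lin g q.
Proof. by rewrite !osc_mulE osc_lin_line addrA. Qed.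

Lemma osc_linM g h p : VO g -> VO h -> osc_lin g (osc_lin h p) = osc_lin (osc_mul gamma g h) p.
Proof.
case: g h p => [[t x] s] [[t' x'] s'] [[a y] b] /= Vg Vh; congr (_, _, _) => /=.
  rewrite (gam_add hA) (omDl hA) //; last exact: (gam_V hA).
  by rewrite (om_gam hA) //; ring.
by rewrite (gam_add hA).
Qed.

Lemma osc_mulA g h p : VO g -> VO h ->
  osc_mul gamma g (osc_mul gamma h p) = osc_mul gamma (osc_mul gamma g h) p.
Proof.
move=> Vg Vh; rewrite [in RHS]osc_mulE -osc_linM // [osc_mul gamma h p]osc_mulE.
by have := osc_mul_line g h (osc_lin h p) 1; rewrite !scale1r.
Qed.

Lemma osc_lin0 p : osc_lin 0 p = p.
Proof.
case: p => [[a y] b]; congr (_, _, _) => /=; last by rewrite (gam_0 hA).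
by rewrite (om0l hA) mulr0 addr0.
Qed.
Lemma osc_mul0 p : osc_mul gamma 0 p = p.
Proof. by rewrite osc_mulE osc_lin0 add0r. Qed.
Lemma osc_mulr0 g : osc_mul gamma g 0 = g.
Proof.
rewrite osc_mulE; have := osc_linL g 0 0 0; rewrite !scale0r !add0r => h.
by have -> : osc_lin g 0 = 0; [rewrite /osc_lin /= (gam0r hA) om0r mulr0 addr0 | rewrite addr0].
Qed.
Lemma osc_mulV g : VO g -> osc_mul gamma g (osc_inv g) = 0.
Proof.
case: g => [[t x] s] Vg; rewrite /osc_mul /osc_inv /=; congr (_, _, _); last by rewrite subrr.
  by rewrite (gamN hA) (gamK hA) subrr add0r omNr (omxx hA) // oppr0 mulr0.
by rewrite (gamN hA) (gamK hA) subrr.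
Qed.
Lemma osc_mulVr g : VO g -> osc_mul gamma (osc_inv g) g = 0.
Proof.
case: g => [[t x] s] Vg; rewrite /osc_mul /osc_inv /=; congr (_, _, _); last by rewrite addNr.
  by rewrite addNr add0r (omNl hA) ?(omxx hA) ?oppr0 ?mulr0 //; apply: (gam_V hA).
by rewrite addNr.
Qed.

Lemma osc_lin_V g p : VO g -> VO p -> VO (osc_lin g p).
Proof. by move=> Vg Vp; apply: (gam_V hA). Qed.
Lemma osc_mul_V g p : VO g -> VO p -> VO (osc_mul gamma g p).
Proof. by move=> Vg Vp; apply: (CsmoothD sa) => //; apply: (gam_V hA). Qed.
Lemma osc_inv_V g : VO g -> VO (osc_inv g).
Proof.
move=> Vg; rewrite /osc_of /= -scaleN1r; apply: (CsmoothZ sa); exact: (gam_V hA).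
Qed.
Lemma osc_0_V : VO 0. Proof. exact: (Csmooth0 sa). Qed.

Lemma osc_linK g p : VO g -> osc_lin g (osc_lin (osc_inv g) p) = p.
Proof. by move=> Vg; rewrite osc_linM ?osc_mulV ?osc_lin0 //; apply: osc_inv_V. Qed.
Lemma osc_mulK g p : VO g -> osc_mul gamma g (osc_mul gamma (osc_inv g) p) = p.
Proof. by move=> Vg; rewrite osc_mulA ?osc_mulV ?osc_mul0 //; apply: osc_inv_V. Qed.

Lemma osc_lin_cont : jointly_cont VO oscP VO oscP osc_lin.
Proof.
move=> [[t x] s] [[a y] b] k e Vg Vp e0; rewrite /osc_of /= in Vg Vp.
have e4 : 0 < e / 4 by rewrite divr_gt0.
have Vu := gam_V hA s Vp.
have [d d0 hd] := om_cont hA Vg Vu e4.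
have m0 : 0 < Num.min d (e / 4) by rewrite lt_min d0 e4.
have [d' d0' hd'] := gam_jcont hA k s Vp m0.
exists (maxn 1 k), (Num.min d (Num.min d' (e / 4))); first by rewrite !lt_min d0 d0' e4.
move=> [[t' x'] s'] [[a' y'] b']; rewrite /osc_of /= => Vg' Vp'.
have g1 (u : HA) : cinfP 1 (u : cinf A) <= cinfP (maxn 1 k) (u : cinf A).
  exact: (gr_mono gc (u : cinf A) (leq_maxl 1 k)).
have g2 (u : HA) : cinfP k (u : cinf A) <= cinfP (maxn 1 k) (u : cinf A).
  exact: (gr_mono gc (u : cinf A) (leq_maxr 1 k)).
have g3 (u : HA) : cinfP 0 (u : cinf A) <= cinfP k (u : cinf A).
  exact: (gr_mono gc (u : cinf A) (leq0n k)).
rewrite /oscP /sumP /= !lt_min.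
set c1 := cinfP _ (x' - x); set c2 := cinfP _ (y' - y).
move=> /andP[h1 /andP[h2 h3]] /andP[h4 /andP[h5 h6]].
have n1 := normr_ge0 (t' - t); have n2 := normr_ge0 (s' - s).
have n3 := normr_ge0 (a' - a); have n4 := normr_ge0 (b' - b).
have n5 : 0 <= c1 := gr_ge0 gc _ _; have n6 : 0 <= c2 := gr_ge0 gc _ _.
have hu : cinfP k (gamma s' y' - gamma s y : cinf A) < Num.min d (e / 4).
  apply: hd' => //; first by lra.
  by apply: le_lt_trans (g2 _) _; rewrite -/c2; lra.
rewrite lt_min in hu; case/andP: hu => hu1 hu2.
have ho : `|om x' (gamma s' y') - om x (gamma s y)| < e / 4.
  apply: hd => //; first exact: (gam_V hA).
    by apply: le_lt_trans (g1 _) _; rewrite -/c1; lra.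
  by apply: le_lt_trans (g3 _) _.
have ht : `|a' + 2^-1 * om x' (gamma s' y') - (a + 2^-1 * om x (gamma s y))| <=
    `|a' - a| + 2^-1 * `|om x' (gamma s' y') - om x (gamma s y)|.
  have -> : a' + 2^-1 * om x' (gamma s' y') - (a + 2^-1 * om x (gamma s y)) =
    (a' - a) + 2^-1 * (om x' (gamma s' y') - om x (gamma s y)) by ring.
  by apply: le_trans (ler_normD _ _) _; rewrite normrM (@ger0_norm _ 2^-1) ?invr_ge0.
move: ht ho hu2 h6 n5 n6; set o := `|om _ _ - _|; set w := `|_ - (a + _)|; set v := cinfP k _; lra.
Qed.

Lemma osc_mul_cont : jointly_cont VO oscP VO oscP (osc_mul gamma).
Proof.
move=> g p k e Vg Vp e0; have e2 : 0 < e / 2 by rewrite divr_gt0.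
have [l [d d0 hd]] := osc_lin_cont k Vg Vp e2.
exists (maxn k l), (Num.min d (e / 2)); first by rewrite lt_min d0 e2.
move=> g' p' Vg' Vp'; rewrite !lt_min => /andP[h1 h2] /andP[h3 h4].
rewrite !osc_mulE opprD addrACA.
have gO := graded_osc.
have V1 : VO (g' - g) := sublinB (grV gO) Vg' Vg.
have V2 : VO (osc_lin g' p' - osc_lin g p) := sublinB (grV gO) (osc_lin_V Vg' Vp') (osc_lin_V Vg Vp).
apply: le_lt_trans (grD gO k V1 V2) _; rewrite [ltRHS]splitr ltrD //.
  exact: (le_lt_trans (gr_mono gO _ (leq_maxl k l)) h2).
by apply: hd => //; [exact: (le_lt_trans (gr_mono gO _ (leq_maxr k l)) h1)
  | exact: (le_lt_trans (gr_mono gO _ (leq_maxr k l)) h3)].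
Qed.

Lemma osc_inv_cont g k e : VO g -> 0 < e -> exists l, exists2 d : R, 0 < d &
  forall g', VO g' -> oscP l (g' - g) < d -> oscP k (osc_inv g' - osc_inv g) < e.
Proof.
case: g => [[t x] s] Vg e0; rewrite /osc_of /= in Vg.
have e4 : 0 < e / 4 by rewrite divr_gt0.
have [d d0 hd] := gam_jcont hA k (- s) Vg e4.
exists k, (Num.min d (e / 4)); first by rewrite lt_min d0 e4.
move=> [[t' x'] s'] Vg'; rewrite /oscP /sumP /= lt_min => /andP[h1 h2].
have n1 := normr_ge0 (t' - t); have n2 := normr_ge0 (s' - s).
have n5 : 0 <= cinfP k (x' - x) := gr_ge0 gc _ _.
have Vx : V (gamma (- s) x) by apply: (gam_V hA).
have Vx' : V (gamma (- s') x') by apply: (gam_V hA).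
have h3 : cinfP k (gamma (- s') x' - gamma (- s) x : cinf A) < e / 4.
  by apply: hd => //; [rewrite -opprD normrN; lra | lra].
have -> : - gamma (- s') x' - - gamma (- s) x = - (gamma (- s') x' - gamma (- s) x) :> HA.
  by rewrite opprD.
have -> : cinfP k (- (gamma (- s') x' - gamma (- s) x) : cinf A) =
   cinfP k (gamma (- s') x' - gamma (- s) x : cinf A).
  exact: (grN gc k (sublinB (grV gc) Vx' Vx)).
rewrite -!opprD !normrN; move: h2 h3 n5; set u := cinfP k _; set v := cinfP k _; lra.
Qed.

(** Tangent data of order zero: there are no directions yet, so the dilations are trivial. *)
Definition osc_tdata (L : set HA) : tdata (osc A) (osc A) :=
  TData VO (osc_of L) oscP id (osc_mul gamma) osc_lin (fun _ => id).

Section SubGroup.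
Variables (L : set HA) (L_sub : real_subspace L) (L_smooth : L `<=` V).
Hypothesis L_dense : cinf_dense (A := A) L V.
Hypothesis L_gamma : forall t x, L x -> L (gamma t x).
Local Notation SO := (osc_of (A := A) L).

Lemma osc_sub_V : SO `<=` VO.
Proof. by move=> g Lg; apply: L_smooth. Qed.

Lemma cinf_dense_approx (M M' : set HA) x k e : M' `<=` V -> M `<=` V ->
  cinf_dense (A := A) M M' -> M' x -> 0 < e ->
  exists2 y, M y & cinfP k (y - x : cinf A) < e.
Proof.
move=> M'V MV hd Mx e0; have Vx := M'V _ Mx.
have hw : within V (nbhs (x : cinf A)) [set q : cinf A | cinfP k (q - x) < e].
  by apply/(gr_nbhs gc _ Vx); exists k, e.
have [y [/= My hy]] := hd _ Mx _ hw.
by exists y => //; apply: hy; apply: MV.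
Qed.

Lemma osc_dense p k e : VO p -> 0 < e -> exists2 q, SO q & oscP k (q - p) < e.
Proof.
case: p => [[t x] s] Vp e0.
have [y Ly hy] := cinf_dense_approx k (@subset_refl _ V) L_smooth L_dense Vp e0.
exists (t, y : cinf A, s) => //.
by rewrite /oscP /sumP /= !subrr normr0 addr0 add0r.
Qed.

Lemma L_add x y : L x -> L y -> L (x + y).
Proof. by move=> Lx Ly; case: L_sub => _ /(_ 1 x y Lx Ly); rewrite rmorph1 scale1r. Qed.
Lemma L_scale r x : L x -> L (r *^ x).
Proof. by move=> Lx; case: L_sub => L0 /(_ r x 0 Lx L0); rewrite addr0. Qed.
Lemma L_opp x : L x -> L (- x).
Proof. by move=> Lx; rewrite -scaleN1r -(rmorphN1 (real_complex R)); apply: L_scale. Qed.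

Lemma osc_mul_S g p : SO g -> SO p -> SO (osc_mul gamma g p).
Proof. by move=> Lg Lp; apply: L_add => //; apply: L_gamma. Qed.
Lemma osc_lin_S g p : SO g -> SO p -> SO (osc_lin g p).
Proof. by move=> Lg Lp; apply: L_gamma. Qed.
Lemma osc_inv_S g : SO g -> SO (osc_inv g).
Proof. by move=> Lg; apply: L_opp; apply: L_gamma. Qed.

Lemma osc_tlaws : tlaws VO SO oscP osc_inv (osc_tdata L).
Proof.
have gO := graded_osc.
split => //=.
- exact: sublin_osc.
- exact: osc_sub_V.
- exact: osc_dense.
- by move=> *; apply: osc_mul_line.
- by move=> *; apply: osc_lin_line.
- exact: osc_mul_S.
- exact: osc_lin_S.
- exact: osc_mul_V.
- exact: osc_lin_V.
- exact: osc_mulVr.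
- by move=> *; apply: osc_mulK.
- by move=> *; apply: osc_linK.
- exact: osc_mul_cont.
- exact: osc_lin_cont.
(* Only the point 0 lies over the base point 0, so even the trivial dilation contracts there. *)
- by move=> k l p hl _ ->; rewrite (gr0 gO) mulr0.
Qed.

End SubGroup.
End OscGroup.

Lemma nmZc (R : realType) (K : hilbertType R) (c : R[i]) (x : K) :
  nm (c *: x) = complex.Re `|c| * nm x.
Proof.
have h : `|c *: x| = `|c| * `|x| by rewrite normrZ.
have hc : `|c| = (complex.Re `|c|)%:C by rewrite RRe_real // normr_real.
by move: h; rewrite !normE hc -rmorphM /= => -[->].
Qed.

Lemma rdot_polar (R : realType) (K : hilbertType R) (x y : K) :
  rdot x y = (nm (x + y) ^+ 2 - nm x ^+ 2 - nm y ^+ 2) / 2.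
Proof. by rewrite -!rdotxx rdotDl !rdotDr (rdotC y x); field. Qed.

Lemma dense_nm (R : realType) (K : hilbertType R) (S : set K) : dense S ->
  forall (v : K) (e : R), 0 < e -> exists2 w, S w & nm (w - v) < e.
Proof.
move=> hS v e e0.
have : nbhs v [set w | nm (w - v) < e] by apply/nbhs_nm; exists e.
rewrite nbhsE => -[B [Bop Bv] BQ].
have [w [Bw Sw]] : B `&` S !=set0 by apply: hS => //; exists v.
by exists w => //; apply: BQ.
Qed.

(** * Part (a): extension of smooth representations *)

Section MBC.
Context (R : realType) (F : normedModType R[i]).

Lemma MB_C_ext n : forall (E : preTopologicalLmodType R) (S : set E) (f f' : E -> F),
  sublin S -> (forall x, S x -> f x = f' x) -> MB_C n S f -> MB_C n S f'.
Proof.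
have hc (E : preTopologicalLmodType R) (S : set E) (f f' : E -> F) :
  (forall x, S x -> f x = f' x) -> {within S, continuous f} -> {within S, continuous f'}.
  move=> ff' /subspace_continuousP h; apply/subspace_continuousP => x Sx Q /=.
  have -> : nbhs (f' x) = nbhs (f x) by rewrite ff'.
  move=> /(h x Sx) hQ; have hQ' : nbhs x (fun y => S y -> Q (f y)) := hQ.
  suff : nbhs x (fun y => S y -> Q (f' y)) by [].
  by apply: filterS hQ' => y hy Sy; rewrite -ff' //; apply: hy.
case: n => [|n] E S f f' hS ff' [h1 h2]; split => //; try exact: hc h1.
have [df [h3 h4]] := h2; exists df; split => // x h Sx Sh.
have -> : (fun t : R => f' (x + t *: h)) = (fun t : R => f (x + t *: h)).
  by apply/funext => t; rewrite ff' //; apply: (sublinD hS) => //; apply: (sublinZ hS).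
exact: h3.
Qed.

Lemma MB_C_sub n : forall (E : preTopologicalLmodType R) (S S' : set E) (f : E -> F),
  S' `<=` S -> MB_C n S f -> MB_C n S' f.
Proof.
elim: n => [|n IH] E S S' f SS [h1 h2]; (split; first exact: continuous_subspaceW h1) => //.
have [df [h3 h4]] := h2; exists df; split; first by move=> x h /SS Sx /SS Sh; apply: h3.
by apply: IH h4 => -[x h] [/= /SS ? /SS ?].
Qed.

End MBC.

Section UnitaryRep.
Context (R : realType) (HA : hilbertType R) (A : operator HA) (gamma : R -> HA -> HA).
Hypothesis hA : standard_oscillator A gamma.
Context (K : hilbertType R) (L : set HA) (pi : osc A -> K -> K).
Local Notation SO := (osc_of (A := A) L).
Local Notation VO := (osc_of (A := A) (Csmooth A)).
Hypothesis L_sub : real_subspace L.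
Hypothesis L_smooth : L `<=` Csmooth A.
Hypothesis L_gamma : forall t x, L x -> L (gamma t x).
Hypothesis hpi : unitary_rep gamma L pi.

Lemma repL g (c : R[i]) v w : SO g -> pi g (c *: v + w) = c *: pi g v + pi g w.
Proof. by move=> Lg; case: hpi => /(_ g Lg) [h _ _] _; apply: h. Qed.
Lemma rep_nm g v : SO g -> nm (pi g v) = nm v.
Proof. by move=> Lg; case: hpi => /(_ g Lg) [_ h _] _; rewrite /nm /rdot h. Qed.
Lemma repB g v w : SO g -> pi g (v - w) = pi g v - pi g w.
Proof. by move=> Lg; have := repL (-1) w v Lg; rewrite !scaleN1r ![- _ + _]addrC. Qed.
Lemma rep0r g : SO g -> pi g 0 = 0.
Proof. by move=> Lg; have := repB 0 0 Lg; rewrite !subrr. Qed.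
Lemma repZ g (c : R[i]) v : SO g -> pi g (c *: v) = c *: pi g v.
Proof. by move=> Lg; have := repL c v 0 Lg; rewrite rep0r // !addr0. Qed.
Lemma rep_mul g h v : SO g -> SO h -> pi (osc_mul gamma g h) v = pi g (pi h v).
Proof. by move=> Lg Lh; case: hpi => _; apply. Qed.
Lemma osc_0_S : SO 0. Proof. by case: L_sub. Qed.
Lemma rep1 v : pi 0 v = v.
Proof.
have L0 := osc_0_S.
apply/eqP; rewrite -subr_eq0; apply/eqP/nm_eq0.
by rewrite -(rep_nm _ L0) repB // -rep_mul // (osc_mul0 hA) subrr nm0.
Qed.
Lemma rep_iso g v w : SO g -> nm (pi g v - pi g w) = nm (v - w).
Proof. by move=> Lg; rewrite -repB // rep_nm. Qed.
Lemma repVK g v : SO g -> pi (osc_inv gamma g) (pi g v) = v.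
Proof.
move=> Lg; rewrite -rep_mul //; last exact: osc_inv_S.
by rewrite (osc_mulVr hA) ?rep1 //; apply: L_smooth.
Qed.
Lemma repKV g v : SO g -> pi g (pi (osc_inv gamma g) v) = v.
Proof.
move=> Lg; rewrite -rep_mul //; last exact: osc_inv_S.
by rewrite (osc_mulV hA) ?rep1 //; apply: L_smooth.
Qed.

Hypothesis hsm : dense (smooth_vectors L pi).

Lemma rep_cont v : cont (@oscP R HA A) SO (fun g => pi g v).
Proof.
move=> g Sg e e0; have e4 : 0 < e / 4 by rewrite divr_gt0.
have [w sw hw] := dense_nm hsm v e4.
have [h _] := sw 0%N.
have /(contP (graded_osc hA)) hc := h.
have [k [d d0 hd]] := hc (@osc_sub_V _ _ A _ L_smooth) g Sg _ e4.
exists k, d => // q Sq /(hd _ Sq) h1.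
have h2 : nm (pi q v - pi q w) < e / 4 by rewrite rep_iso // nmBC.
have h3 : nm (pi g w - pi g v) < e / 4 by rewrite rep_iso.
have := nmB_tri (pi q w) (pi q v) (pi g v); have := nmB_tri (pi g w) (pi q w) (pi g v).
lra.
Qed.

(** [|pi g1 v - pi g2 v|] equals [|pi (g2^-1 g1) v - v|], and [g2^-1 g1] tends to the identity when
    [g1] and [g2] approach any [g] of the large group. Strong continuity is thus needed at the
    identity only. *)
Lemma rep_cauchy v g (e : R) : VO g -> 0 < e -> exists k, exists2 d : R, 0 < d &
  forall g1 g2, SO g1 -> SO g2 -> oscP k (g1 - g) < d -> oscP k (g2 - g) < d ->
    nm (pi g1 v - pi g2 v) < e.
Proof.
move=> Vg e0.
have [k [d d0 hd]] := rep_cont v osc_0_S e0.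
have [l [d' d0' hd']] := osc_mul_cont hA k (osc_inv_V hA Vg) Vg d0.
have [l' [d2 d20 hd2]] := osc_inv_cont hA l Vg d0'.
have gO := graded_osc hA.
exists (maxn l l'), (Num.min d' d2); first by rewrite lt_min d0' d20.
move=> g1 g2 S1 S2; rewrite !lt_min => /andP[h1 _] /andP[_ h2].
have V1 := L_smooth S1 : VO g1; have V2 := L_smooth S2 : VO g2.
have Si := osc_inv_S L_sub L_gamma S2.
rewrite -(rep_iso _ _ Si) repVK // -rep_mul // -{2}(rep1 v).
apply: hd; first exact: (osc_mul_S L_sub L_gamma Si S1).
have -> : 0 = osc_mul gamma (osc_inv gamma g) g by rewrite (osc_mulVr hA).
apply: hd' => //; first exact: (osc_inv_V hA V2).
  by apply: hd2 => //; exact: (le_lt_trans (gr_mono gO _ (leq_maxr l l')) h2).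
exact: (le_lt_trans (gr_mono gO _ (leq_maxl l l')) h1).
Qed.

End UnitaryRep.

Section Extend.
Context (R : realType) (HA : hilbertType R) (A : operator HA) (gamma : R -> HA -> HA).
Hypothesis hA : standard_oscillator A gamma.
Context (K : hilbertType R) (L : set HA) (piL : osc A -> K -> K).
Local Notation SO := (osc_of (A := A) L).
Local Notation VO := (osc_of (A := A) (Csmooth A)).
Local Notation P := (@oscP R HA A).
Hypothesis L_sub : real_subspace L.
Hypothesis L_smooth : L `<=` Csmooth A.
Hypothesis L_dense : cinf_dense (A := A) L (Csmooth A).
Hypothesis L_gamma : forall t x, L x -> L (gamma t x).
Hypothesis hpi : smooth_rep gamma L piL.

Let gO := graded_osc hA.
Let urep := hpi.1.
Let hsm := hpi.2.

Definition is_extension (pi : osc A -> K -> K) :=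
  forall v, extends VO SO P (fun g => piL g v) (fun g => pi g v).

Lemma extension_exists : exists pi, is_extension pi.
Proof.
have h v : exists F : osc A -> K, extends VO SO P (fun g => piL g v) F.
  apply: (extension gO) => [p k e|p e Vp e0]; first exact: (osc_dense hA).
  exact: (rep_cauchy hA L_sub L_smooth L_gamma urep hsm).
have /choice [F hF] := h.
by exists (fun g v => F v g).
Qed.

Variable pi : osc A -> K -> K.
Hypothesis ext : is_extension pi.

Lemma ext_near g v k (e : R) : VO g -> 0 < e -> exists2 g', SO g' &
  P k (g' - g) < e /\ nm (piL g' v - pi g v) < e.
Proof.
move=> Vg e0; have [l [d d0 hd]] := ext v Vg e0.
have m0 : 0 < Num.min d e by rewrite lt_min d0 e0.
have [g' Sg'] := osc_dense hA L_smooth L_dense (maxn k l) Vg m0.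
rewrite lt_min => /andP[h1 h2]; exists g' => //; split.
  exact: (le_lt_trans (gr_mono gO _ (leq_maxl k l)) h2).
by apply: hd => //; exact: (le_lt_trans (gr_mono gO _ (leq_maxr k l)) h1).
Qed.

Lemma ext_uniq g v w : VO g -> tends P SO (fun g => piL g v) g w -> pi g v = w.
Proof. 
move=> Vg; apply: (extends_uniq gO) (@ext v) Vg => p k e.
exact: (osc_dense hA).
Qed.

Lemma ext_eq g v : SO g -> pi g v = piL g v.
Proof.
move=> Sg; apply: ext_uniq; first exact: L_smooth.
exact: (rep_cont hA L_smooth urep hsm).
Qed.

Lemma ext_lin g (c : R[i]) v w : VO g -> pi g (c *: v + w) = c *: pi g v + pi g w.
Proof.
move=> Vg; apply: ext_uniq => // e e0.
have c0 : 0 < complex.Re `|c| + 1.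
  by have := nm_ge0 (c *: v); have : 0 <= complex.Re `|c|; [have := normr_ge0 c; rewrite lecE => /andP[] | lra].
have e1 : 0 < e / (complex.Re `|c| + 1) / 2 by rewrite !divr_gt0.
have e2 : 0 < e / 2 by rewrite divr_gt0.
have [k [d d0 hd]] := ext v Vg e1; have [k' [d' d0' hd']] := ext w Vg e2.
exists (maxn k k'), (Num.min d d'); first by rewrite lt_min d0 d0'.
move=> q Sq; rewrite lt_min => /andP[h1 h2].
have h3 := hd q Sq (le_lt_trans (gr_mono gO _ (leq_maxl k k')) h1).
have h4 := hd' q Sq (le_lt_trans (gr_mono gO _ (leq_maxr k k')) h2).
rewrite (repL urep) // opprD addrACA -scalerBr.
apply: le_lt_trans (nmD _ _) _; rewrite nmZc [ltRHS]splitr ler_ltD //.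
have c1 : 0 <= complex.Re `|c| by have := normr_ge0 c; rewrite lecE => /andP[].
apply: le_trans (_ : (complex.Re `|c| + 1) * nm (piL q v - pi g v) <= _).
  by apply: ler_wpM2r; [exact: nm_ge0 | rewrite lerDl].
rewrite mulrC -ler_pdivlMr // mulrAC; exact: ltW.
Qed.

Lemma ext_nm g v : VO g -> nm (pi g v) = nm v.
Proof.
move=> Vg; apply/eqP; rewrite -subr_eq0 -normr_eq0 eq_le normr_ge0 andbT.
apply/ler_addgt0Pr => e e0; rewrite add0r.
have [g' Sg' [_ h]] := ext_near v 0 Vg e0.
rewrite -(rep_nm urep v Sg').
have h1 := nm_tri (piL g' v) (pi g v); have h2 := nm_tri (pi g v) (piL g' v).
rewrite nmBC in h2; apply/ltW; rewrite ltr_norml.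
by apply/andP; split; [rewrite ltrNl opprB ltrBlDr (le_lt_trans h1) // ltrD2r
  | rewrite ltrBlDr (le_lt_trans h2) // ltrD2r].
Qed.

Lemma ext_mul g h v : VO g -> VO h -> pi (osc_mul gamma g h) v = pi g (pi h v).
Proof.
move=> Vg Vh; apply: eq_nm => e e0.
have e4 : 0 < e / 4 by rewrite divr_gt0.
have [k [d d0 hd]] := ext v (osc_mul_V hA Vg Vh) e4.
have [l [d' d0' hd']] := osc_mul_cont hA k Vg Vh d0.
have m0 : 0 < Num.min d' (e / 4) by rewrite lt_min d0' e4.
have [g' Sg' [hg1 hg2]] := ext_near (pi h v) l Vg m0.
have [h' Sh' [hh1 hh2]] := ext_near v l Vh m0.
rewrite !lt_min in hg1 hg2 hh1 hh2.
case/andP: hg1 => hg1 _; case/andP: hg2 => _ hg2.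
case/andP: hh1 => hh1 _; case/andP: hh2 => _ hh2.
have Sgh := osc_mul_S L_sub L_gamma Sg' Sh'.
have h1 : nm (piL (osc_mul gamma g' h') v - pi (osc_mul gamma g h) v) < e / 4.
  by apply: hd => //; apply: hd' => //; apply: L_smooth.
have h2 : nm (piL g' (piL h' v) - piL g' (pi h v)) < e / 4 by rewrite (rep_iso urep).
rewrite (rep_mul urep) // in h1.
have := nmB_tri (piL g' (piL h' v)) (pi (osc_mul gamma g h) v) (pi g (pi h v)).
have := nmB_tri (piL g' (pi h v)) (piL g' (piL h' v)) (pi g (pi h v)).
rewrite (nmBC (pi (osc_mul gamma g h) v) (piL g' (piL h' v))); lra.
Qed.

Lemma ext_unitary_rep : unitary_rep gamma (Csmooth A) pi.
Proof.
have hn g : VO g -> forall v w, rdot (pi g v) (pi g w) = rdot v w.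
  move=> Vg v w; rewrite !rdot_polar !ext_nm //.
  by have := ext_lin 1 v w Vg; rewrite !scale1r => <-; rewrite ext_nm.
split; last by move=> g h Vg Vh v; exact: ext_mul.
move=> g Vg; split.
- by move=> c v w; apply: ext_lin.
- move=> v w; rewrite !dotpRI hn //.
  have := ext_lin im w 0 Vg; have -> : pi g 0 = 0 by apply: nm_eq0; rewrite ext_nm // nm0.
  by rewrite !addr0 => <-; rewrite hn.
- move=> y; exists (pi (osc_inv gamma g) y).
  rewrite -ext_mul //; last exact: (osc_inv_V hA).
  rewrite (osc_mulV hA) // ext_eq; first exact: (rep1 hA L_sub urep).
  exact: osc_0_S.
Qed.

(** Restriction gives one inclusion; for the other, [orbit_extends] is applied at every order. The
    equality makes the derived operators of both representations comparable. *)
Lemma ext_smooth_vectors : smooth_vectors (Csmooth A) pi = smooth_vectors L piL.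
Proof.
have hS : sublin SO := sublin_osc A L_sub.
apply/seteqP; split => v hv n.
  apply: (MB_C_ext hS (f := fun g => pi g v)); first by move=> g Sg; rewrite ext_eq.
  by apply: MB_C_sub (hv n) => g; apply: L_smooth.
have tl := osc_tlaws hA L_sub L_smooth L_dense L_gamma.
have [g hg hC] : exists2 g, extends VO SO P (fun g => piL g v) g & MB_C n VO g.
  have s1 : SO `<=` VO by move=> g; apply: L_smooth.
  have s2 g w w' : SO g -> nm (piL g w - piL g w') = nm (w - w').
    by move=> Sg; rewrite (rep_iso urep).
  have s3 g (r : R) w w' : SO g -> piL g (r *^ w + w') = r *^ piL g w + piL g w'.
    by move=> Sg; rewrite (repL urep).
  have s4 := rep_cauchy hA L_sub L_smooth L_gamma urep hsm.
  have s5 g p : SO g -> SO p -> piL (osc_mul gamma g p) v = piL g (piL p v).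
    by move=> Sg Sp; rewrite (rep_mul urep).
  have s6 (l : R) (p : osc A) : 0 < l <= 1 -> SO p -> piL p v = (l ^+ 0) *^ piL p v.
    by rewrite expr0 rmorph1 scale1r.
  have := orbit_extends (gr_mono gO) (osc_inv_S L_sub L_gamma) (osc_inv_V hA) (osc_inv_cont hA)
    s1 s2 s3 s4 tl s5 s6 (hv n.+1).
  by [].
apply: (MB_C_ext (grV gO) _ hC) => p Vp; apply/esym.
exact: (ext_uniq Vp (hg p Vp)).
Qed.

Lemma ext_smooth_rep : smooth_rep gamma (Csmooth A) pi.
Proof. by split; [exact: ext_unitary_rep | rewrite ext_smooth_vectors]. Qed.

Lemma ext_unique pi' : smooth_rep gamma (Csmooth A) pi' ->
  (forall g, SO g -> pi' g = piL g) -> forall g, VO g -> pi' g = pi g.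
Proof.
move=> [urep' hsm'] h g Vg; apply/funext => v; apply/esym/ext_uniq => // e e0.
have [k [d d0 hd]] := rep_cont hA (@subset_refl _ _) urep' hsm' v Vg e0.
by exists k, d => // q Sq hq; rewrite -h //; apply: hd => //; apply: L_smooth.
Qed.

End Extend.

Lemma small_scale (R : realFieldType) (e c : R) : 0 < e -> 0 < c ->
  exists d : R, [/\ 0 < d, d <= 1 & d * c <= e].
Proof.
move=> e0 c0; exists (Num.min 1 (e / c)); split; first by rewrite lt_min ltr01 divr_gt0.
  exact: min_lel.
by rewrite -ler_pdivlMr //; exact: min_ler.
Qed.

(** * Smooth maps between graded spaces and the derived representation *)

Section SmoothMaps.
Context (R : realType).

Definition ccont (E E' : preTopologicalLmodType R) (V : set E) (P : nat -> E -> R)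
    (P' : nat -> E' -> R) (phi : E -> E') :=
  forall p k (e : R), V p -> 0 < e -> exists l, exists2 d : R, 0 < d &
    forall q, V q -> P l (q - p) < d -> P' k (phi q - phi p) < e.

Definition tangent_curve (E : lmodType R) (P : nat -> E -> R) (c : R -> E) (w : E) :=
  forall k (e : R), 0 < e -> exists2 d : R, 0 < d &
    forall t : R, `|t| < d -> P k (c t - c 0 - t *: w) <= e * `|t|.

(** [MB_C] concerns maps into normed spaces, whereas right translations take values in a graded
    space; derivatives are again directional, with a remainder that is small in each seminorm. *)
Fixpoint smap n (E E' : preTopologicalLmodType R) (V : set E) (P : nat -> E -> R)
    (V' : set E') (P' : nat -> E' -> R) (phi : E -> E') : Prop :=
  [/\ forall p, V p -> V' (phi p), ccont V P P' phi &
    if n is m.+1 then exists dphi : E * E -> E',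
      (forall x h, V x -> V h -> tangent_curve P' (fun t => phi (x + t *: h)) (dphi (x, h))) /\
      smap m (V `*` V) (sumP P P) V' P' dphi
    else True].

Lemma smap_V n (E E' : preTopologicalLmodType R) (V : set E) P (V' : set E') P' phi :
  smap n V P V' P' phi -> forall p, V p -> V' (phi p).
Proof. by case: n => [|n] []. Qed.

Lemma smap_le n : forall (E E' : preTopologicalLmodType R) (V : set E) P (V' : set E') P' phi,
  smap n.+1 V P V' P' phi -> smap n V P V' P' phi.
Proof.
elim: n => [|n IH] E E' V P V' P' phi [h1 h2 [dphi [h3 h4]]]; split => //.
by exists dphi; split => //; apply: IH.
Qed.

Definition linmap (E E' : preTopologicalLmodType R) (V : set E) (P : nat -> E -> R)
    (V' : set E') (P' : nat -> E' -> R) (f : E -> E') :=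
  [/\ forall p, V p -> V' (f p), forall x h (t : R), f (x + t *: h) = f x + t *: f h &
      forall k x, P' k (f x) <= P k x].

Lemma linmapX (E E' : preTopologicalLmodType R) (V : set E) P (V' : set E') P' f :
  linmap V P V' P' f ->
  linmap (V `*` V) (sumP P P) (V' `*` V') (sumP P' P') (fun p => (f p.1, f p.2)).
Proof.
move=> [h1 h2 h3]; split.
- by move=> p [? ?]; split; apply: h1.
- by move=> x h t; rewrite !h2.
- by move=> k x; rewrite /sumP lerD ?h3.
Qed.

Lemma linmapB (E E' : preTopologicalLmodType R) (V : set E) P (V' : set E') P' f x y :
  linmap V P V' P' f -> f (x - y) = f x - f y.
Proof. by move=> [_ h _]; have := h x y (-1); rewrite !scaleN1r. Qed.

Lemma linmap_comp (E E' E2 : preTopologicalLmodType R) (V : set E) P (V' : set E') P'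
  (V2 : set E2) P2 f g :
  linmap V P V' P' f -> linmap V' P' V2 P2 g -> linmap V P V2 P2 (g \o f).
Proof.
move=> [h1 h2 h3] [g1 g2 g3]; split => /=.
- by move=> p /h1 /g1.
- by move=> x h t; rewrite h2 g2.
- by move=> k x; apply: le_trans (g3 _ _) (h3 _ _).
Qed.

Lemma linmap_fst (E E' : preTopologicalLmodType R) (V : set E) P (V' : set E') P' :
  graded V P -> graded V' P' -> linmap (V `*` V') (sumP P P') V P fst.
Proof.
move=> g g'; split => //; first by move=> p [].
by move=> k x; rewrite /sumP lerDl (gr_ge0 g').
Qed.

Lemma linmap_snd (E E' : preTopologicalLmodType R) (V : set E) P (V' : set E') P' :
  graded V P -> graded V' P' -> linmap (V `*` V') (sumP P P') V' P' snd.
Proof.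
move=> g g'; split => //; first by move=> p [].
by move=> k x; rewrite /sumP lerDr (gr_ge0 g).
Qed.

Lemma smap_precomp n : forall (E E' E2 : preTopologicalLmodType R) (V : set E) P (V' : set E') P'
  (V2 : set E2) P2 f phi, linmap V P V' P' f -> smap n V' P' V2 P2 phi ->
  smap n V P V2 P2 (phi \o f).
Proof.
have hc (E E' E2 : preTopologicalLmodType R) (V : set E) P (V' : set E') P'
  (P2 : nat -> E2 -> R) f phi :
  linmap V P V' P' f -> ccont V' P' P2 phi -> ccont V P P2 (phi \o f).
  move=> fl h p k e Vp e0; have [h1 h2 h3] := fl.
  have [l [d d0 hd]] := h (f p) k e (h1 _ Vp) e0.
  exists l, d => // q Vq hq; apply: hd; first exact: h1.
  by rewrite -(linmapB _ _ fl); apply: le_lt_trans (h3 _ _) hq.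
elim: n => [|n IH] E E' E2 V P V' P' V2 P2 f phi fl [p1 p2 p3]; have [h1 h2 h3] := fl.
  by split => //; [by move=> p /h1 /p1 | apply: (hc _ _ _ _ _ _ _ _ _ _ fl p2)].
split; [by move=> p /h1 /p1 | exact: (hc _ _ _ _ _ _ _ _ _ _ fl p2)|].
have [dphi [d1 d2]] := p3; exists (fun p => dphi (f p.1, f p.2)); split.
  move=> x h Vx Vh /=; have := d1 (f x) (f h) (h1 _ Vx) (h1 _ Vh).
  by under eq_fun do rewrite -h2.
exact: (IH _ _ _ _ _ _ _ _ _ _ _ (linmapX fl) d2).
Qed.

Lemma smap_pair n : forall (E E' E2 : preTopologicalLmodType R) (V : set E) P (V' : set E') P'
  (V2 : set E2) P2 phi psi, graded V P -> smap n V P V' P' phi -> smap n V P V2 P2 psi ->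
  smap n V P (V' `*` V2) (sumP P' P2) (fun p => (phi p, psi p)).
Proof.
have hc (E E' E2 : preTopologicalLmodType R) (V : set E) P (P' : nat -> E' -> R)
  (P2 : nat -> E2 -> R) phi psi : graded V P -> ccont V P P' phi -> ccont V P P2 psi ->
  ccont V P (sumP P' P2) (fun p => (phi p, psi p)).
  move=> gE h h' p k e Vp e0; have e2 : 0 < e / 2 by rewrite divr_gt0.
  have [l [d d0 hd]] := h p k _ Vp e2; have [l' [d' d0' hd']] := h' p k _ Vp e2.
  exists (maxn l l'), (Num.min d d'); first by rewrite lt_min d0 d0'.
  move=> q Vq; rewrite lt_min => /andP[h1 h2]; rewrite /sumP /= [ltRHS]splitr ltrD //.
    by apply: hd => //; exact: (le_lt_trans (gr_mono gE _ (leq_maxl l l')) h1).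
  by apply: hd' => //; exact: (le_lt_trans (gr_mono gE _ (leq_maxr l l')) h2).
elim: n => [|n IH] E E' E2 V P V' P' V2 P2 phi psi gE [p1 p2 p3] [q1 q2 q3].
  split => //; first by move=> p Vp; split; [apply: p1 | apply: q1].
  exact: hc.
split; first by move=> p Vp; split; [apply: p1 | apply: q1].
  exact: hc.
have [dp [p4 p5]] := p3; have [dq [q4 q5]] := q3.
exists (fun p => (dp p, dq p)); split; last exact: (IH _ _ _ _ _ _ _ _ _ _ _ (gradedX gE gE) p5 q5).
move=> x h Vx Vh k e e0; have e2 : 0 < e / 2 by rewrite divr_gt0.
have [d d0 hd] := p4 x h Vx Vh k _ e2; have [d' d0' hd'] := q4 x h Vx Vh k _ e2.
exists (Num.min d d'); first by rewrite lt_min d0 d0'.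
move=> t; rewrite lt_min => /andP[h1 h2]; rewrite /sumP /= {1}[e]splitr mulrDl lerD //.
  exact: hd.
exact: hd'.
Qed.

Lemma smap_lin n : forall (E E' : preTopologicalLmodType R) (V : set E) P (V' : set E') P' f,
  graded V P -> graded V' P' -> linmap V P V' P' f -> smap n V P V' P' f.
Proof.
have hc (E E' : preTopologicalLmodType R) (V : set E) P (V' : set E') (P' : nat -> E' -> R) f :
  linmap V P V' P' f -> ccont V P P' f.
  move=> fl; case: (fl) => h1 h2 h3 p k e Vp e0; exists k, e => // q Vq hq.
  by rewrite -(linmapB _ _ fl); apply: le_lt_trans (h3 _ _) hq.
elim: n => [|n IH] E E' V P V' P' f gE gE' fl; have [h1 h2 h3] := fl.
  by split => //; apply: (hc _ _ _ _ _ _ _ fl).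
split => //; first exact: (hc _ _ _ _ _ _ _ fl).
exists (fun p => f p.2); split.
  move=> x h Vx Vh k e e0; exists 1 => // t _.
  rewrite !h2 scale0r addr0 [f x + _]addrC addrK subrr (gr0 gE').
  by rewrite mulr_ge0 // ltW.
apply: (IH _ _ _ _ _ _ (f \o snd)) => //; first exact: (gradedX gE gE).
exact: (linmap_comp (linmap_snd gE gE) fl).
Qed.

Lemma smap_const n : forall (E E' : preTopologicalLmodType R) (V : set E) P (V' : set E') P' c,
  graded V P -> graded V' P' -> V' c -> smap n V P V' P' (fun=> c).
Proof.
have hc (E E' : preTopologicalLmodType R) (V : set E) (P : nat -> E -> R) (V' : set E') (P' : nat -> E' -> R) c :
  graded V' P' -> ccont V P P' (fun=> c).
  by move=> gE' p k e Vp e0; exists 0%N, 1 => // q Vq _; rewrite subrr (gr0 gE').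
elim: n => [|n IH] E E' V P V' P' c gE gE' Vc.
  by split => //; exact: (hc _ _ _ _ _ _ _ gE').
split => //; first exact: (hc _ _ _ _ _ _ _ gE').
exists (fun=> 0); split; last first.
  by apply: IH => //; [exact: gradedX | exact: (sublin0 (grV gE'))].
move=> x h Vx Vh k e e0; exists 1 => // t _.
by rewrite scaler0 subr0 subrr (gr0 gE') mulr_ge0 // ltW.
Qed.

Lemma smap_add n : forall (E E' : preTopologicalLmodType R) (V : set E) P (V' : set E') P' phi psi,
  graded V P -> graded V' P' -> smap n V P V' P' phi -> smap n V P V' P' psi ->
  smap n V P V' P' (fun p => phi p + psi p).
Proof.
have hc (E E' : preTopologicalLmodType R) (V : set E) P (V' : set E') (P' : nat -> E' -> R) phi psi :
  graded V P -> graded V' P' -> (forall p, V p -> V' (phi p)) -> (forall p, V p -> V' (psi p)) ->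
  ccont V P P' phi -> ccont V P P' psi -> ccont V P P' (fun p => phi p + psi p).
  move=> gE gE' v1 v2 h h' p k e Vp e0; have e2 : 0 < e / 2 by rewrite divr_gt0.
  have [l [d d0 hd]] := h p k _ Vp e2; have [l' [d' d0' hd']] := h' p k _ Vp e2.
  exists (maxn l l'), (Num.min d d'); first by rewrite lt_min d0 d0'.
  move=> q Vq; rewrite lt_min => /andP[h1 h2]; rewrite opprD addrACA.
  apply: le_lt_trans (grD gE' _ _ _) _.
  - by apply: (sublinB (grV gE')); apply: v1.
  - by apply: (sublinB (grV gE')); apply: v2.
  rewrite [ltRHS]splitr ltrD //.
    by apply: hd => //; exact: (le_lt_trans (gr_mono gE _ (leq_maxl l l')) h1).
  by apply: hd' => //; exact: (le_lt_trans (gr_mono gE _ (leq_maxr l l')) h2).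
elim: n => [|n IH] E E' V P V' P' phi psi gE gE' [p1 p2 p3] [q1 q2 q3].
  split => //; last exact: (hc _ _ _ _ V').
  by move=> p Vp; apply: (sublinD (grV gE')); [apply: p1 | apply: q1].
split; last first.
- have [dp [p4 p5]] := p3; have [dq [q4 q5]] := q3.
  exists (fun p => dp p + dq p); split; last exact: (IH _ _ _ _ _ _ _ _ (gradedX gE gE) gE' p5 q5).
  move=> x h Vx Vh k e e0; have e2 : 0 < e / 2 by rewrite divr_gt0.
  have [d d0 hd] := p4 x h Vx Vh k _ e2; have [d' d0' hd'] := q4 x h Vx Vh k _ e2.
  exists (Num.min d d'); first by rewrite lt_min d0 d0'.
  move=> t; rewrite lt_min => /andP[h1 h2].
  have Vt s : V (x + s *: h) by apply: (sublinD (grV gE)) => //; apply: (sublinZ (grV gE)).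
  have Vd := smap_V p5 (conj Vx Vh : (V `*` V) (x, h)).
  have Vd' := smap_V q5 (conj Vx Vh : (V `*` V) (x, h)).
  have -> : phi (x + t *: h) + psi (x + t *: h) - (phi (x + 0 *: h) + psi (x + 0 *: h)) -
     t *: (dp (x, h) + dq (x, h)) =
     (phi (x + t *: h) - phi (x + 0 *: h) - t *: dp (x, h)) +
     (psi (x + t *: h) - psi (x + 0 *: h) - t *: dq (x, h)).
    have lem (a b c u v w : E') : a + b - (c + u) - (v + w) = (a - c - v) + (b - u - w).
      by rewrite !opprD (addrACA a b) (addrACA (a - c)).
    by rewrite scalerDr lem.
  apply: le_trans (grD gE' _ _ _) _; try by do !apply: (sublinB (grV gE'));
    try apply: (sublinZ (grV gE')); auto.
  by rewrite {1}[e]splitr mulrDl lerD //; [exact: hd | exact: hd'].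
- exact: (hc _ _ _ _ V').
- by move=> p Vp; apply: (sublinD (grV gE')); [apply: p1 | apply: q1].
Qed.

Record bilin_map (E1 E2 E' : preTopologicalLmodType R) (V1 : set E1) (P1 : nat -> E1 -> R)
    (V2 : set E2) (P2 : nat -> E2 -> R) (V' : set E') (P' : nat -> E' -> R)
    (B : E1 -> E2 -> E') : Prop := BilinMap {
  bmV : forall u v, V1 u -> V2 v -> V' (B u v) ;
  bml : forall u u' v (t : R), V1 u -> V1 u' -> V2 v -> B (u + t *: u') v = B u v + t *: B u' v ;
  bmr : forall u v v' (t : R), V1 u -> V2 v -> V2 v' -> B u (v + t *: v') = B u v + t *: B u v' ;
  bm_le : forall k, exists l, forall u v, V1 u -> V2 v -> P' k (B u v) <= P1 l u * P2 l v
}.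

Section Bilinear.
Context (E1 E2 E' : preTopologicalLmodType R) (V1 : set E1) (P1 : nat -> E1 -> R)
  (V2 : set E2) (P2 : nat -> E2 -> R) (V' : set E') (P' : nat -> E' -> R) (B : E1 -> E2 -> E').
Hypothesis g1 : graded V1 P1.
Hypothesis g2 : graded V2 P2.
Hypothesis g' : graded V' P'.
Hypothesis hB : bilin_map V1 P1 V2 P2 V' P' B.

Lemma bmBl u u' v : V1 u -> V1 u' -> V2 v -> B (u - u') v = B u v - B u' v.
Proof. by move=> *; rewrite -scaleN1r (bml hB) // scaleN1r. Qed.
Lemma bmBr u v v' : V1 u -> V2 v -> V2 v' -> B u (v - v') = B u v - B u v'.
Proof. by move=> *; rewrite -scaleN1r (bmr hB) // scaleN1r. Qed.

Lemma ccont_bilin (E : preTopologicalLmodType R) (V : set E) P phi psi : graded V P ->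
  (forall p, V p -> V1 (phi p)) -> (forall p, V p -> V2 (psi p)) ->
  ccont V P P1 phi -> ccont V P P2 psi -> ccont V P P' (fun p => B (phi p) (psi p)).
Proof.
move=> gE v1 v2 c1 c2 p k e Vp e0.
have [l hl] := bm_le hB k.
have a1 := gr_ge0 g1 l (phi p); have a2 := gr_ge0 g2 l (psi p).
set M := P1 l (phi p) + P2 l (psi p) + 1.
have M0 : 0 < M by rewrite /M; lra.
pose d := Num.min 1 (e / (2 * M)).
have M20 : 0 < 2 * M by rewrite mulr_gt0.
have d0 : 0 < d by rewrite lt_min ltr01 divr_gt0.
have d1 : d <= 1 by exact: min_lel.
have dM : d * (2 * M) <= e by rewrite -ler_pdivlMr //; exact: min_ler.
have [k1 [e1 e10 h1]] := c1 p l d Vp d0; have [k2 [e2 e20 h2]] := c2 p l d Vp d0.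
exists (maxn k1 k2), (Num.min e1 e2); first by rewrite lt_min e10 e20.
move=> q Vq; rewrite lt_min => /andP[q1 q2].
have {}h1 := h1 q Vq (le_lt_trans (gr_mono gE _ (leq_maxl k1 k2)) q1).
have {}h2 := h2 q Vq (le_lt_trans (gr_mono gE _ (leq_maxr k1 k2)) q2).
have [w1 w1'] := (v1 _ Vp, v1 _ Vq); have [w2 w2'] := (v2 _ Vp, v2 _ Vq).
have w3 := sublinB (grV g1) w1' w1; have w4 := sublinB (grV g2) w2' w2.
have -> : B (phi q) (psi q) - B (phi p) (psi p) =
    B (phi q - phi p) (psi q) + B (phi p) (psi q - psi p).
  by rewrite bmBl // bmBr // addrA subrK.
have b1 := hl _ _ w3 w2'; have b2 := hl _ _ w1 w4.
apply: le_lt_trans (grD g' _ (bmV hB w3 w2') (bmV hB w1 w4)) _.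
have b3 := gr_tri g2 l w2' w2.
have b4 := gr_ge0 g1 l (phi q - phi p); have b5 := gr_ge0 g2 l (psi q); have b6 := gr_ge0 g2 l (psi q - psi p).
have b7 : P1 l (phi q - phi p) * P2 l (psi q) <= d * M.
  by apply: ler_pM => //; [exact: ltW | rewrite /M; lra].
have b8 : P1 l (phi p) * P2 l (psi q - psi p) <= P1 l (phi p) * d.
  by apply: ler_wpM2l => //; exact: ltW.
have b9 : P1 l (phi p) * d < M * d by rewrite ltr_pM2r // /M; lra.
move: b1 b2 b7 b8 b9 dM; clear; lra.
Qed.

(** Product rule. With remainders [r1] of [phi] and [r2] of [psi], the remainder of the product is
    [B r1 (psi t) + t B u (psi t - psi 0) + B (phi 0) r2]. The middle term is quadratic in [t],
    because [psi t - psi 0] is of order [t]. *)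
Lemma tangent_bilin (phi : R -> E1) (psi : R -> E2) u v : V1 u -> V2 v ->
  (forall t, V1 (phi t)) -> (forall t, V2 (psi t)) ->
  tangent_curve P1 phi u -> tangent_curve P2 psi v ->
  tangent_curve P' (fun t => B (phi t) (psi t)) (B u (psi 0) + B (phi 0) v).
Proof.
move=> Vu Vv v1 v2 c1 c2 k e e0.
have [l hl] := bm_le hB k.
have a1 := gr_ge0 g1 l (phi 0); have a2 := gr_ge0 g2 l (psi 0).
have a3 := gr_ge0 g1 l u; have a4 := gr_ge0 g2 l v.
set M := P1 l (phi 0) + P2 l (psi 0) + P1 l u + P2 l v + 1.
have M1 : 1 <= M by rewrite /M; lra.
have M0 : 0 < M by lra.
(* [M] dominates every seminorm that occurs. Up to the factor [|t|], the outer terms contribute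
   [2 eta M] and the middle one [dl M M], each at most [e / 2]. *)
have [eta [eta0 eta1 etaM]] := small_scale e0 (mulr_gt0 (ltr0Sn _ 3) M0).
have [dl [dl0 dl1 dlM]] := small_scale e0 (mulr_gt0 (ltr0Sn _ 1) (mulr_gt0 M0 M0)).
have [d1 d10 h1] := c1 l eta eta0; have [d2 d20 h2] := c2 l eta eta0.
exists (Num.min dl (Num.min d1 d2)); first by rewrite !lt_min dl0 d10 d20.
move=> t; rewrite !lt_min => /andP[tl /andP[/h1 t1 /h2 t2]].
set r1 := phi t - phi 0 - t *: u in t1; set r2 := psi t - psi 0 - t *: v in t2.
have Vr1 : V1 r1.
  by apply: (sublinB (grV g1)); [apply: (sublinB (grV g1)) | apply: (sublinZ (grV g1))].
have Vr2 : V2 r2.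
  by apply: (sublinB (grV g2)); [apply: (sublinB (grV g2)) | apply: (sublinZ (grV g2))].
have e1 : phi t = (phi 0 + t *: u) + 1 *: r1 by rewrite scale1r /r1 -(addrA (phi t)) -opprD [RHS]addrC subrK.
have e2 : psi t = (psi 0 + t *: v) + 1 *: r2 by rewrite scale1r /r2 -(addrA (psi t)) -opprD [RHS]addrC subrK.
have V1t : V1 (phi 0 + t *: u) by apply: (sublinD (grV g1)) => //; apply: (sublinZ (grV g1)).
have V2t : V2 (psi 0 + t *: v) by apply: (sublinD (grV g2)) => //; apply: (sublinZ (grV g2)).
have w4 := sublinB (grV g2) (v2 t) (v2 0).
have -> : B (phi t) (psi t) - B (phi 0) (psi 0) - t *: (B u (psi 0) + B (phi 0) v) =
    B r1 (psi t) + (t *: B u (psi t - psi 0) + B (phi 0) r2).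
  rewrite {1}e1 (bml hB) // (bml hB) // scale1r bmBr // {1}e2 (bmr hB) // (bmr hB) // scale1r.
  set x1 := B (phi 0) (psi 0); set x2 := B (phi 0) v; set x3 := B (phi 0) r2.
  set x4 := B u (psi t); set x5 := B r1 (psi t); set x6 := B u (psi 0).
  rewrite scalerDr scalerBr opprD !addrA.
  by rewrite [LHS](ACl ((1*6)*(2*8)*(5*4*7*3))) /= !subrr add0r add0r.
apply: le_trans (grD g' _ _ _) _; first exact: (bmV hB).
  by apply: (sublinD (grV g')); [apply: (sublinZ (grV g')) |]; apply: (bmV hB).
have b1 : P' k (B r1 (psi t)) <= eta * `|t| * M.
  apply: le_trans (hl _ _ Vr1 (v2 t)) _; apply: ler_pM => //; rewrite ?(gr_ge0 g1) ?(gr_ge0 g2) //.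
  rewrite e2 scale1r; apply: le_trans (grD g2 _ V2t Vr2) _.
  apply: le_trans (lerD (grD g2 _ (v2 0) (sublinZ (grV g2) t Vv)) t2) _.
  rewrite (grZ g2) //.
  have t1' : `|t| <= 1 by apply: ltW; apply: lt_le_trans tl dl1.
  have : `|t| * P2 l v <= 1 * P2 l v by apply: ler_wpM2r.
  have : eta * `|t| <= 1 * 1 by apply: ler_pM => //; exact: ltW.
  rewrite /M; lra.
have b2 : P2 l (psi t - psi 0) <= `|t| * M.
  have -> : psi t - psi 0 = t *: v + r2 by rewrite /r2 [RHS]addrC subrK.
  apply: le_trans (grD g2 _ (sublinZ (grV g2) t Vv) Vr2) _; rewrite (grZ g2) //.
  apply: le_trans (lerD (lexx _) t2) _; rewrite [eta * _]mulrC -mulrDr.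
  by apply: ler_wpM2l => //; rewrite /M; lra.
have b3 : P' k (t *: B u (psi t - psi 0)) <= `|t| * (M * (dl * M)).
  rewrite (grZ g'); last exact: (bmV hB).
  apply: ler_wpM2l => //; apply: le_trans (hl _ _ Vu w4) _.
  apply: ler_pM; rewrite ?(gr_ge0 g1) ?(gr_ge0 g2) //; first by rewrite /M; lra.
  by apply: le_trans b2 _; apply: ler_wpM2r; exact: ltW.
have b4 : P' k (B (phi 0) r2) <= M * (eta * `|t|).
  apply: le_trans (hl _ _ (v1 0) Vr2) _.
  by apply: ler_pM; rewrite ?(gr_ge0 g1) ?(gr_ge0 g2) //; rewrite /M; lra.
apply: le_trans (lerD b1 (grD g' _ _ _)) _; [|exact: (bmV hB)|].
  by apply: (sublinZ (grV g')); apply: (bmV hB).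
apply: le_trans (lerD (lexx _) (lerD b3 b4)) _.
have -> : eta * `|t| * M + (`|t| * (M * (dl * M)) + M * (eta * `|t|)) =
  `|t| * (2 * (eta * M) + dl * (M * M)) by ring.
rewrite mulrC; apply: ler_wpM2r => //; lra.
Qed.

End Bilinear.

Lemma smap_bilin n : forall (E E1 E2 E' : preTopologicalLmodType R) (V : set E) P
  (V1 : set E1) P1 (V2 : set E2) P2 (V' : set E') P' (B : E1 -> E2 -> E') phi psi,
  graded V P -> graded V1 P1 -> graded V2 P2 -> graded V' P' ->
  bilin_map V1 P1 V2 P2 V' P' B ->
  smap n V P V1 P1 phi -> smap n V P V2 P2 psi -> smap n V P V' P' (fun p => B (phi p) (psi p)).
Proof.
elim: n => [|n IH] E E1 E2 E' V P V1 P1 V2 P2 V' P' B phi psi gE g1 g2 g' hB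
  [p1 p2 p3] [q1 q2 q3].
  split => //; first by move=> p Vp; apply: (bmV hB); [apply: p1 | apply: q1].
  exact: (ccont_bilin g1 g2 g' hB).
have s1 : smap n (V `*` V) (sumP P P) V1 P1 (phi \o fst).
  apply: (smap_precomp (linmap_fst gE gE)); exact: smap_le (And3 p1 p2 p3).
have s2 : smap n (V `*` V) (sumP P P) V2 P2 (psi \o fst).
  apply: (smap_precomp (linmap_fst gE gE)); exact: smap_le (And3 q1 q2 q3).
split; first by move=> p Vp; apply: (bmV hB); [apply: p1 | apply: q1].
  exact: (ccont_bilin g1 g2 g' hB).
have [dp [p4 p5]] := p3; have [dq [q4 q5]] := q3.
exists (fun p => B (dp p) (psi p.1) + B (phi p.1) (dq p)); split.
  move=> x h Vx Vh.
  have Vt s : V (x + s *: h) by apply: (sublinD (grV gE)) => //; apply: (sublinZ (grV gE)).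
  have := tangent_bilin g1 g2 g' hB (smap_V p5 (conj Vx Vh : (V `*` V) (x, h)))
    (smap_V q5 (conj Vx Vh : (V `*` V) (x, h))) (fun t => p1 _ (Vt t)) (fun t => q1 _ (Vt t))
    (p4 x h Vx Vh) (q4 x h Vx Vh).
  by rewrite scale0r addr0.
have gX := gradedX gE gE.
apply: smap_add => //.
  exact: (IH _ _ _ _ _ _ _ _ _ _ _ _ B dp (psi \o fst) gX g1 g2 g' hB p5 s2).
exact: (IH _ _ _ _ _ _ _ _ _ _ _ _ B (phi \o fst) dq gX g1 g2 g' hB s1 q5).
Qed.

(** For [t] nonzero, [c t] is [c 0 + t h] with a direction [h] close to [w], so [uniform_dir]
    applies with a direction that varies with [t]. *)
Lemma hasd_chain (K : hilbertType R) (E : preTopologicalLmodType R) (V : set E) P (f : E -> K) df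
  (c : R -> E) w : graded V P -> has_dir V f df -> cont (sumP P P) (V `*` V) df ->
  (forall t, V (c t)) -> V w -> tangent_curve P c w -> hasd (fun t => f (c t)) 0 (df (c 0, w)).
Proof.
move=> gE hf hc Vc Vw ht e e0.
have [l [d d0 hd]] := uniform_dir gE (grV gE) (@subset_refl _ V) hf (Vc 0) Vw
  (hc (c 0, w) (conj (Vc 0) Vw)) e0.
have [d' d0' hd'] := ht l _ (divr_gt0 d0 (ltr0Sn _ 1)).
exists (Num.min d d'); first by rewrite lt_min d0 d0'.
move=> t; rewrite lt_min add0r => /andP[td /hd' td'].
have [->|t0] := eqVneq t 0.
  by rewrite subrr rmorph0 scale0r subrr nm0 normr0 mulr0.
pose h := t^-1 *: (c t - c 0).
have Vh : V h by apply: (sublinZ (grV gE)); apply: (sublinB (grV gE)).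
have ch : c t = c 0 + t *: h by rewrite scalerA divff // scale1r [RHS]addrC subrK.
rewrite ch; apply: hd => //; first by rewrite subrr (gr0 gE).
have t0' : 0 < `|t| by rewrite normr_gt0.
rewrite -(ltr_pM2l t0') -(grZ gE); last exact: (sublinB (grV gE)).
rewrite scalerBr; have -> : t *: h = c t - c 0 by rewrite ch addrC addKr.
by apply: le_lt_trans td' _; rewrite mulrC ltr_pM2l // ltr_pdivrMr // ltr_pMr // ltr1n.
Qed.

(** The differential of the composite is [df] after the tangent map
    [(x, h) |-> (phi x, dphi (x, h))], which is again a smooth map, of one order less. *)
Lemma MB_C_comp n : forall (K : hilbertType R) (E E' : preTopologicalLmodType R) (V : set E) P
  (V' : set E') P' (f : E' -> K) phi, graded V P -> graded V' P' ->
  MB_C n V' f -> smap n V P V' P' phi -> MB_C n V (f \o phi).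
Proof.
have hc (K : hilbertType R) (E E' : preTopologicalLmodType R) (V : set E) P
  (V' : set E') P' (f : E' -> K) phi : graded V P -> graded V' P' ->
  {within V', continuous f} -> (forall p, V p -> V' (phi p)) -> ccont V P P' phi ->
  {within V, continuous (f \o phi)}.
  move=> gE gE' /(contP gE' _ (@subset_refl _ V')) hf v1 c1.
  apply/(contP gE) => // p Vp e e0.
  have [k [d d0 hd]] := hf (phi p) (v1 _ Vp) e e0.
  have [l [d' d0' hd']] := c1 p k d Vp d0.
  by exists l, d' => // q Vq hq; apply: hd; [apply: v1 | apply: hd'].
elim: n => [|n IH] K E E' V P V' P' f phi gE gE' [f1 f2] [p1 p2 p3].
  by split => //; exact: (hc _ _ _ _ _ _ _ _ _ gE gE').
split; first exact: (hc _ _ _ _ _ _ _ _ _ gE gE').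
have [df [f3 f4]] := f2; have [dp [p4 p5]] := p3.
have gX := gradedX gE gE; have gX' := gradedX gE' gE'.
exists (fun p => df (phi p.1, dp p)); split.
  move=> x h Vx Vh; apply/real_deriv0P.
  have Vt s : V (x + s *: h) by apply: (sublinD (grV gE)) => //; apply: (sublinZ (grV gE)).
  have := @hasd_chain K _ _ _ f df (fun t => phi (x + t *: h)) (dp (x, h)) gE'.
  rewrite scale0r addr0; apply.
  - by move=> y k Vy Vk; apply/real_deriv0P; apply: f3.
  - by apply/(contP gX') => //; case: (n) f4 => [|m] [].
  - by move=> t; apply: p1.
  - exact: (smap_V p5 (conj Vx Vh : (V `*` V) (x, h))).
  - exact: p4.
apply: (IH _ _ _ _ _ _ _ df (fun p => (phi p.1, dp p)) gX gX' f4).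
apply: smap_pair => //.
apply: (smap_precomp (linmap_fst gE gE)); exact: smap_le (And3 p1 p2 p3).
Qed.

End SmoothMaps.

Lemma hasd_linC (R : realType) (K : hilbertType R) (c : R[i]) (a b : R -> K) t u w :
  hasd a t u -> hasd b t w -> hasd (fun s => c *: a s + b s) t (c *: u + w).
Proof.
move=> ha hb e e0; have e2 : 0 < e / 2 by rewrite divr_gt0.
have cge : 0 <= complex.Re `|c| by have := normr_ge0 c; rewrite lecE => /andP[].
have c0 : 0 < complex.Re `|c| + 1 by rewrite ltr_wpDl.
have [d d0 hd] := ha _ (divr_gt0 e2 c0); have [d' d0' hd'] := hb _ e2.
exists (Num.min d d'); first by rewrite lt_min d0 d0'.
move=> h; rewrite lt_min => /andP[/hd h1 /hd' h2].
have -> : c *: a (t + h) + b (t + h) - (c *: a t + b t) - h *^ (c *: u + w) =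
    c *: (a (t + h) - a t - h *^ u) + (b (t + h) - b t - h *^ w).
  rewrite !scalerBr scaleCA scalerDr !opprD.
  by rewrite (addrACA (c *: a (t + h))) (addrACA (c *: a (t + h) - _)).
apply: le_trans (nmD _ _) _; rewrite nmZc {1}[e]splitr mulrDl lerD //.
apply: le_trans (ler_wpM2l cge h1) _; rewrite mulrA; apply: ler_wpM2r => //.
by rewrite mulrCA ger_pMr // ler_pdivrMr // mul1r lerDl.
Qed.

(** The exact identity [rdot (c t - v) (c t + v) = 0], divided by [t], tends to [2 rdot w v = 0]. *)
Lemma hasd_norm_orth (R : realType) (K : hilbertType R) (c : R -> K) v w : c 0 = v ->
  (forall t, nm (c t) = nm v) -> hasd c 0 w -> rdot w v = 0.
Proof.
move=> c0 cn hc; apply/eqP; rewrite -normr_eq0 eq_le normr_ge0 andbT.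
suff h (e : R) : 0 < e -> `|rdot w v| <= e by apply/ler_addgt0Pr => e /h; rewrite add0r.
move=> e0.
have M0 : 0 < 4 * (nm v + 1) by rewrite mulr_gt0 // ltr_wpDl // nm_ge0.
have [eta [eta0 eta1 etaM]] := small_scale e0 M0.
have M1 : 0 < 2 * (nm w + 1) ^+ 2 by rewrite mulr_gt0 // exprn_gt0 // ltr_wpDl // nm_ge0.
have [dl [dl0 dl1 dlM]] := small_scale e0 M1.
have [d d0 hd] := hc eta eta0.
have [t [t0 td tl]] : exists t : R, [/\ 0 < t, t < d & t < dl].
  have m0 : 0 < Num.min d dl by rewrite lt_min d0.
  exists (Num.min d dl / 2).
  have tm : Num.min d dl / 2 < Num.min d dl by rewrite ltr_pdivrMr // ltr_pMr // ltr1n.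
  by split; [rewrite divr_gt0 | exact: (lt_le_trans tm (min_lel _ _)) | exact: (lt_le_trans tm (min_ler _ _))].
have := hd t; rewrite gtr0_norm // add0r c0 => /(_ td) hr.
set a := c t in hr; have an : nm a = nm v by exact: cn.
set r := a - v - t *^ w in hr.
have ar : a = v + t *^ w + r by rewrite /r; hring.
have h1 : rdot (a - v) (a + v) = 0.
  by rewrite rdotBl !rdotDr !rdotxx an (rdotC v a); ring.
have e1 : t * (2 * rdot w v) = - rdot r (a + v) - t * rdot w (a - v).
  have : rdot (t *^ w + r) (a + v) = 0.
    by rewrite -h1; congr rdot; rewrite ar; hring.
  by rewrite rdotDl rdotZl !rdotDr rdotNr; lra.
have b1 : `|rdot r (a + v)| <= eta * t * (2 * nm v).
  apply: le_trans (rdot_abs _ _) _; apply: ler_pM; rewrite ?nm_ge0 //.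
  by apply: le_trans (nmD _ _) _; rewrite an; lra.
have b2 : nm (a - v) <= t * (nm w + 1).
  have -> : a - v = t *^ w + r by rewrite ar; hring.
  apply: le_trans (nmD _ _) _; rewrite nmZ gtr0_norm // mulrDr lerD2l mulr1.
  by apply: le_trans hr _; rewrite ger_pMl.
have b3 : `|rdot w (a - v)| <= nm w * (t * (nm w + 1)).
  by apply: le_trans (rdot_abs _ _) _; apply: ler_wpM2l => //; exact: nm_ge0.
have b4 : `|t * (2 * rdot w v)| <= t * (eta * (2 * nm v) + nm w * (t * (nm w + 1))).
  rewrite e1; apply: le_trans (ler_normB _ _) _; rewrite normrN normrM (gtr0_norm t0) mulrDr.
  apply: lerD; first by rewrite mulrCA mulrA.
  by apply: ler_wpM2l b3; exact: ltW.
move: b4; rewrite !normrM (gtr0_norm t0) (@ger0_norm _ 2) // ler_pM2l // => b4.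
have n1 := nm_ge0 v; have n2 := nm_ge0 w.
have b5 : nm w * (t * (nm w + 1)) <= dl * (nm w + 1) ^+ 2.
  have : t * (nm w * (nm w + 1)) <= dl * ((nm w + 1) * (nm w + 1)).
    by apply: ler_pM; rewrite ?mulr_ge0 //; try lra; apply: ler_wpM2r; lra.
  by rewrite expr2; lra.
have b6 : eta * (2 * nm v) <= eta * (2 * (nm v + 1)) by apply: ler_wpM2l; lra.
lra.
Qed.

Lemma MB_C_lin (R : realType) (F : normedModType R[i]) (c : R[i]) n :
  forall (E : preTopologicalLmodType R) (S : set E) (f g : E -> F),
  MB_C n S f -> MB_C n S g -> MB_C n S (fun x => c *: f x + g x).
Proof.
have hc (E : preTopologicalLmodType R) (S : set E) (f g : E -> F) :
    {within S, continuous f} -> {within S, continuous g} ->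
    {within S, continuous (fun x => c *: f x + g x)}.
  move=> hf hg x; apply: cvgD; last exact: hg.
  by apply: cvgZl_tmp; exact: hf.
elim: n => [|n IH] E S f g [f1 f2] [g1 g2]; (split; first exact: hc) => //.
have [df [f3 f4]] := f2; have [dg [g3 g4]] := g2.
exists (fun p => c *: df p + dg p); split; last exact: IH.
move=> x h Sx Sh; have hf := f3 x h Sx Sh; have hg := g3 x h Sx Sh.
have hs := cvgD (cvgZl_tmp (k := c) hf) hg.
rewrite /real_deriv0.
suff <- : (c \*: (fun t : R => (t^-1)%:C *: (f (x + t *: h) - f (x + 0 *: h))) +
    (fun t : R => (t^-1)%:C *: (g (x + t *: h) - g (x + 0 *: h)))) =
  (fun t : R => (t^-1)%:C *: (c *: f (x + t *: h) + g (x + t *: h) -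
    (c *: f (x + 0 *: h) + g (x + 0 *: h)))) by exact: hs.
apply/funext => t; rewrite /= fctE /=.
by rewrite scalerA mulrC -scalerA -scalerDr scalerBr opprD addrACA.
Qed.

(** * Right translations, the derived representation and the adjoint action *)

Section RightTranslation.
Context (R : realType) (HA : hilbertType R) (A : operator HA) (gamma : R -> HA -> HA).
Hypothesis hA : standard_oscillator A gamma.
Local Notation V := (Csmooth A).
Local Notation VO := (osc_of (A := A) V).
Local Notation om := (omegaA A).
Local Notation Pc := (@cinfP R HA A).
Local Notation Vc := (Csmooth A : set (cinf A)).
Local Notation TR := (setT : set R^o).
Local Notation absP := (fun (_ : nat) (x : R^o) => `|x|).

Let sa : selfadjoint A := osc_sa hA.
Let gc : @graded R (cinf A) Vc Pc := graded_cinf sa.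
Let gO := graded_osc hA.
Let gR := @gradedR R.

Lemma Csmooth_iA x : V x -> V (im *: A x).
Proof. by move=> Vx; apply: (CsmoothZ sa); apply: Csmooth_app. Qed.

(** Powers of [A] commute with [gamma t], so the generator relation at each [A^j y] gives the
    derivative in every seminorm. *)
Lemma cinfP_gam_deriv k (y : HA) (e : R) : V y -> 0 < e -> exists2 d : R, 0 < d &
  forall t, `|t| < d -> Pc k (gamma t y - y - t *^ (im *: A y)) <= e * `|t|.
Proof.
move=> Vy; have Vy' := Csmooth_iA Vy.
have key j t : iter j A (gamma t y - y - t *^ (im *: A y)) =
    gamma t (iter j A y) - iter j A y - t *^ (im *: A (iter j A y)).
  have V1 : V (gamma t y - y) by apply: (CsmoothB sa) => //; apply: (gam_V hA).
  have V2 : V (t *^ (im *: A y)) by apply: (CsmoothZ sa).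
  rewrite (iter_appB sa) // (iter_appB sa) ?(iter_appZ sa) ?(gam_iter hA) //.
  - by rewrite -iterSr iterS.
  - exact: Csmooth_app.
  - exact: (gam_V hA).
elim: k e => [|k IH] e e0.
  have /(gam_hasd0 hA) h : dom A y /\ im *: A y = im *: A y by split => //; apply: Csmooth_dom.
  have [d d0 hd] := h e e0; exists d => // t /hd.
  by rewrite /cinfP big_ord1 /= add0r (gam_0 hA).
have e2 : 0 < e / 2 by rewrite divr_gt0.
have [d d0 hd] := IH _ e2.
have /(gam_hasd0 hA) h : dom A (iter k.+1 A y) /\ im *: A (iter k.+1 A y) = im *: A (iter k.+1 A y).
  by split => //; apply: Csmooth_iter.
have [d' d0' hd'] := h _ e2.
exists (Num.min d d'); first by rewrite lt_min d0 d0'.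
move=> t; rewrite lt_min => /andP[/hd h1 /hd' h2].
rewrite /cinfP big_ord_recr {1}[e]splitr mulrDl lerD //.
by move: h2; rewrite add0r (gam_0 hA) -key.
Qed.

Lemma bilin_scale : bilin_map TR absP Vc Pc Vc Pc (fun (a : R^o) (v : cinf A) => a *: v).
Proof.
split.
- by move=> a v _ Vv; apply: (sublinZ (grV gc)).
- by move=> a b v t _ _ _; rewrite scalerDl scalerA.
- by move=> a v v' t _ _ _; rewrite scalerDr !scalerA mulrC.
- by move=> k; exists k => a v _ Vv; rewrite (grZ gc).
Qed.

Lemma bilin_om : bilin_map Vc Pc Vc Pc TR absP (fun u v : cinf A => om u v : R^o).
Proof.
split => //.
- move=> u u' v t Vu Vu' Vv; rewrite (omDl hA) //; last exact: (CsmoothZ sa).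
  by rewrite (omZl hA).
- by move=> u v v' t Vu Vv Vv'; rewrite omDr omZr.
- move=> k; exists 1%N => u v Vu Vv.
  have h : `|om u v| <= Pc 1 u * Pc 0 v by exact: om_le.
  by apply: (le_trans h); apply: ler_wpM2l; [exact: (gr_ge0 gc) | exact: (gr_mono gc)].
Qed.

(** The derivative along [h] is [sigma h] times a map of the same form with [y] replaced by [i A y],
    so the induction runs over all [y] in [V]; smoothness of [y] is what keeps it going. *)
Lemma smap_gam n : forall (E : preTopologicalLmodType R) (VE : set E) P (sigma : E -> R^o) y,
  graded VE P -> linmap VE P TR absP sigma -> V y ->
  smap n VE P Vc Pc (fun p => gamma (sigma p) y : cinf A).
Proof.
have hc (E : preTopologicalLmodType R) (VE : set E) P (sigma : E -> R^o) y :
  linmap VE P TR absP sigma -> V y -> ccont VE P Pc (fun p => gamma (sigma p) y : cinf A).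
  move=> sl Vy p k e Vp e0; have [d d0 hd] := gam_jcont hA k (sigma p) Vy e0.
  exists 0%N, d => // q Vq hq; apply: hd => //; last by rewrite subrr (gr0 gc).
  by case: (sl) => _ _ s3; rewrite -(linmapB _ _ sl); apply: le_lt_trans (s3 0%N _) hq.
elim: n => [|n IH] E VE P sigma y gE sl Vy.
  by split => //; [move=> p _; apply: (gam_V hA) | exact: hc].
split; [by move=> p _; apply: (gam_V hA) | exact: hc |].
have gX := gradedX gE gE.
exists (fun p => sigma p.2 *: (gamma (sigma p.1) (im *: A y) : cinf A)); split.
  move=> x h Vx Vh k e e0.
  have c0 : 0 < `|sigma h| + 1 by rewrite ltr_wpDl.
  have [d d0 hd] := cinfP_gam_deriv k Vy (divr_gt0 e0 c0).
  exists (d / (`|sigma h| + 1)); first by rewrite divr_gt0.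
  move=> t td; case: (sl) => _ s2 _; rewrite !s2 scale0r addr0.
  have -> : t *: sigma h = t * sigma h by [].
  have -> : gamma (sigma x + t * sigma h) y - gamma (sigma x) y -
     t *: (sigma h *: (gamma (sigma x) (im *: A y) : cinf A)) =
     gamma (sigma x) (gamma (t * sigma h) y - y - (t * sigma h) *^ (im *: A y)) :> HA.
    by rewrite !(gamB hA) (gam_add hA) (gamZ hA _ (t * _)%:C) scalerA.
  have V1 : V (gamma (t * sigma h) y - y - (t * sigma h) *^ (im *: A y)).
    apply: (CsmoothB sa); last by apply: (CsmoothZ sa); apply: Csmooth_iA.
    by apply: (CsmoothB sa) => //; apply: (gam_V hA).
  rewrite (cinfP_gam hA) //.
  have le1 : `|t * sigma h| <= (`|sigma h| + 1) * `|t|.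
    by rewrite normrM mulrC ler_wpM2r // lerDl.
  apply: le_trans (hd _ _) _.
    by apply: le_lt_trans le1 _; rewrite mulrC -ltr_pdivlMr.
  apply: le_trans (ler_wpM2l _ le1) _; first by rewrite divr_ge0 // ltW.
  by rewrite mulrA divfK // gt_eqF.
apply: (smap_bilin (phi := sigma \o snd) (psi := fun p => gamma ((sigma \o fst) p) (im *: A y) : cinf A)
  gX gR gc gc bilin_scale).
  by apply: smap_lin => //; apply: linmap_comp sl; apply: linmap_snd.
apply: IH => //; last exact: Csmooth_iA.
by apply: linmap_comp sl; apply: linmap_fst.
Qed.

Lemma osc_ofE : VO = (setT `*` V) `*` setT.
Proof. by apply/seteqP; split => [[[t x] s]|[[t x] s] [[_]]]. Qed.

Lemma linmap_osc_s : linmap VO (@oscP R HA A) TR absP (fun g => g.2).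
Proof.
split => // k x; rewrite /oscP /sumP lerDr addr_ge0 //; exact: (gr_ge0 gc).
Qed.
Lemma linmap_osc_x : linmap VO (@oscP R HA A) Vc Pc (fun g => g.1.2).
Proof.
split => // k x; rewrite /oscP /sumP.
by apply: le_trans (_ : `|x.1.1| + Pc k x.1.2 <= _); rewrite ?lerDl ?lerDr.
Qed.
Lemma linmap_osc_t : linmap VO (@oscP R HA A) TR absP (fun g => g.1.1).
Proof.
split => // k x; rewrite /oscP /sumP.
apply: le_trans (_ : `|x.1.1| + Pc k x.1.2 <= _); rewrite ?lerDl ?lerDr //; exact: (gr_ge0 gc).
Qed.

(** Unlike left translations, right translations are not affine, since the last component of the
    variable enters through [gamma]. Smoothness is assembled from [smap_gam], the coordinates and
    the bilinear form [om]. *)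
Lemma smap_rtrans n (g0 : osc A) : VO g0 ->
  smap n VO (@oscP R HA A) VO (@oscP R HA A) (fun g => osc_mul gamma g g0).
Proof.
move=> Vg0; have Vy : V g0.1.2 by [].
have sg : smap n VO (@oscP R HA A) Vc Pc (fun g : osc A => gamma g.2 g0.1.2 : cinf A).
  by apply: smap_gam => //; exact: linmap_osc_s.
have sx : smap n VO (@oscP R HA A) Vc Pc (fun g : osc A => g.1.2).
  by apply: smap_lin => //; exact: linmap_osc_x.
rewrite {2}osc_ofE.
apply: (smap_pair (phi := fun g : osc A => (g.1.1 + g0.1.1 + 2^-1 * om g.1.2 (gamma g.2 g0.1.2) : R^o,
  (g.1.2 : HA) + gamma g.2 g0.1.2 : cinf A)) gO).
  apply: (smap_pair gO).
    apply: (smap_add (phi := fun g : osc A => g.1.1 + g0.1.1)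
      (psi := fun g : osc A => (2^-1 : R^o) *: (om g.1.2 (gamma g.2 g0.1.2) : R^o)) gO gR).
      apply: (smap_add gO gR); last exact: smap_const.
      by apply: smap_lin => //; exact: linmap_osc_t.
    have sh : smap n VO (@oscP R HA A) Vc Pc
        (fun g : osc A => (2^-1 : R) *: (gamma g.2 g0.1.2 : cinf A)).
      apply: (smap_bilin (phi := fun=> 2^-1 : R^o) gO gR gc gc bilin_scale) => //.
      exact: smap_const.
    have := smap_bilin gO gc gc gR bilin_om sx sh.
    congr (smap _ _ _ _ _ _); apply/funext => g; exact: omZr.
  exact: (smap_add gO gc).
by apply: (smap_add gO gR); [apply: smap_lin => //; exact: linmap_osc_s | exact: smap_const].
Qed.

Section Rep.
Context (K : hilbertType R) (pi : osc A -> K -> K).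
Hypothesis hpi : smooth_rep gamma V pi.
Let urep := hpi.1.
Local Notation P := (@oscP R HA A).
Local Notation smv := (smooth_vectors V pi).

Lemma V_real : real_subspace V.
Proof. by split; [exact: (Csmooth0 sa) | move=> r x y; apply: (CsmoothL sa)]. Qed.
Let vg : forall t x, V x -> V (gamma t x) := fun t x h => gam_V hA t h.

Lemma smooth_translate v g0 : smv v -> VO g0 -> smv (pi g0 v).
Proof.
move=> sv Vg n; have h := MB_C_comp gO gO (sv n) (smap_rtrans n Vg).
apply: (MB_C_ext (grV gO) _ h) => g Vg' /=; exact: (rep_mul urep).
Qed.

(* [dpi(X) v], computed along the straight line [t |-> t *: X] rather than along
   [exp]; the default 0 is only reached when [v] is not smooth. *)
Definition dvec v X : K := xget 0 [set w | hasd (fun t : R => pi (t *: X) v) 0 w].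

Lemma dvecP v : smv v -> exists df : osc A * osc A -> K,
  [/\ has_dir VO (fun g => pi g v) df, cont (sumP P P) (VO `*` VO) df &
      forall X, VO X -> dvec v X = df (0, X)].
Proof.
move=> /(_ 1%N) [_ [df [h1 h2]]]; exists df.
have h1' : has_dir VO (fun g => pi g v) df by move=> x h Vx Vh; apply/real_deriv0P; exact: h1.
split => //; first by apply/(contP (gradedX gO gO)) => //; case: h2.
move=> X VX; have h := h1' 0 X (osc_0_V hA) VX.
have {}h : hasd (fun t : R => pi (t *: X) v) 0 (df (0, X)).
  by move: h; under eq_fun do rewrite add0r.
by rewrite /dvec; apply: (xget_unique _ h) => y hy; exact: hasd_unique hy h.
Qed.

Lemma dvec_hasd v X : smv v -> VO X -> hasd (fun t : R => pi (t *: X) v) 0 (dvec v X).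
Proof.
move=> sv VX; have [df [h1 _ ->]] := dvecP sv => //.
by have := h1 0 X (osc_0_V hA) VX; under eq_fun do rewrite add0r.
Qed.

Lemma dvec_uniq v X w : smv v -> VO X -> hasd (fun t : R => pi (t *: X) v) 0 w -> dvec v X = w.
Proof. by move=> sv VX; apply: hasd_unique (dvec_hasd sv VX). Qed.

Lemma dvecL v X Y r : smv v -> VO X -> VO Y -> dvec v (X + r *: Y) = dvec v X + r *^ dvec v Y.
Proof.
move=> sv VX VY; have [df [h1 h2 h3]] := dvecP sv.
have V0 := osc_0_V hA; have VrY := sublinZ (grV gO) r VY.
rewrite !h3 //; last exact: (sublinD (grV gO)).
rewrite (dirD gO (grV gO) (@subset_refl _ _) h1 h2) //.
by rewrite (dirZ (grV gO) h1).
Qed.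

Lemma dvec_cont v X (e : R) : smv v -> VO X -> 0 < e -> exists k, exists2 d : R, 0 < d &
  forall Y, VO Y -> P k (Y - X) < d -> nm (dvec v Y - dvec v X) < e.
Proof.
move=> sv VX e0; have [df [h1 h2 h3]] := dvecP sv; have V0 := osc_0_V hA.
have [k [d d0 hd]] := h2 (0, X) (conj V0 VX) e e0.
exists k, d => // Y VY hY; rewrite !h3 //; apply: hd => //.
by rewrite /sumP /= subrr (gr0 gO) add0r.
Qed.

Lemma dvec_chain v (c : R -> osc A) X : smv v -> (forall t, VO (c t)) -> c 0 = 0 -> VO X ->
  tangent_curve P c X -> hasd (fun t => pi (c t) v) 0 (dvec v X).
Proof.
move=> sv Vc0 c0 VX ht; have [df [h1 h2 h3]] := dvecP sv.
by rewrite h3 // -c0; apply: (hasd_chain gO h1 h2).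
Qed.

(* [Ad(g^-1) X], the derivative of [g^-1 (t X) g] at [t = 0]. *)
Definition osc_ad (g X : osc A) : osc A := osc_lin gamma (osc_inv gamma g)
  (X.1.1 + 2^-1 * om X.1.2 g.1.2, X.1.2 + X.2 *: (im *: A g.1.2 : cinf A), X.2).

Lemma osc_ad_V g X : VO g -> VO X -> VO (osc_ad g X).
Proof.
move=> Vg VX; apply: (osc_lin_V hA); first exact: (osc_inv_V hA).
by apply: (sublinD (grV gc)) => //; apply: (sublinZ (grV gc)); apply: Csmooth_iA.
Qed.

Lemma rtrans_tangent g X : VO g -> VO X ->
  tangent_curve P (fun t : R => osc_mul gamma (t *: X) g)
    (X.1.1 + 2^-1 * om X.1.2 g.1.2, X.1.2 + X.2 *: (im *: A g.1.2 : cinf A), X.2).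
Proof.
case: g X => [[t0 y] s0] [[z x] s]; rewrite /osc_of /= => Vy Vx k e e0.
have e3 : 0 < e / 4 by rewrite divr_gt0.
have c0 : 0 < `|s| + 1 by rewrite ltr_wpDl.
have [d d0 hd] := cinfP_gam_deriv k Vy (divr_gt0 e3 c0).
have [d' d0' hd'] := om_cont hA Vx Vy e3.
have [d2 d20 hd2] := cinfP_gam_cont hA 0 Vy d0'.
exists (Num.min d d2 / (`|s| + 1)); first by rewrite divr_gt0 // lt_min d0.
move=> t; rewrite ltr_pdivlMr // lt_min => /andP[t1 t2].
have ts : `|t * s| <= `|t| * (`|s| + 1) by rewrite normrM ler_wpM2l // lerDl.
have b1 := hd _ (le_lt_trans ts t1).
have b2 := hd2 _ (le_lt_trans ts t2).
have b3 : `|om x (gamma (t * s) y) - om x y| < e / 4.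
  by apply: hd' => //; [exact: (gam_V hA) | rewrite subrr (gr0 gc)].
rewrite /oscP /sumP /=.
have -> : (t *: (z : R^o) + t0 + 2^-1 * om (t *: x) (gamma (t *: (s : R^o)) y) -
   (0 *: (z : R^o) + t0 + 2^-1 * om (0 *: x) (gamma (0 *: (s : R^o)) y)) -
   t *: (z + 2^-1 * om x y : R^o)) = t * (2^-1 * (om x (gamma (t * s) y) - om x y)) :> R.
  rewrite (omZl hA) // scale0r -[(0 *: x)]/((0 : R) *^ (x : HA)) (omZl hA) // -![_ *: _]/(_ * _).
  by ring.
have -> : t *: x + gamma (t *: (s : R^o)) y - (0 *: x + gamma (0 *: (s : R^o)) y) -
    t *: (x + s *: (im *: A y : cinf A)) = gamma (t * s) y - y - (t * s) *^ (im *: A y) :> HA.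
  rewrite -[0 *: (s : R^o)]/(0 * s) mul0r (gam_0 hA) -[t *: (s : R^o)]/(t * s).
  rewrite -[t *: x]/(t *^ (x : HA)) -[0 *: x]/((0 : R) *^ (x : HA)).
  rewrite -[t *: (_ + _)]/(t *^ ((x : HA) + s *^ (im *: A y))).
  by hring.
have -> : t *: (s : R^o) + s0 - (0 *: (s : R^o) + s0) - t *: (s : R^o) = 0 :> R.
  by rewrite -![_ *: _]/(_ * _); ring.
rewrite normr0 addr0 !normrM (@ger0_norm _ 2^-1) ?invr_ge0 //.
have b4 : Pc k (gamma (t * s) y - y - (t * s) *^ (im *: A y)) <= e / 4 * `|t|.
  apply: le_trans b1 _; apply: le_trans (ler_wpM2l _ ts) _; first by rewrite divr_ge0 // ltW.
  by rewrite [`|t| * _]mulrC mulrA divfK // gt_eqF.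
apply: le_trans (lerD (ler_wpM2l (normr_ge0 t) (ler_wpM2l _ (ltW b3))) b4) _; first by rewrite invr_ge0.
have := normr_ge0 t; nra.
Qed.

(** The curves [(t X) g] and [g + t (osc_lin g (osc_ad g X))], the latter being [g] times
    [t (osc_ad g X)], have the same tangent vector at [g]. Both sides are therefore the differential
    of the orbit map of [v] at [g] in that direction. *)
Lemma dvec_translate g v X : smv v -> VO g -> VO X ->
  dvec (pi g v) X = pi g (dvec v (osc_ad g X)).
Proof.
move=> sv Vg VX; apply: dvec_uniq => //; first exact: smooth_translate.
have [df [h1 h2 h3]] := dvecP sv; have V0 := osc_0_V hA.
set w : osc A := (X.1.1 + 2^-1 * om X.1.2 g.1.2, X.1.2 + X.2 *: (im *: A g.1.2 : cinf A), X.2).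
have Vw : VO w.
  by apply: (sublinD (grV gc)) => //; apply: (sublinZ (grV gc)); apply: Csmooth_iA.
have Vt t : VO (t *: X) by apply: (sublinZ (grV gO)).
have hc : hasd (fun t : R => pi (osc_mul gamma (t *: X) g) v) 0 (df (osc_mul gamma (0 *: X) g, w)).
  apply: (hasd_chain gO h1 h2) => //; first by move=> t; apply: (osc_mul_V hA).
  exact: rtrans_tangent.
rewrite scale0r (osc_mul0 hA) in hc.
have -> : pi g (dvec v (osc_ad g X)) = df (g, w).
  have VZ := osc_ad_V Vg VX.
  apply: (@hasd_unique _ _ (fun t : R => pi (g + t *: osc_lin gamma g (osc_ad g X)) v) 0).
    have hd := dvec_hasd sv VZ.
    move=> e e0; have [d d0 hd'] := hd e e0; exists d => // t /hd'.
    rewrite !add0r !scale0r addr0 (rep1 hA V_real urep).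
    have := osc_mul_line hA g 0 (osc_ad g X) t; rewrite (osc_mulr0 hA) add0r => <-.
    rewrite (rep_mul urep) //; last exact: (sublinZ (grV gO)).
    by rewrite -(repZ urep) // -!(repB urep) // (rep_nm urep).
  have -> : osc_lin gamma g (osc_ad g X) = w by exact: (osc_linK hA).
  exact: h1.
move: hc; congr (hasd _ _ _); apply/funext => t.
by rewrite (rep_mul urep).
Qed.

Lemma smvL (c : R[i]) v w : smv v -> smv w -> smv (c *: v + w).
Proof.
move=> sv sw n; apply: (MB_C_ext (grV gO) (f := fun g => c *: pi g v + pi g w)).
  by move=> g Vg; rewrite (repL urep).
exact: MB_C_lin.
Qed.

Lemma dvec_lin (c : R[i]) v w X : smv v -> smv w -> VO X ->
  dvec (c *: v + w) X = c *: dvec v X + dvec w X.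
Proof.
move=> sv sw VX; apply: dvec_uniq => //; first exact: smvL.
have h := hasd_linC c (dvec_hasd sv VX) (dvec_hasd sw VX).
move: h; congr (hasd _ _ _); apply/funext => t.
by rewrite (repL urep) //; apply: (sublinZ (grV gO)).
Qed.

Lemma dvec_orth v X : smv v -> VO X -> rdot (dvec v X) v = 0.
Proof.
move=> sv VX; apply: (hasd_norm_orth (c := fun t : R => pi (t *: X) v)).
- by rewrite scale0r (rep1 hA V_real urep).
- by move=> t; rewrite (rep_nm urep) //; apply: (sublinZ (grV gO)).
- exact: dvec_hasd.
Qed.

Lemma dvec_skew v w X : smv v -> smv w -> VO X -> rdot (dvec v X) w = - rdot v (dvec w X).
Proof.
move=> sv sw VX; have svw := smvL 1 sv sw.
have := dvec_orth svw VX; rewrite dvec_lin // !scale1r rdotDl !rdotDr !dvec_orth //.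
by rewrite addr0 add0r (rdotC v) => /eqP; rewrite addr_eq0 => /eqP.
Qed.

End Rep.
End RightTranslation.

(** * The exponential map *)

(* Unlike in the library's [ge0_le_integral], [f] and [g] need not be measurable. *)
Lemma ge0_integral_le d (T : measurableType d) (R : realType) (mu : {measure set T -> \bar R})
    (D : set T) (f g : T -> \bar R) : (forall x, D x -> (0 <= f x)%E) ->
  (forall x, D x -> (f x <= g x)%E) ->
  (\int[mu]_(x in D) f x <= \int[mu]_(x in D) g x)%E.
Proof.
move=> f0 fg; have g0 x : D x -> (0 <= g x)%E by move=> Dx; apply: le_trans (f0 x Dx) (fg x Dx).
rewrite (integral_mkcond D f) (integral_mkcond D g).
rewrite !ge0_integralTE; [|exact: erestrict_ge0|exact: erestrict_ge0].
apply: le_ereal_sup => _ /= [h hf <-]; exists h => // x.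
exact: (le_trans (hf x) (lee_restrict fg x)).
Qed.

Section Integral01.
Context (R : realType).
Local Notation mu := (@lebesgue_measure R).

Definition I01 (f : R -> R) : R := \int[mu]_(t in `[0%R, 1%R]) f t.

(** Positive and negative parts are compared separately with the integral of a constant, so [f] may
    be arbitrary; this is convenient for the iterated integral in [osc_exp]. *)
Lemma I01_le (f : R -> R) (c : R) : (forall t, 0 <= t <= 1 -> `|f t| <= c) -> `|I01 f| <= c.
Proof.
move=> hf.
have c0 : 0 <= c by apply: le_trans (normr_ge0 (f 0)) (hf 0 _); rewrite lexx ler01.
have m01 : mu `[0%R, 1%R]%classic = 1%:E.
  by rewrite lebesgue_measure_itv /= lte_fin ltr01 oppr0 adde0.
have ic : (\int[mu]_(t in `[0%R, 1%R]) c%:E = c%:E)%E.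
  by rewrite integral_cst // -[RHS]mule1; congr (_ * _)%E; exact: m01.
have hin t : `[0%R, 1%R]%classic t -> 0 <= t <= 1 by rewrite /= in_itv.
rewrite /I01 /Rintegral integralE.
set p := (\int[mu]_(x in _) _^\+ _)%E; set n := (\int[mu]_(x in _) _^\- _)%E.
have p0 : (0 <= p)%E by apply: integral_ge0.
have n0 : (0 <= n)%E by apply: integral_ge0.
have pc : (p <= c%:E)%E.
  rewrite -ic; apply: ge0_integral_le => // t /hin /hf.
  by rewrite ler_norml => /andP[_ h]; rewrite funepos.unlock /= ge_max !lee_fin h c0.
have nc : (n <= c%:E)%E.
  rewrite -ic; apply: ge0_integral_le => // t /hin /hf.
  by rewrite ler_norml => /andP[h _]; rewrite funeneg.unlock /= ge_max !lee_fin lerNl h c0.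
clearbody p n; move: p n p0 n0 pc nc => [p| |] [n| |] //=; rewrite !lee_fin => p0 n0 pc nc.
by rewrite ler_norml; lra.
Qed.

Lemma I01_ftc (F f : R -> R) : continuous f -> (forall t, hasdR F t (f t)) -> I01 f = F 1 - F 0.
Proof.
move=> cf hF.
have dF (t : R) : is_derive t 1 F (f t) by apply: hasdR_is_derive.
have cF : continuous F.
  move=> t; apply: differentiable_continuous; apply/derivable1_diffP.
  by have := dF t; case.
rewrite /I01 /Rintegral (@continuous_FTC2 _ f F 0 1) //.
- by apply: continuous_subspaceT.
- split; first by move=> t _; have := dF t; case.
  + by apply: cvg_at_right_filter; exact: cF.
  + by apply: cvg_at_left_filter; exact: cF.
- by move=> t _; rewrite derive1E; exact: derive_val.
Qed.

Lemma I01_integrable (f : R -> R) : continuous f -> mu.-integrable `[0%R, 1%R] (EFin \o f).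
Proof.
move=> cf; apply: continuous_compact_integrable; first exact: segment_compact.
exact: continuous_subspaceT.
Qed.

Lemma I01B (f g : R -> R) : continuous f -> continuous g ->
  I01 (fun t => f t - g t) = I01 f - I01 g.
Proof. by move=> cf cg; apply: RintegralB => //; apply: I01_integrable. Qed.

Lemma continuousP_eps (f : R -> R) :
  (forall t (e : R), 0 < e -> exists2 d : R, 0 < d & forall s, `|s - t| < d -> `|f s - f t| < e) ->
  continuous f.
Proof.
move=> h t; apply/cvgrPdist_lt => e /(h t) [d d0 hd].
apply/nbhs_ballP; exists d => // s; rewrite /ball /= distrC => /hd.
by rewrite distrC.
Qed.

Lemma I01_const (c : R) : I01 (fun=> c) = c.
Proof.
rewrite (@I01_ftc (fun t => t * c)) ?mul1r ?mul0r ?subr0 //; first by move=> t; apply: cvg_cst.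
move=> t e e0; exists 1 => // h _.
have -> : (t + h) * c - t * c - h * c = 0 by ring.
by rewrite normr0 mulr_ge0 // ltW.
Qed.

End Integral01.

(** * Pettis integrals of orbits and the derivative of the exponential map *)

Section Pettis.
Context (R : realType) (HA : hilbertType R) (A : operator HA) (gamma : R -> HA -> HA).
Hypothesis hA : standard_oscillator A gamma.
Local Notation V := (Csmooth A).
Local Notation VO := (osc_of (A := A) V).
Local Notation om := (omegaA A).
Local Notation Pc := (@cinfP R HA A).
Hypothesis D_dense : forall x k (e : R), V x -> 0 < e ->
  exists2 y, V y & Pc k (im *: A y - x) < e.

Let sa : selfadjoint A := osc_sa hA.
Let gc : @graded R (cinf A) V Pc := graded_cinf sa.
Let gO := graded_osc hA.

(** The sequences [A^k (u n)] have limits [l k], and closedness of [A] gives [l k.+1 = A (l k)], so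
    [l 0] is smooth with iterates [l k]. *)
Lemma cinf_complete (u : nat -> HA) : (forall n, V (u n)) ->
  (forall k (e : R), 0 < e -> exists N, forall m n, (N <= m)%N -> (N <= n)%N -> Pc k (u m - u n) < e) ->
  exists2 l, V l & forall k (e : R), 0 < e -> exists N, forall n, (N <= n)%N -> Pc k (u n - l) < e.
Proof.
move=> Vu hu.
have hk k : exists l, forall e : R, 0 < e -> exists N, forall n, (N <= n)%N -> nm (iter k A (u n) - l) < e.
  apply: cauchy_nm => e e0; have [N hN] := hu k e e0; exists N => m n hm hn.
  rewrite -(iter_appB sa) //; apply: le_lt_trans (hN m n hm hn).
  by apply: cinfP_ge.
have /choice [l hl] := hk.
have key k : dom A (l k) /\ l k.+1 = A (l k).
  apply: (app_closed sa) => e e0.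
  have [N hN] := hl k e e0; have [N' hN'] := hl k.+1 e e0.
  exists (iter k A (u (maxn N N'))); first exact: Csmooth_iter.
  by split; [apply: hN; exact: leq_maxl | apply: hN'; exact: leq_maxr].
have lk k : l k = iter k A (l 0%N) by elim: k => //= k <-; have [] := key k.
have Vl : V (l 0%N) by move=> k; rewrite -lk; have [] := key k.
exists (l 0%N) => // k; elim: k => [|k IH] e e0.
  have [N hN] := hl 0%N e e0; exists N => n /hN; by rewrite /cinfP big_ord1.
have e2 : 0 < e / 2 by rewrite divr_gt0.
have [N hN] := IH _ e2; have [N' hN'] := hl k.+1 _ e2.
exists (maxn N N') => n; rewrite geq_max => /andP[/hN h1 /hN' h2].
rewrite /cinfP big_ord_recr [ltRHS]splitr ltrD //.
by rewrite (iter_appB sa) // -lk.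
Qed.

Lemma gam_mvt u s w (M : R) : dom A u ->
  (forall t, `|t| <= `|s| -> nm (gamma t (im *: A u) - w) <= M) ->
  nm (gamma s u - u - s *^ w) <= `|s| * M.
Proof.
move=> du hM.
have hc t : 0 <= t <= 1 -> hasd (fun t => gamma (s * t) u) t (s *^ gamma (s * t) (im *: A u)).
  move=> _; have h : hasd (fun r => gamma (s * r) (gamma (s * t) u)) 0 (s *^ (im *: A (gamma (s * t) u))).
    apply: (hasd_scale s (c := fun r => gamma r (gamma (s * t) u))).
    by apply/(gam_hasd0 hA); split => //; have [] := gam_app hA (s * t) du.
  have [_ hh] := gam_app hA (s * t) du; rewrite hh -(gamZ hA) in h.
  move=> e e0; have [d d0 hd] := h e e0; exists d => // r /hd.
  by rewrite add0r mulr0 (gam_0 hA) -(gam_add hA) -mulrDr (addrC r).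
have := mvt_nm (w := s *^ w) (M := `|s| * M) ler01 hc.
rewrite mulr1 mulr0 (gam_0 hA) !subr0 rmorph1 scale1r mulr1; apply => t /andP[t0 t1].
rewrite -scalerBr nmZ ler_wpM2l // hM // normrM (ger0_norm t0) ler_piMr //.
Qed.

Lemma rdot_gam_cont s (x z : HA) : continuous (fun t : R => rdot (gamma (s * t) x) z).
Proof.
apply: continuousP_eps => t e e0.
have z0 : 0 < nm z + 1 by rewrite ltr_wpDl // nm_ge0.
have s0 : 0 < `|s| + 1 by rewrite ltr_wpDl.
have [d d0 hd] := gam_cont hA x (divr_gt0 e0 z0).
exists (d / (`|s| + 1)); first by rewrite divr_gt0.
move=> t' ht; rewrite -rdotBl; apply: le_lt_trans (rdot_abs _ _) _.
have -> : gamma (s * t') x - gamma (s * t) x = gamma (s * t) (gamma (s * (t' - t)) x - x).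
  by rewrite (gamB hA) -(gam_add hA) -mulrDr (addrC t) subrK.
rewrite (gam_nm hA); apply: le_lt_trans (_ : nm (gamma (s * (t' - t)) x - x) * (nm z + 1) < _).
  by apply: ler_wpM2l; [exact: nm_ge0 | rewrite lerDl].
rewrite -ltr_pdivlMr //; apply: hd; rewrite normrM.
apply: le_lt_trans (_ : (`|s| + 1) * `|t' - t| < _); first by rewrite ler_wpM2r // lerDl.
by rewrite mulrC -ltr_pdivlMr.
Qed.

(** Real pairings suffice: the imaginary part of the pairing with [z] is the real pairing with
    [i z]. *)
Definition weak_integral (f : R -> HA) (y : HA) := forall z, rdot y z = I01 (fun t => rdot (f t) z).

Lemma integral01_weak (f : R -> HA) y : weak_integral f y -> integral01 f = y.
Proof.
move=> hy; rewrite /integral01; apply: xget_unique.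
  move=> z /=; rewrite dotpRI; congr (_ +i* _); first exact: hy.
  rewrite hy; apply: eq_Rintegral => t _; by rewrite dotpRI.
move=> y' /= h; apply: rdot_ext => z; rewrite hy /rdot h; by apply: eq_Rintegral.
Qed.

(* On the range of [D] the integral is [s^-1 (gamma s y - y)] with [x = i A y]; the
   general case follows by density and completeness of [V]. *)
Lemma weak_integral_exists s (x : HA) : V x -> exists Y, [/\ V Y,
  weak_integral (fun t => gamma (s * t) x) Y &
  forall k (e : R), (forall t, `|t| <= `|s| -> nm (gamma t (iter k A x) - iter k A x) <= e) ->
    nm (iter k A Y - iter k A x) <= e].
Proof.
move=> Vx; have [->|s0] := eqVneq s 0.
  exists x; split => //.
    move=> z; rewrite -[LHS]I01_const; congr I01; apply/funext => t.
    by rewrite mul0r (gam_0 hA).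
  move=> k e h; rewrite subrr nm0.
  by have := h 0; rewrite normr0 (gam_0 hA) subrr nm0; apply.
have /choice [u hu] : forall n : nat, exists y, V y /\ Pc n (im *: A y - x) < n.+1%:R^-1.
  move=> n; have [|y Vy hy] := D_dense n Vx (_ : 0 < n.+1%:R^-1); first by rewrite invr_gt0 ltr0Sn.
  by exists y.
have Vu n : V (u n) by case: (hu n).
have Vu' n : V (im *: A (u n)) by apply: (Csmooth_iA hA).
have near_u k (d : R) : 0 < d -> exists N, forall n, (N <= n)%N -> Pc k (im *: A (u n) - x) < d.
  move=> d0; have [N hN] := invSn_small d0; exists (maxn N k) => n.
  rewrite geq_max => /andP[Nn kn].
  exact: (le_lt_trans (gr_mono gc _ kn) (lt_trans (hu n).2 (hN _ Nn))).
(* By the fundamental theorem of calculus this is the integral of [gamma (s t) (i A (u n))] over the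
   unit interval. *)
pose Y n := s^-1 *^ (gamma s (u n) - u n).
have VY n : V (Y n) by apply: (CsmoothZ sa); apply: (CsmoothB sa) => //; apply: (gam_V hA).
have iA k y : V y -> im *: A (iter k A y) = iter k A (im *: A y).
  by move=> Vy; rewrite (iter_appZ sa) -?iterSr ?iterS //; apply: Csmooth_app.
have s0' : 0 < `|s| by rewrite normr_gt0.
(* The average stays within [M] of [w] if the integrand does: the factor [|s|] from the mean value
   inequality cancels [s^-1]. Hence [Y] is Cauchy as soon as the integrands are. *)
have mv k y w (M : R) : V y -> (forall t, `|t| <= `|s| -> nm (gamma t (iter k A (im *: A y)) - w) <= M) ->
    nm (iter k A (s^-1 *^ (gamma s y - y)) - w) <= M.
  move=> Vy hM.
  have Vgy : V (gamma s y - y) by apply: (CsmoothB sa) => //; apply: (gam_V hA).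
  rewrite (iter_appZ sa) // (iter_appB sa) ?(gam_iter hA) //; last exact: (gam_V hA).
  have -> : s^-1 *^ (gamma s (iter k A y) - iter k A y) - w =
      s^-1 *^ (gamma s (iter k A y) - iter k A y - s *^ w).
    by apply: rdot_ext => z; rewrite !(rdotZl, rdotDl, rdotNl); field.
  rewrite nmZ normfV mulrC ler_pdivrMr // mulrC; apply: gam_mvt => //.
  by move=> t ht; rewrite iA //; apply: hM.
have [l Vl hl] : exists2 l, V l & forall k (e : R), 0 < e -> exists N, forall n, (N <= n)%N -> Pc k (Y n - l) < e.
  apply: cinf_complete => // k e e0; have e2 : 0 < e / 2 by rewrite divr_gt0.
  have [N hN] := near_u k _ e2; exists N => m n hm hn.
  have Vmn : V (u m - u n) by apply: (CsmoothB sa).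
  have Vmn' : V (im *: A (u m) - im *: A (u n)) by apply: (CsmoothB sa).
  have iAB : im *: A (u m - u n) = im *: A (u m) - im *: A (u n).
    by have := @iter_appB _ _ _ sa 1 (u m) (u n) (Vu m) (Vu n); rewrite /= => ->; rewrite scalerBr.
  apply: le_lt_trans (_ : Pc k (im *: A (u m) - im *: A (u n)) < _).
    apply: ler_sum => j _; have -> : Y m - Y n = s^-1 *^ (gamma s (u m - u n) - (u m - u n)).
      by rewrite (gamB hA); rewrite /Y; hring.
    rewrite -[X in nm X <= _]subr0; apply: mv => // t _.
    by rewrite subr0 iAB (gam_nm hA).
  apply: le_lt_trans (grB_tri gc k (Vu' m) (Vu' n) Vx) _.
  rewrite (grBC gc k Vx (Vu' n)) [ltRHS]splitr ltrD //; [exact: hN | exact: hN].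
exists l; split => //.
- move=> z; apply/eqP; rewrite -subr_eq0 -normr_eq0 eq_le normr_ge0 andbT.
  suff h (e : R) : 0 < e -> `|rdot l z - I01 (fun t => rdot (gamma (s * t) x) z)| <= e.
    by apply/ler_addgt0Pr => e /h; rewrite add0r.
  move=> e0; have z0 : 0 < 2 * (nm z + 1) by rewrite mulr_gt0 // ltr_wpDl // nm_ge0.
  have eta0 := divr_gt0 e0 z0.
  have [N hN] := near_u 0%N _ eta0; have [N' hN'] := hl 0%N _ eta0.
  set n := maxn N N'; have {}hN := hN n (leq_maxl _ _); have {}hN' := hN' n (leq_maxr _ _).
  rewrite /cinfP !big_ord1 /= in hN hN'.
  have hY : rdot (Y n) z = I01 (fun t => rdot (gamma (s * t) (im *: A (u n))) z).
    rewrite (@I01_ftc _ (fun t => rdot (s^-1 *^ gamma (s * t) (u n)) z)).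
    - by rewrite mulr1 mulr0 (gam_0 hA) -rdotBl -scalerBr.
    - exact: rdot_gam_cont.
    - move=> t; apply: hasd_rdot.
      have hs : hasd (fun r => gamma (s * r) (u n)) t (s *^ gamma (s * t) (im *: A (u n))).
        have h : hasd (fun r => gamma (s * r) (gamma (s * t) (u n))) 0 (s *^ (im *: A (gamma (s * t) (u n)))).
          apply: (hasd_scale s (c := fun r => gamma r (gamma (s * t) (u n)))).
          apply/(gam_hasd0 hA); split => //.
          by have [] := gam_app hA (s * t) (Csmooth_dom (Vu n)).
        have [_ hh] := gam_app hA (s * t) (Csmooth_dom (Vu n)); rewrite hh -(gamZ hA) in h.
        move=> e1 e10; have [d d0 hd] := h e1 e10; exists d => // r /hd.
        by rewrite add0r mulr0 (gam_0 hA) -(gam_add hA) -mulrDr (addrC r).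
      have := @hasd_linC _ _ ((s^-1)%:C) _ (fun=> 0) t _ 0 hs.
      have h0 : hasd (fun=> 0 : HA) t 0.
        by move=> e1 e10; exists 1 => // r _; rewrite scaler0 !subr0 nm0 mulr_ge0 // ltW.
      move=> /(_ h0); rewrite addr0 scalerA -rmorphM /= mulVf // rmorph1 scale1r.
      by under eq_fun do rewrite addr0.
  have -> : rdot l z - I01 (fun t => rdot (gamma (s * t) x) z) =
    - rdot (Y n - l) z + I01 (fun t => rdot (gamma (s * t) (im *: A (u n))) z - rdot (gamma (s * t) x) z).
    by rewrite I01B; [rewrite -hY rdotBl; ring | exact: rdot_gam_cont | exact: rdot_gam_cont].
  apply: le_trans (ler_normD _ _) _; rewrite normrN.
  have b1 : `|I01 (fun t => rdot (gamma (s * t) (im *: A (u n))) z - rdot (gamma (s * t) x) z)| <=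
     e / (2 * (nm z + 1)) * nm z.
    apply: I01_le => t _; rewrite -rdotBl -(gamB hA); apply: le_trans (rdot_abs _ _) _.
    by rewrite (gam_nm hA); apply: ler_wpM2r; [exact: nm_ge0 | exact: ltW].
  have b2 : `|rdot (Y n - l) z| <= e / (2 * (nm z + 1)) * nm z.
    by apply: le_trans (rdot_abs _ _) _; apply: ler_wpM2r; [exact: nm_ge0 | exact: ltW].
  have b3 : e / (2 * (nm z + 1)) * (2 * (nm z + 1)) = e by rewrite divfK // gt_eqF.
  by move: b1 b2 b3 eta0; set q := e / _ => b1 b2 b3 q0; lra.
- move=> k e he; suff h (d : R) : 0 < d -> nm (iter k A l - iter k A x) <= e + d.
    by apply/ler_addgt0Pr.
  move=> d0; have d4 : 0 < d / 4 by rewrite divr_gt0.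
  have [N hN] := near_u k _ d4; have [N' hN'] := hl k _ d4.
  set n := maxn N N'; have {}hN := hN n (leq_maxl _ _); have {}hN' := hN' n (leq_maxr _ _).
  have c1 : nm (iter k A (Y n) - iter k A l) < d / 4.
    by rewrite -(iter_appB sa) //; apply: le_lt_trans hN'; exact: cinfP_ge.
  have c2 : nm (iter k A (im *: A (u n)) - iter k A x) < d / 4.
    by rewrite -(iter_appB sa) //; apply: le_lt_trans hN; exact: cinfP_ge.
  have c3 : nm (iter k A (Y n) - iter k A x) <= e + d / 4.
    apply: mv => // t /he ht.
    apply: le_trans (nmB_tri (gamma t (iter k A x)) _ _) _.
    by rewrite -(gamB hA) (gam_nm hA) addrC lerD // ltW.
  have := nmB_tri (iter k A (Y n)) (iter k A l) (iter k A x); rewrite (nmBC (iter k A l) (iter k A (Y n))).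
  lra.
Qed.

(** The averaging estimate is applied to each [A^j x] with [j <= k]; the sum of these bounds
    produces the factor [k.+1]. *)
Lemma osc_exp_integral t s (x : HA) : V x -> exists Y : HA,
  [/\ V Y, integral01 (fun r => gamma (t * s * r) (t *^ x)) = Y &
  forall k (e : R), (forall r, `|r| <= `|t * s| -> Pc k (gamma r x - x) <= e) ->
    Pc k (Y - t *^ x) <= k.+1%:R * (`|t| * e)].
Proof.
move=> Vx; have Vtx : V (t *^ x) by apply: (CsmoothZ sa).
have [Y [VY hw hY]] := weak_integral_exists (t * s) Vtx.
exists Y; split => //; first exact: integral01_weak.
move=> k e he; rewrite mulr_natl -[k.+1 in leRHS]card_ord -sumr_const.
apply: ler_sum => j _; rewrite (iter_appB sa) //; apply: hY => r /he hr.
rewrite (iter_appZ sa) // (gamZ hA) -scalerBr nmZ; apply: ler_wpM2l => //.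
rewrite -(gam_iter hA) // -(iter_appB sa) //; last exact: (gam_V hA).
by apply: le_trans hr; apply: cinfP_ge; rewrite -ltnS.
Qed.

Lemma osc_exp_V t (X : osc A) : VO X -> VO (osc_exp gamma (t *: X)).
Proof.
case: X => [[z x] s] Vx; rewrite /osc_of /=.
by have [Y [VY -> _]] := osc_exp_integral t s Vx.
Qed.

Lemma osc_exp0 (X : osc A) : VO X -> osc_exp gamma (0 *: X) = 0.
Proof.
case: X => [[z x] s] Vx.
have [Y [VY hY hc]] := osc_exp_integral 0 s Vx.
have Y0 : Y = 0.
  have hr r : `|r| <= `|0 * s| -> Pc 0 (gamma r x - x) <= 0.
    by rewrite mul0r normr0 normr_le0 => /eqP ->; rewrite (gam_0 hA) subrr (gr0 gc).
  have := hc 0%N 0 hr; rewrite normr0 rmorph0 scale0r subr0 mulr0 mulr0 /cinfP big_ord1 /= => h.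
  by apply: nm_eq0; apply/eqP; rewrite eq_le h nm_ge0.
rewrite /osc_exp /=; congr (_, _, _).
- rewrite -[0 *: (z : R^o)]/(0 * z) mul0r add0r.
  set q := (\int[_]_(_ in _) _).
  have : `|q| <= 0.
    apply: I01_le => t _; apply: I01_le => t' _.
    have -> : 0 *: x = 0 :> HA by exact: scale0r.
    by rewrite !(gam0r hA) om0r mul0r normr0.
  by rewrite normr_le0 => /eqP ->; rewrite mulr0.
- by rewrite hY.
- exact: mul0r.
Qed.

(** The central double integral is of order [t^2] and the Pettis integral is [t x] up to [o(t)].
    Derivatives along exp can therefore be computed along straight lines. *)
Lemma osc_exp_tangent (X : osc A) : VO X ->
  tangent_curve (@oscP R HA A) (fun t : R => osc_exp gamma (t *: X)) X.
Proof.
move=> VX k e e0; rewrite osc_exp0 //.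
case: X VX => [[z x] s] Vx; rewrite /osc_of /= in Vx.
pose M := nm (A x) * nm x + 1.
have M0 : 0 < M by rewrite /M ltr_wpDl // mulr_ge0 // nm_ge0.
have e4 : 0 < e / (4 * k.+1%:R) by rewrite divr_gt0 // mulr_gt0 // ltr0Sn.
have [d d0 hd] := cinfP_gam_cont hA k Vx e4.
have s0 : 0 < `|s| + 1 by rewrite ltr_wpDl.
exists (Num.min (d / (`|s| + 1)) (e / M)); first by rewrite lt_min !divr_gt0.
move=> t; rewrite lt_min => /andP[t1 t2].
rewrite subr0 /osc_exp /=.
set q := (\int[_]_(_ in _) _).
have hq : `|q| <= `|t| * (`|t| * M).
  apply: I01_le => r /andP[r0 r1]; apply: I01_le => r' _.
  rewrite -[t *: x]/(t *^ (x : HA)) !(gamZ hA) omZr (omZl hA); last exact: (gam_V hA).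
  rewrite !normrM -!mulrA; apply: ler_wpM2l => //; apply: ler_wpM2l => //.
  rewrite (ger0_norm r0); apply: le_trans (ler_piMr (normr_ge0 _) r1) _.
  apply: le_trans (om_abs _ _ _) _.
  have [_ ->] := gam_app hA (t * (s * (r * r'))) (Csmooth_dom Vx).
  by rewrite !(gam_nm hA) /M lerDl.
have [Y [VY hY hc]] := osc_exp_integral t s Vx.
have -> : integral01 (fun r : R => gamma (t *: (s : R^o) * r) (t *: x)) = Y by exact: hY.
rewrite /oscP /sumP /=.
have -> : t *: (z : R^o) + 2^-1 * q - t *: (z : R^o) = 2^-1 * q by rewrite addrC addrA addNr add0r.
rewrite subrr normr0 addr0 normrM (@ger0_norm _ 2^-1) ?invr_ge0 //.
have b1 : Pc k (Y - t *^ x) <= k.+1%:R * (`|t| * (e / (4 * k.+1%:R))).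
  apply: hc => r hr; apply/ltW/hd; apply: le_lt_trans hr _.
  rewrite normrM; apply: le_lt_trans (_ : `|t| * (`|s| + 1) < _).
    by apply: ler_wpM2l => //; rewrite lerDl.
  by rewrite -ltr_pdivlMr.
have e1 : k.+1%:R * (`|t| * (e / (4 * k.+1%:R))) = `|t| * (e / 4).
  have : (k.+1%:R : R) != 0 by rewrite pnatr_eq0.
  by move: (k.+1%:R : R) => c c0; field.
rewrite e1 in b1.
have b2 : `|t| * (`|t| * M) <= `|t| * e.
  by apply: ler_wpM2l => //; rewrite -ler_pdivlMr // ltW.
apply: le_trans (lerD (ler_wpM2l _ (le_trans hq b2)) b1) _; first by rewrite invr_ge0.
have := normr_ge0 t; nra.
Qed.

End Pettis.

(** * Spectral bounds and numerical range *)

Lemma im_eq0 (R : realType) (K : hilbertType R) (x : K) : im *: x = 0 -> x = 0.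
Proof. by move=> h; apply: nm_eq0; rewrite -nm_i h nm0. Qed.

Section Spectral.
Context (R : realType) (K : hilbertType R) (D : set K) (tau : K -> K).
Hypothesis D0 : D 0.
Hypothesis DL : forall (c : R[i]) v w, D v -> D w -> D (c *: v + w).
Hypothesis tauL : forall (c : R[i]) v w, D v -> D w -> tau (c *: v + w) = c *: tau v + tau w.
Hypothesis tau_skew : forall v w, D v -> D w -> rdot (tau v) w = - rdot v (tau w).

Definition core : set (K * K) := [set p | D p.1 /\ p.2 = im *: tau p.1].
Local Notation T := (closure core).
Implicit Types (a b v w y : K).

Lemma closure_coreP a b : T (a, b) <->
  forall e : R, 0 < e -> exists2 v, D v & nm (v - a) < e /\ nm (im *: tau v - b) < e.
Proof.
split.
  move=> h e e0.
  have /h : nbhs (a, b) [set p | nm (p.1 - a) < e /\ nm (p.2 - b) < e].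
    exists ([set x | nm (x - a) < e], [set x | nm (x - b) < e]) => //=.
    by split; apply/nbhs_nm; exists e.
  by move=> [[v w] [[/= Dv ->] [/= h1 h2]]]; exists v.
move=> h B [[B1 B2] [/= /nbhs_nm [e1 e10 h1] /nbhs_nm [e2 e20 h2]] hB].
have [|v Dv [hv1 hv2]] := h (Num.min e1 e2); first by rewrite lt_min e10 e20.
rewrite !lt_min in hv1 hv2; case/andP: hv1 => hv1 _; case/andP: hv2 => _ hv2.
exists (v, im *: tau v); split => //; apply: hB; split => /=; [exact: h1 | exact: h2].
Qed.

Lemma core_T v : D v -> T (v, im *: tau v).
Proof. by move=> Dv; apply: subset_closure. Qed.

Lemma TL (c : R[i]) a b a' b' : T (a, b) -> T (a', b') -> T (c *: a + a', c *: b + b').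
Proof.
move=> /closure_coreP h /closure_coreP h'; apply/closure_coreP => e e0.
have e2 : 0 < e / 2 by rewrite divr_gt0.
have cge : 0 <= complex.Re `|c| by have := normr_ge0 c; rewrite lecE => /andP[].
have c0 : 0 < complex.Re `|c| + 1 by rewrite ltr_wpDl.
have [v Dv [v1 v2]] := h _ (divr_gt0 e2 c0); have [w Dw [w1 w2]] := h' _ e2.
have key x y x' y' : nm (x - y) < e / 2 / (complex.Re `|c| + 1) -> nm (x' - y') < e / 2 ->
    nm (c *: x + x' - (c *: y + y')) < e.
  move=> k1 k2; rewrite opprD addrACA -scalerBr.
  apply: le_lt_trans (nmD _ _) _; rewrite nmZc [ltRHS]splitr ler_ltD //.
  apply: le_trans (ler_wpM2l cge (ltW k1)) _.
  by rewrite mulrCA ger_pMr // ler_pdivrMr // mul1r lerDl.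
exists (c *: v + w); first exact: DL.
split; first exact: key.
by rewrite tauL // scalerDr (scalerA im) mulrC -scalerA; apply: key.
Qed.

Lemma T0 : T (0, 0).
Proof.
have t0 : tau 0 = 0.
  have := tauL (-1) D0 D0; rewrite scaler0 addr0 => h.
  by rewrite h scaleN1r addNr.
by have := core_T D0; rewrite t0 scaler0.
Qed.

Lemma TB a b a' b' : T (a, b) -> T (a', b') -> T (a - a', b - b').
Proof.
by move=> h h'; have := @TL (-1) _ _ _ _ h' h; rewrite !scaleN1r ![- _ + _]addrC.
Qed.

Lemma TZ (c : R[i]) a b : T (a, b) -> T (c *: a, c *: b).
Proof. by move=> h; have := @TL c _ _ _ _ h T0; rewrite !addr0. Qed.

Lemma T_closed a b :
  (forall e : R, 0 < e -> exists p, [/\ T p, nm (p.1 - a) < e & nm (p.2 - b) < e]) -> T (a, b).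
Proof.
move=> h; apply/closure_coreP => e e0; have e2 : 0 < e / 2 by rewrite divr_gt0.
have [[x y] [/closure_coreP hT /= h1 h2]] := h _ e2.
have [v Dv [v1 v2]] := hT _ e2; exists v => //; split.
  by have := nmB_tri x v a; lra.
by have := nmB_tri y (im *: tau v) b; lra.
Qed.

Lemma limit_rdot_le (a b a' b' : K) (c : R) : T (a, b) ->
  (forall v, D v -> rdot (im *: tau v) a' - rdot v b' <= c) -> rdot b a' - rdot a b' <= c.
Proof.
move=> /closure_coreP h hc; apply/ler_addgt0Pr => e e0.
have M0 : 0 < nm a' + nm b' + 1 by have := nm_ge0 a'; have := nm_ge0 b'; lra.
have [v Dv [v1 v2]] := h _ (divr_gt0 e0 M0).
have -> : rdot b a' - rdot a b' = (rdot (im *: tau v) a' - rdot v b') +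
    (rdot (v - a) b' - rdot (im *: tau v - b) a') by rewrite !rdotBl; ring.
apply: lerD; first exact: hc.
have k1 := rdot_abs (v - a) b'; have k2 := rdot_abs (im *: tau v - b) a'.
rewrite !ler_norml in k1 k2; case/andP: k1 => _ k1; case/andP: k2 => k2 _.
set q := e / _ in v1 v2.
have eq : q * (nm a' + nm b' + 1) = e by rewrite divfK // gt_eqF.
have := ler_wpM2r (nm_ge0 b') (ltW v1); have := ler_wpM2r (nm_ge0 a') (ltW v2).
have : 0 < q by rewrite divr_gt0.
move: k1 k2 eq; clear; lra.
Qed.

Lemma tau_i v : D v -> tau (im *: v) = im *: tau v.
Proof.
move=> Dv; have t0 : tau 0 = 0.
  have := tauL (-1) D0 D0; rewrite scaler0 addr0 => h.
  by rewrite h scaleN1r addNr.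
by have := tauL im Dv D0; rewrite t0 !addr0.
Qed.

Lemma tau_sym v w : D v -> D w -> rdot (im *: tau v) w = rdot v (im *: tau w).
Proof.
move=> Dv Dw; have Dw' : D (im *: w) by have := DL im Dw D0; rewrite addr0.
by rewrite rdot_iNr tau_skew // opprK tau_i.
Qed.

Lemma T_sym_core v a b : D v -> T (a, b) -> rdot (im *: tau v) a = rdot v b.
Proof.
move=> Dv h; apply/eqP; rewrite eq_le; apply/andP; split.
  have := @limit_rdot_le a b (- v) (- (im *: tau v)) 0 h.
  rewrite !rdotNr (rdotC b) (rdotC a).
  have hh u : D u -> rdot (im *: tau u) (- v) - rdot u (- (im *: tau v)) <= 0.
    by move=> Du; rewrite !rdotNr tau_sym // subrr.
  by move=> /(_ hh); lra.
have := @limit_rdot_le a b v (im *: tau v) 0 h.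
rewrite (rdotC b) (rdotC a).
have hh u : D u -> rdot (im *: tau u) v - rdot u (im *: tau v) <= 0.
  by move=> Du; rewrite tau_sym // subrr.
by move=> /(_ hh); lra.
Qed.

Lemma T_sym a b a' b' : T (a, b) -> T (a', b') -> rdot b a' = rdot a b'.
Proof.
have half x y x' y' : T (x, y) -> T (x', y') -> rdot y x' - rdot x y' <= 0.
  by move=> h h'; apply: (limit_rdot_le h) => v Dv; rewrite (T_sym_core Dv h') subrr.
move=> h h'; have := half _ _ _ _ h h'; have := half _ _ _ _ h' h.
rewrite (rdotC b') (rdotC a'); lra.
Qed.

Lemma T_sym_i a b : T (a, b) -> rdot b (im *: a) = 0.
Proof.
move=> h; have := T_sym h (@TZ im _ _ h).
rewrite -[rdot a _]opprK -rdot_iNr (rdotC (im *: a)); lra.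
Qed.

(** Symmetry kills the cross term, so the squared norm of [b - i a] is the sum of those of [b] and
    [a]. *)
Lemma nm_shift_i a b : T (a, b) -> nm a <= nm (b - im *: a).
Proof.
move=> h; rewrite -(@ler_pXn2r _ 2) ?nnegrE ?nm_ge0 // -!rdotxx.
rewrite rdotBl !rdotBr rdot_ii T_sym_i // (rdotC (im *: a)) T_sym_i //.
have := rdot_ge0 b; lra.
Qed.

(** The lower bound and closedness of [T] make the range of [T - c] closed; the orthogonality
    hypothesis makes it dense, and [complete_subspace] concludes. *)
Lemma range_all (c : R[i]) (C : R) : (forall a b, T (a, b) -> nm a <= C * nm (b - c *: a)) ->
  (forall w, (forall v, D v -> rdot (im *: tau v - c *: v) w = 0) -> w = 0) ->
  forall y, exists a, T (a, y + c *: a).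
Proof.
move=> hC hp; apply: (complete_subspace (M := [set y | exists a, T (a, y + c *: a)])).
- move=> r x y [a ha] [b hb]; exists (r *^ a + b).
  have -> : r *^ x + y + c *: (r *^ a + b) = r *^ (x + c *: a) + (y + c *: b).
    by rewrite !scalerDr addrACA !scalerA [c * _]mulrC.
  exact: (@TL r%:C _ _ _ _ ha hb).
- by exists 0; rewrite scaler0 addr0; apply: T0.
- move=> y hy.
  have [f hf] : exists f : nat -> K * K, forall n, T ((f n).1, (f n).2 + c *: (f n).1) /\
      nm ((f n).2 - y) < n.+1%:R^-1.
    suff /choice [f hf] : forall n, exists p : K * K, T (p.1, p.2 + c *: p.1) /\
        nm (p.2 - y) < n.+1%:R^-1 by exists f.
    by move=> n; have [|m [a ha] hm] := hy n.+1%:R^-1; [rewrite invr_gt0 | exists (a, m)].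
  have C1 : 0 < 2 * `|C| + 1 by have := normr_ge0 C; lra.
  have small (e : R) : 0 < e -> exists N, forall n, (N <= n)%N -> nm ((f n).2 - y) < e.
    move=> e0; have [N hN] := invSn_small e0; exists N => n hn.
    by apply: lt_le_trans (hf n).2 _; apply/ltW/hN.
  have [|a ha] := @cauchy_nm _ _ (fun n => (f n).1).
    move=> e e0; have [N hN] := small _ (divr_gt0 e0 C1); exists N => m n hm hn.
    have := hC _ _ (TB (hf m).1 (hf n).1).
    set p := f m; set q := f n.
    have -> : p.2 + c *: p.1 - (q.2 + c *: q.1) - c *: (p.1 - q.1) = p.2 - q.2.
      by rewrite scalerBr; hring.
    have := nmB_tri y p.2 q.2; rewrite (nmBC y).
    have := hN _ hm; have := hN _ hn; rewrite -/p -/q => h1 h2 h3 h4.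
    have h5 : nm (p.2 - q.2) < 2 * (e / (2 * `|C| + 1)) by lra.
    have e1 : 0 < e / (2 * `|C| + 1) by rewrite divr_gt0.
    have : e / (2 * `|C| + 1) * (2 * `|C| + 1) = e by rewrite divfK // gt_eqF.
    have := ler_wpM2r (nm_ge0 (p.2 - q.2)) (ler_norm C).
    have := ler_wpM2l (normr_ge0 C) (ltW h5); lra.
  exists a; apply: T_closed => e e0.
  have c1 : 0 <= complex.Re `|c| by have := normr_ge0 c; rewrite lecE => /andP[].
  have c0 : 0 < complex.Re `|c| + 1 by lra.
  have [d [d0 d1 dc]] := small_scale (divr_gt0 e0 (ltr0n R 2)) c0.
  have [N1 hN1] := ha _ d0; have [N2 hN2] := small _ (divr_gt0 e0 (ltr0n R 2)).
  have := hN1 _ (leq_maxl N1 N2); have := hN2 _ (leq_maxr N1 N2).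
  set n := maxn N1 N2 => h2 h1.
  exists ((f n).1, (f n).2 + c *: (f n).1); split; first exact: (hf n).1.
    by apply: lt_le_trans h1 _; have := mulr_ge0 (ltW d0) c1; lra.
  rewrite opprD addrACA -scalerBr; apply: le_lt_trans (nmD _ _) _.
  rewrite nmZc [ltRHS]splitr ltr_leD //; apply: le_trans dc.
  have := ler_wpM2l c1 (ltW h1); lra.
move=> w hw; apply: hp => v Dv; apply: hw; exists v.
by rewrite subrK; apply: core_T.
Qed.

Lemma T_numeric (M : R) : (forall v, D v -> rdot (im *: tau v) v <= M * nm v ^+ 2) ->
  forall a b, T (a, b) -> rdot b a <= M * nm a ^+ 2.
Proof.
move=> hM a b /closure_coreP h; apply/ler_addgt0Pr => e e0.
set C := (nm a + 1) + nm b + 1 + `|M| * (2 * nm a + 1).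
have na := nm_ge0 a; have nb := nm_ge0 b; have M0 := normr_ge0 M.
have C0 : 0 < C by rewrite /C; have := mulr_ge0 M0 na; lra.
have [d [d0 d1 dC]] := small_scale e0 C0.
have [v Dv [v1 v2]] := h _ d0; have nv := nm_ge0 v.
have := hM _ Dv.
have vle : nm v <= nm a + 1 by have := nm_tri v a; lra.
have e1 : rdot b a = rdot (im *: tau v) v - rdot (im *: tau v - b) v - rdot b (v - a).
  by rewrite rdotBl rdotBr; ring.
have k1 := rdot_abs (im *: tau v - b) v; have k2 := rdot_abs b (v - a).
rewrite !ler_norml in k1 k2; case/andP: k1 => k1 _; case/andP: k2 => k2 _.
have k3 : nm (im *: tau v - b) * nm v <= d * (nm a + 1).
  by apply: ler_pM => //; [exact: nm_ge0 | exact: ltW].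
have k4 : nm b * nm (v - a) <= nm b * d by apply: ler_wpM2l => //; exact: ltW.
have k5 : M * nm v ^+ 2 - M * nm a ^+ 2 <= `|M| * (d * (2 * nm a + 1)).
  rewrite -mulrBr; apply: le_trans (ler_norm _) _; rewrite normrM ler_wpM2l // subr_sqr normrM.
  apply: ler_pM => //; last by rewrite ger0_norm; lra.
  rewrite ler_norml; have := nm_tri v a; have := nm_tri a v; rewrite (nmBC a); lra.
have k6 : nm a ^+ 2 = nm a * nm a by rewrite expr2.
rewrite /C in dC; lra.
Qed.

(** The numerical bound makes [T - r] bounded below by [r - M]. Essential self-adjointness enters
    for the density of the range: a vector orthogonal to it is shown to lie in the domain of [T] as
    an eigenvector for [r], which the lower bound excludes. *)
Lemma lt_sup_resolvent (M r : R) :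
  (forall (s : bool) w, (forall v, D v -> rdot (tau v) w = (-1) ^+ s * rdot v w) -> w = 0) ->
  (forall v, D v -> rdot (im *: tau v) v <= M * nm v ^+ 2) ->
  M < r -> resolvent_set T r%:C.
Proof.
move=> esa hM Mr; have r0 : 0 < r - M by lra.
have lower a b : T (a, b) -> (r - M) * nm a <= nm (b - r *^ a).
  move=> h; have [a0|pa] := leP (nm a) 0.
    by have -> : nm a = 0 by [apply/eqP; rewrite eq_le a0 nm_ge0]; rewrite mulr0 nm_ge0.
  rewrite -(ler_pM2r pa); have := T_numeric hM h.
  have := rdot_abs (b - r *^ a) a; rewrite ler_norml => /andP[h1 _].
  move: h1; rewrite rdotBl rdotZl rdotxx expr2; lra.
have bound a b : T (a, b) -> nm a <= (r - M)^-1 * nm (b - r *^ a).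
  by move=> h; rewrite mulrC ler_pdivlMr // mulrC lower.
have sol : forall y, exists a, T (a, y + r *^ a).
  apply: (range_all bound) => w hw.
  have ri : forall y, exists a, T (a, y + im *: a).
    apply: (@range_all im 1) => [a b h|z hz]; first by rewrite mul1r nm_shift_i.
    apply: im_eq0; apply: (esa false) => v Dv.
    have := hz v Dv; rewrite -scalerBr rdot_iNr rdotBl; lra.
  (* [a] solves [(T - i) a = (r - i) w]. Then [i (w - a)] satisfies the other deficiency equation
     and vanishes, so [w] is in the domain. *)
  have [a ha] := ri (r *^ w - im *: w).
  have wa : w - a = 0.
    apply: im_eq0; apply: (esa true) => v Dv; rewrite expr1 mulN1r.
    have := hw v Dv; have := T_sym_core Dv ha.
    rewrite !scalerBr !rdotBr rdotBl !(rdotDr, rdotNr, rdotZl, rdotZr) !rdot_iNr; lra.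
  have {}wa : a = w by rewrite -(subrK a w) wa add0r.
  rewrite wa subrK in ha.
  have := lower _ _ ha; rewrite subrr nm0 pmulr_rle0 // => h.
  by apply: nm_eq0; apply/eqP; rewrite eq_le h nm_ge0.
split; last first.
  exists (r - M)^-1 => v w h; rewrite !normE -rmorphM lecR; exact: bound.
move=> w; have [a ha] := sol w; exists a; split => // a' ha'.
have := bound _ _ (TB ha ha').
have -> : w + r *^ a - (w + r *^ a') - r *^ (a - a') = 0 by rewrite scalerBr; hring.
rewrite nm0 mulr0 => h; apply/eqP; rewrite -subr_eq0; apply/eqP.
by apply: nm_eq0; apply/eqP; rewrite eq_le h nm_ge0.
Qed.

Lemma spectrum_sup_le (M : R) :
  (forall (s : bool) w, (forall v, D v -> rdot (tau v) w = (-1) ^+ s * rdot v w) -> w = 0) ->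
  (forall v, D v -> rdot (im *: tau v) v <= M * nm v ^+ 2) ->
  (ereal_sup [set r%:E | r in [set r : R | spectrum T r%:C]] <= M%:E)%E.
Proof.
move=> esa hM; apply: ub_ereal_sup => _ [r hr <-]; rewrite lee_fin leNgt.
by apply/negP => /(lt_sup_resolvent esa hM).
Qed.

(** * From the resolvent set to the numerical range *)

Section Resolvent.
Variables (M r : R).
Hypothesis res : forall q : R, M < q -> resolvent_set T q%:C.
Hypothesis Mr : M < r.

Let solve w : exists a, T (a, w + r *^ a).
Proof. by have [/(_ w) [a [ha _]] _] := res Mr; exists a. Qed.

(* With [mu] the supremum of the symmetric bounded form [w |-> <B w, w>], where
   [B] is the resolvent at [r], the operator [mu - B] is positive and not bounded
   below, so that [r + 1/mu] is in the spectrum unless [mu <= 0]. *)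
Lemma resolvent_numeric_le a b : T (a, b) -> rdot a (b - r *^ a) <= 0.
Proof.
move=> hab; rewrite leNgt; apply/negP => pos0.
have [_ [C0 hC0]] := res Mr.
pose C := `|C0| + 1.
have Cp : 0 < C by rewrite /C ltr_wpDl.
have hC x y : T (x, y) -> nm x <= C * nm (y - r *^ x).
  move=> h; have := hC0 _ _ h; rewrite !normE -rmorphM lecR => h1.
  apply: le_trans h1 _; rewrite ler_wpM2r ?nm_ge0 // /C.
  by have := ler_norm C0; lra.
(* The quotients [<B w, w> / |w|^2], with [B] expressed through the graph: [w] is [p.2 - r *^ p.1]
   and [B w] is [p.1]. *)
pose E := [set q : R | exists p, [/\ T p, nm (p.2 - r *^ p.1) != 0 &
   q = rdot p.1 (p.2 - r *^ p.1) / nm (p.2 - r *^ p.1) ^+ 2]].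
have nz x : nm x != 0 -> 0 < nm x ^+ 2 by move=> h; rewrite exprn_gt0 // lt_def h nm_ge0.
have n0 : nm (b - r *^ a) != 0.
  by apply/eqP => /nm_eq0 h; move: pos0; rewrite h rdot0r ltxx.
have Eab : E (rdot a (b - r *^ a) / nm (b - r *^ a) ^+ 2) by exists (a, b).
have Eub : ubound E C.
  move=> _ [[x y] [/= h hn ->]]; rewrite ler_pdivrMr ?nz //.
  apply: le_trans (rdot_le _ _) _; rewrite expr2 mulrA ler_wpM2r ?nm_ge0 //; exact: hC.
have Esup : has_sup E by split; [exists (rdot a (b - r *^ a) / nm (b - r *^ a) ^+ 2) | exists C].
have [mu mu0 [mu_ge mu_near]] : exists2 mu : R, 0 < mu &
    (forall x y, T (x, y) -> rdot x (y - r *^ x) <= mu * nm (y - r *^ x) ^+ 2) /\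
    forall e : R, 0 < e -> exists p, [/\ T p, nm (p.2 - r *^ p.1) != 0 &
      (mu - e) * nm (p.2 - r *^ p.1) ^+ 2 < rdot p.1 (p.2 - r *^ p.1)].
  exists (sup E).
    apply: lt_le_trans (ub_le_sup _ Eab); last by exists C.
    by rewrite divr_gt0 // nz.
  split=> [x y h|e e0].
    have [h0|h0] := eqVneq (nm (y - r *^ x)) 0.
      by rewrite (nm_eq0 h0) rdot0r nm0 expr2 mulr0 mulr0.
    by rewrite -ler_pdivrMr ?nz //; apply: ub_le_sup; [exists C | exists (x, y)].
  have [_ [p [hp pn ->]] lt1] := sup_adherent e0 Esup.
  by exists p; split => //; rewrite -ltr_pdivlMr ?nz.
have Mq : M < r + mu^-1 by apply: lt_trans Mr _; rewrite ltrDl invr_gt0.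
have [_ [C1 hC1]] := res Mq.
pose c := mu + C.
have c0 : 0 < c by rewrite addr_gt0.
(* Cauchy-Schwarz for the nonnegative form of [mu - B]: with [z = (mu - B) w], [|z|^2 <= c <z, w>].
   It follows from nonnegativity at [w - z / c], because [c] bounds the norm of [mu - B]. *)
have zbound x y : T (x, y) -> nm (mu *^ (y - r *^ x) - x) ^+ 2 <=
    c * (mu * nm (y - r *^ x) ^+ 2 - rdot x (y - r *^ x)).
  move=> h; set w := y - r *^ x; set z := mu *^ w - x.
  have [x' h'] := solve z.
  have := mu_ge _ _ (TB h (@TZ (c^-1)%:C _ _ h')).
  have -> : y - c^-1 *^ (z + r *^ x') - r *^ (x - c^-1 *^ x') = w - c^-1 *^ z by rewrite /w; hring.
  have xz : rdot x' w = rdot x z.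
    have := T_sym h h'; have -> : y = w + r *^ x by rewrite /w subrK.
    rewrite rdotDl rdotDr rdotZl rdotZr (rdotC x'); lra.
  have S : rdot x' z >= - (C * nm z ^+ 2).
    have := rdot_abs x' z; rewrite ler_norml => /andP[+ _]; apply: le_trans.
    have := hC _ _ h'; rewrite addrK => /(ler_wpM2r (nm_ge0 z)); rewrite expr2; lra.
  set k := c^-1; have k0 : 0 < k by rewrite invr_gt0.
  have kc : k * c = 1 by rewrite mulVf // gt_eqF.
  have Z : rdot z z = mu * rdot w z - rdot x z by rewrite {1}/z rdotBl rdotZl.
  have Z0 := rdot_ge0 z; move: S Z Z0; rewrite -!rdotxx.
  clearbody z w k; rewrite !(rdotBl, rdotBr, rdotZl, rdotZr) (rdotC z w) xz => S Z Z0.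
  set zz := rdot z z in S Z Z0 *; set ww := rdot w w; set xw := rdot x w.
  set xz' := rdot x z in Z *; set wz := rdot w z in Z *; set xz'' := rdot x' z in S *.
  move=> h1.
  have h2 : k * zz <= mu * ww - xw.
    have : k * k * (mu * zz - xz'') <= k * k * (c * zz).
      by apply: ler_wpM2l; [apply: mulr_ge0; exact: ltW | rewrite /c; lra].
    have -> : k * k * (c * zz) = k * zz * (k * c) by ring.
    by rewrite kc; move: h1; rewrite Z; lra.
  by rewrite -(ler_pM2l k0) mulrA kc mul1r.
(* With [N = C1 / mu], this choice excludes [(mu - e)^2 < N^2 c e], which a vector nearly attaining
   the supremum would satisfy. *)
have [e [e0 _ he]] : exists e : R, [/\ 0 < e, e <= 1 &
    e * ((C1 / mu) ^+ 2 * c + 2 * mu) <= mu ^+ 2 / 2].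
  by apply: small_scale; [rewrite divr_gt0 // exprn_gt0 |
     rewrite ltr_wpDl ?mulr_gt0 // mulr_ge0 ?sqr_ge0 // ltW].
have [[x y] [/= h hn near]] := mu_near _ e0.
have := zbound _ _ h; have := hC1 _ _ h; rewrite !normE -rmorphM lecR.
set w := y - r *^ x in hn near *.
(* The shift by [mu^-1] turns [T - (r + mu^-1)] into [mu^-1 (mu - B)] applied to [w], so the
   resolvent bound at that point bounds [mu - B] from below. *)
have -> : y - (r + mu^-1) *^ x = mu^-1 *^ (mu *^ w - x).
  by apply: rdot_ext => u; rewrite /w !(rdotDl, rdotNl, rdotZl); field; rewrite gt_eqF.
set z := mu *^ w - x; clearbody z w.
rewrite nmZ gtr0_norm ?invr_gt0 // mulrA; move: he; move: (C1 / mu) => N he hN hz.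
have n0' : 0 < nm w by rewrite lt_def hn nm_ge0.
have h1 : (mu - e) * nm w < nm x.
  by rewrite -(ltr_pM2r n0') -mulrA -expr2; apply: lt_le_trans near (rdot_le _ _).
have emu : e <= mu.
  have c1 : 0 <= e * (N ^+ 2 * c) by apply: mulr_ge0; [exact: ltW | apply: mulr_ge0; [exact: sqr_ge0 | exact: ltW]].
  have : e * mu <= mu * mu by rewrite -expr2; have := sqr_ge0 mu; lra.
  by rewrite ler_pM2r.
have h2 : ((mu - e) * nm w) ^+ 2 < N ^+ 2 * (c * (e * nm w ^+ 2)).
  apply: (@lt_le_trans _ _ (nm x ^+ 2)).
    by rewrite ltr_pXn2r // nnegrE ?nm_ge0 // mulr_ge0 ?nm_ge0 // subr_ge0.
  apply: (@le_trans _ _ ((N * nm z) ^+ 2)).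
    by rewrite ler_pXn2r // nnegrE ?nm_ge0 //; apply: le_trans (nm_ge0 x) hN.
  rewrite exprMn ler_wpM2l ?sqr_ge0 //; apply: le_trans hz _.
  by rewrite ler_wpM2l ?ltW //; lra.
have p2 : 0 < nm w ^+ 2 by rewrite exprn_gt0.
have {}h2 : (mu - e) ^+ 2 < N ^+ 2 * (c * e).
  rewrite -(ltr_pM2r p2) -exprMn; apply: lt_le_trans h2 _.
  by rewrite !mulrA.
move: h2; rewrite sqrrB; have := sqr_ge0 e; have : 0 < mu ^+ 2 by rewrite exprn_gt0.
lra.
Qed.

End Resolvent.

(** At [q = M + e] the resolvent form is nonpositive, which reads [<i tau v, v> <= q |v|^2]; [e]
    then tends to 0. *)
Lemma numeric_le_sup (M : R) :
  (ereal_sup [set r%:E | r in [set r : R | spectrum T r%:C]] <= M%:E)%E ->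
  forall v, D v -> rdot (im *: tau v) v <= M * nm v ^+ 2.
Proof.
move=> hs v Dv.
have res (q : R) : M < q -> resolvent_set T q%:C.
  move=> Mq; apply: contrapT => h.
  have /ereal_sup_ubound : [set r%:E | r in [set r : R | spectrum T r%:C]] q%:E by exists q.
  by move=> /le_trans/(_ hs); rewrite lee_fin leNgt Mq.
have [v0|v0] := eqVneq (nm v) 0; first by rewrite (nm_eq0 v0) rdot0r nm0 expr2 !mulr0.
have pv : 0 < nm v ^+ 2 by rewrite exprn_gt0 // lt_def v0 nm_ge0.
rewrite -ler_pdivrMr //; suff h (e : R) : 0 < e -> rdot (im *: tau v) v / nm v ^+ 2 <= M + e.
  by apply/ler_addgt0Pr.
move=> e0; have Mq : M < M + e by rewrite ltrDl.
rewrite ler_pdivrMr //.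
by have := resolvent_numeric_le res Mq (core_T Dv); rewrite rdotBr rdotZr rdotxx rdotC subr_le0.
Qed.

End Spectral.

(** * Essential self-adjointness of the generators *)

(** The derivative of [e^-t f] is [e^-t g], whence [|f 0| <= e^-T |f T| + T e]. The crude estimate
    [e^-T <= 1 / (1 + T)] is enough, since only the limit of large [T] matters. *)
Lemma exp_growth_bound (R : realType) (f g : R -> R) (T B e : R) : 0 <= T ->
  (forall t, 0 <= t <= T -> hasdR f t (f t + g t)) ->
  (forall t, 0 <= t <= T -> `|g t| <= e) -> `|f T| <= B -> `|f 0| <= B / (1 + T) + T * e.
Proof.
move=> T0 hf hg hB.
have B0 : 0 <= B by apply: le_trans hB.
have hd t : 0 <= t <= T -> is_derive t 1 (fun t => expR (- t) * f t) (expR (- t) * g t).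
  move=> /hf /hasdR_is_derive h.
  have he : is_derive t 1 (expR \o -%R) (expR (- t) * -1).
    exact: is_derive1_comp.
  have := is_deriveM he h; congr (is_derive _ _ _ _).
  by rewrite /= -![_ *: _]/(_ * _); ring.
have h : `|expR (- T) * f T - expR (- 0) * f 0| <= e * (T - 0).
  apply: (mvt_der T0 hd) => t ht; rewrite normrM (gtr0_norm (expR_gt0 _)).
  apply: le_trans (hg _ ht); rewrite ler_piMl // -expR0 ler_expR.
  by case/andP: ht => t0 _; lra.
have p1 : 0 < 1 + T by lra.
have h1 : `|expR (- T) * f T| <= B / (1 + T).
  rewrite normrM (gtr0_norm (expR_gt0 _)) mulrC; apply: ler_pM => //.
  by rewrite expRN lef_pV2 ?posrE ?expR_gt0 // expR_ge1Dx.
move: h; rewrite oppr0 addr0 expR0 mul1r distrC => h.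
have := ler_normD (f 0 - expR (- T) * f T) (expR (- T) * f T); rewrite subrK; lra.
Qed.

Section Generator.
Context (R : realType) (HA : hilbertType R) (A : operator HA) (gamma : R -> HA -> HA).
Hypothesis hA : standard_oscillator A gamma.
Local Notation V := (Csmooth A).
Local Notation VO := (osc_of (A := A) V).
Local Notation om := (omegaA A).
Local Notation P := (@oscP R HA A).
Local Notation Pc := (@cinfP R HA A).
Hypothesis D_dense : forall x k (e : R), V x -> 0 < e ->
  exists2 y, V y & Pc k (im *: A y - x) < e.

Let sa : selfadjoint A := osc_sa hA.
Let gc : @graded R (cinf A) V Pc := graded_cinf sa.
Let gO := graded_osc hA.

Lemma osc_ad_center t y s : V y -> osc_ad gamma (0, y, 0) (t, 0, s) =
  (t + s / 2 * nm (A y) ^+ 2, s *^ (im *: A y), s) :> osc A.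
Proof.
move=> Vy; rewrite /osc_ad /osc_lin /osc_inv /= oppr0 !(gam_0 hA) (om0l hA) // add0r mulr0 addr0.
have -> : om (- y) (s *: (im *: A y : cinf A)) = s * nm (A y) ^+ 2.
  rewrite -[s *: _]/(s *^ (im *: A y)) (omNl hA) // omZr omE imII rdotNr rdotxx; ring.
by rewrite mulrA [2^-1 * _]mulrC.
Qed.

(** For [i A y] close to [x / s], the vector [u = s i A y] is close to [x], and the central shift
    [s / 2 |A y|^2] equals [|u|^2 / (2 s)], which restores the subtracted [|x|^2 / (2 s)] in the
    limit. *)
Lemma osc_ad_approx (X : osc A) k (e : R) : VO X -> 0 < X.2 -> 0 < e -> exists2 y, V y &
  P k (osc_ad gamma (0, y, 0) (X.1.1 - (2 * X.2)^-1 * nm (X.1.2 : HA) ^+ 2, 0, X.2) - X) < e.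
Proof.
case: X => [[t x] s] /= Vx s0 e0.
set C := 1 + (2 * s)^-1 * (2 * nm x + 1).
have C0 : 0 < C.
  by rewrite /C ltr_wpDr // mulr_ge0 // ?invr_ge0 ?mulr_ge0 //; have := nm_ge0 x; lra.
have [d [d0 d1 dC]] := small_scale e0 C0.
have [y Vy hy] := D_dense k (CsmoothZ sa (s^-1)%:C Vx) (divr_gt0 d0 s0).
exists y => //; rewrite osc_ad_center // /oscP /sumP /= subrr normr0 addr0.
set u := s *^ (im *: A y).
have hu : Pc k (u - x) < d.
  have -> : u - x = s *: (im *: A y - s^-1 *^ x : cinf A) :> cinf A.
    by apply: rdot_ext => w; rewrite /u !(rdotBl, rdotZl); field; rewrite gt_eqF.
  have Vd : V (im *: A y - s^-1 *^ x).
    by apply: (CsmoothB sa); [apply: (CsmoothZ sa); apply: Csmooth_app | apply: CsmoothZ].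
  by rewrite (grZ gc) // gtr0_norm // mulrC -ltr_pdivlMr.
have -> : t - (2 * s)^-1 * nm x ^+ 2 + s / 2 * nm (A y) ^+ 2 - t =
    (2 * s)^-1 * (nm u ^+ 2 - nm x ^+ 2).
  by rewrite /u nmZ nm_i gtr0_norm //; field; rewrite gt_eqF.
have q : nm (u - x) < d by apply: le_lt_trans hu; exact: (@cinfP_ge _ _ _ k (u - x) 0).
have n1 := nm_tri u x; have n2 := nm_tri x u; rewrite nmBC in n2.
have nx := nm_ge0 x; have nu := nm_ge0 u.
have k1 : `|nm u ^+ 2 - nm x ^+ 2| <= d * (2 * nm x + 1).
  by rewrite subr_sqr normrM; apply: ler_pM => //; rewrite ler_norml; apply/andP; split; lra.
rewrite normrM gtr0_norm ?invr_gt0 ?mulr_gt0 //.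
have k2 : (2 * s)^-1 * `|nm u ^+ 2 - nm x ^+ 2| <= (2 * s)^-1 * (d * (2 * nm x + 1)).
  by rewrite ler_wpM2l // invr_ge0 mulr_ge0 // ltW.
move: dC; rewrite /C; lra.
Qed.

Lemma osc_ad_horizontal c a x : VO c -> V x -> osc_ad gamma c (a, x, 0) =
  (a + om x c.1.2, gamma (- c.2) x : cinf A, 0) :> osc A.
Proof.
case: c => [[b y] r] /= Vy Vx; rewrite /osc_ad /osc_lin /osc_inv /=.
have -> : (x : cinf A) + 0 *: (im *: A y : cinf A) = x by rewrite scale0r addr0.
have -> : om (- gamma (- r) y) (gamma (- r) x) = om x y.
  rewrite (omNl hA); last exact: (gam_V hA).
  by rewrite (om_gam hA) // (omC hA Vy Vx) opprK.
by congr (_, _, _); rewrite -addrA -mulrDl -mulr2n; lra.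
Qed.

(** The central shift [om x y] is bounded by [|A x| |y|]: one more power of [A] is spent on [Y], but
    only the Hilbert norm of the group element enters, the one norm that [dvec_deficiency] can
    control. *)
Lemma osc_ad_horizontal_le c (Y : osc A) k : VO c -> VO Y -> Y.2 = 0 ->
  P k (osc_ad gamma c Y) <= P k.+1 Y * (1 + nm (c.1.2 : HA)).
Proof.
case: Y => [[a x] r] /= Vc Vx -> /=; rewrite osc_ad_horizontal // /oscP /sumP /= normr0 !addr0.
rewrite (cinfP_gam hA) //.
have h1 := om_abs A x c.1.2; have h2 := @cinfP_ge _ _ A k.+1 x 1 isT.
have h3 := gr_mono gc x (leqnSn k); have h4 := ler_normD a (om x c.1.2).
have := ler_wpM2r (nm_ge0 (c.1.2 : HA)) h2; have := mulr_ge0 (normr_ge0 a) (nm_ge0 (c.1.2 : HA)).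
by rewrite /= in h2 *; lra.
Qed.

Section Rep.
Context (K : hilbertType R) (pi : osc A -> K -> K).
Hypothesis hpi : smooth_rep gamma V pi.
Let urep := hpi.1.
Local Notation smv := (smooth_vectors V pi).
Local Notation dv := (dvec (A := A) pi).
Implicit Types (v w : K) (X Y Z : osc A) (t s : R).

Let vg : forall t x, V x -> V (gamma t x) := fun t x h => gam_V hA t h.
Let VZ t Z : VO Z -> VO (t *: Z) := sublinZ (grV gO) t (x := Z).

Lemma smv0 : smv 0.
Proof.
have [v sv _] := dense_nm hpi.2 0 ltr01.
by have := smvL hA hpi (-1) sv sv; rewrite scaleN1r addNr.
Qed.

(** [osc_exp] enters only through its derivative at 0; this brings [i_dpi] into the form to which
    the abstract spectral lemmas apply. *)
Lemma i_dpi_core X : VO X -> i_dpi gamma V pi X = core smv (fun v => dv v X).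
Proof.
move=> VX; have hd v : smv v -> hasd (fun t : R => pi (osc_exp gamma (t *: X)) v) 0 (dv v X).
  move=> sv; apply: (dvec_chain hA sv) => //; first by move=> t; exact: osc_exp_V.
    exact: osc_exp0.
  exact: osc_exp_tangent.
apply/seteqP; split => [[v w] [[v' w'] [/= sv /real_deriv0P h] [<- <-]] | [v w] [/= sv ->]].
  by split => //=; congr (_ *: _); apply: hasd_unique h (hd _ sv).
by exists (v, dv v X) => //; split => //=; apply/real_deriv0P; exact: hd.
Qed.

(* A one-parameter group when [Z] is in the plane [R x 0 x R], where [t |-> t *: Z]
   is the exponential map. *)
Definition flow (g Z : osc A) t v := pi (osc_inv gamma g) (pi (t *: Z) (pi g v)).

Section Flow.
Variables (g Z : osc A).
Hypotheses (Vg : VO g) (Z0 : (Z.1.2 : HA) = 0).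

Let VtZ t : VO (t *: Z).
Proof. by apply: VZ; rewrite /osc_of /= Z0; apply: Csmooth0. Qed.
Let Vg' : VO (osc_inv gamma g) := osc_inv_V hA Vg.

Lemma flow_smv t v : smv v -> smv (flow g Z t v).
Proof. by move=> sv; do !apply: (smooth_translate hA hpi). Qed.

Lemma flow_nm t v : nm (flow g Z t v) = nm v.
Proof. by rewrite /flow !(rep_nm urep). Qed.

Lemma flow_0 v : flow g Z 0 v = v.
Proof.
by rewrite /flow scale0r (rep1 hA (V_real hA) urep) (repVK hA (V_real hA) (@subset_refl _ _) vg urep).
Qed.

Lemma flow_add t s v : flow g Z (t + s) v = flow g Z s (flow g Z t v).
Proof.
rewrite /flow (repKV hA (V_real hA) (@subset_refl _ _) vg urep) //; congr (pi _ _).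
have e : osc_mul gamma (s *: Z) (t *: Z) = (t + s) *: Z.
  rewrite osc_mulE addrC scalerDl; congr (_ + _).
  case: Z Z0 => [[z x] r] /= ->; rewrite /osc_lin /=.
  by rewrite !scaler0 (gam0r hA) om0r mulr0 addr0 -[RHS]/(t *: z, t *: (0 : cinf A), t *: r) scaler0.
by rewrite -e (rep_mul urep).
Qed.

Lemma flow_hasd t v : smv v -> hasd (fun t => flow g Z t v) t (dv (flow g Z t v) (osc_ad gamma g Z)).
Proof.
have h0 u : smv u -> hasd (fun t => flow g Z t u) 0 (dv u (osc_ad gamma g Z)).
  move=> su; have VZ0 : VO Z by rewrite /osc_of /= Z0; apply: Csmooth0.
  have h := dvec_hasd hA (smooth_translate hA hpi su Vg) VZ0.
  move=> e e0; have [d d0 hd] := h e e0; exists d => // r /hd.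
  rewrite (dvec_translate hA hpi) // !add0r scale0r (rep1 hA (V_real hA) urep).
  set W := dv u _; set p := pi (r *: Z) _ => {}hd.
  have Vr : VO (r *: Z) by [].
  have -> : flow g Z r u - flow g Z 0 u - r *^ W =
      pi (osc_inv gamma g) (p - pi g u - r *^ pi g W).
    rewrite !(repB urep) // (repZ urep) // !(repVK hA (V_real hA) (@subset_refl _ _) vg urep) //.
    by rewrite flow_0.
  by rewrite (rep_nm urep).
move=> sv e e0; have [d d0 hd] := h0 _ (flow_smv t sv) e e0; exists d => // r /hd.
by rewrite add0r flow_0 flow_add.
Qed.

(** The flow is the action of [c = g^-1 (t Z) g]. Moving the derivative back to the fixed vector [v]
    lets continuity of [dvec v] at 0 serve for all [t] at once. *)
Lemma flow_dvec_nm t v X : smv v -> VO X -> nm (dv (flow g Z t v) X) =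
  nm (dv v (osc_ad gamma (osc_mul gamma (osc_inv gamma g) (osc_mul gamma (t *: Z) g)) X)).
Proof.
move=> sv VX; set c := osc_mul _ _ _.
have Vc : VO c by do 2?apply: osc_mul_V.
have -> : flow g Z t v = pi c v by rewrite /flow /c !(rep_mul urep) //; exact: (osc_mul_V hA).
by rewrite (dvec_translate hA hpi) // (rep_nm urep).
Qed.

End Flow.

(** For each horizon [T] the conjugated generator is [X + E], with [E] so small that its action
    along the whole trajectory has norm at most [e]. The coefficient [f] then satisfies [f' = f + g]
    with [|g| <= e |w|], while unitarity keeps it below [|v| |w|]. *)
Lemma dvec_deficiency (b : bool) X w : VO X -> 0 < X.2 ->
  (forall v, smv v -> rdot (dv v X) w = (-1) ^+ b * rdot v w) -> w = 0.
Proof.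
move=> VX s0 hw.
have bound v T e : smv v -> 0 < T -> 0 < e -> `|rdot v w| <= nm v * nm w / (1 + T) + T * (e * nm w).
  move=> sv T0 e0.
  have V0 : VO 0 := osc_0_V hA.
  have [k [d d0 hd]] := dvec_cont hA sv V0 e0.
  set x : HA := X.1.2; have nx := nm_ge0 x.
  have C0 : 0 < 1 + T * (nm x + 1) by have := mulr_gt0 T0 (_ : 0 < nm x + 1); lra.
  have [d' [d0' d1' hd']] := small_scale (divr_gt0 d0 (ltr0n R 2)) C0.
  have [y Vy hy] := osc_ad_approx k.+1 VX s0 d0'.
  set g : osc A := (0, y, 0) in hy; set Z : osc A := (_, 0, X.2) in hy.
  have Vg : VO g by []. have Z0 : (Z.1.2 : HA) = 0 by [].
  set E := osc_ad gamma g Z - X in hy.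
  have VgZ : VO (osc_ad gamma g Z) by apply: (osc_ad_V hA) => //; apply: Csmooth0.
  have VE : VO E by apply: (sublinB (grV gO)).
  have E2 : E.2 = 0 by rewrite /E /osc_ad /osc_lin /= subrr.
  have hc : osc_ad gamma g Z = (Z.1.1 + X.2 / 2 * nm (A y) ^+ 2, X.2 *^ (im *: A y), X.2).
    exact: osc_ad_center.
  (* This bound on [s |A y|] does not depend on the accuracy of the approximation. *)
  have x1 : X.2 * nm (A y) <= nm x + 1.
    have : nm (X.2 *^ (im *: A y) - x) <= P k.+1 E.
      rewrite /E hc /oscP /sumP /=.
      have := @cinfP_ge _ _ A k.+1 (X.2 *^ (im *: A y) - x) 0 isT.
      have := normr_ge0 (Z.1.1 + X.2 / 2 * nm (A y) ^+ 2 - X.1.1).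
      have := normr_ge0 (X.2 - X.2); rewrite /= -/x; lra.
    have := nm_tri (X.2 *^ (im *: A y)) x; rewrite nmZ nm_i gtr0_norm //; lra.
  (* The sign of the deficiency equation is absorbed by running the flow at time [q * t]. *)
  pose q : R := (-1) ^+ b.
  have qq : q * q = 1 by rewrite -expr2 /q sqrr_sign.
  have q1 : `|q| = 1 by rewrite normr_sign.
  have small t : 0 <= t <= T -> nm (dv (flow g Z (q * t) v) E) <= e.
    move=> /andP[t0 tT]; rewrite flow_dvec_nm //; set c := osc_mul _ _ _.
    have Vc : VO c.
      apply: (osc_mul_V hA); first exact: osc_inv_V.
      by apply: (osc_mul_V hA) => //; apply: VZ; apply: Csmooth0.
    (* The norm of [y] is not controlled, but its displacement under [gamma] is, by [|A y|] times
       the elapsed time. *)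
    have cx : nm (c.1.2 : HA) <= T * (nm x + 1).
      have -> : c.1.2 = gamma (q * t * X.2) y - y :> HA.
        rewrite /c /osc_mul /osc_inv /= oppr0 !(gam_0 hA) scaler0 add0r addrC.
        by rewrite -[q * t *: _]/(q * t * X.2).
      have := gam_mvt hA (w := 0) (M := nm (A y)) (s := q * t * X.2) (Csmooth_dom Vy).
      rewrite scaler0 subr0 => h; apply: le_trans (h _) _.
        by move=> r _; rewrite subr0 (gam_nm hA) nm_i.
      rewrite !normrM q1 mul1r (ger0_norm t0) (gtr0_norm s0) -mulrA.
      by apply: ler_pM => //; rewrite mulr_ge0 ?nm_ge0 // ltW.
    have := hd _ (osc_ad_V hA Vc VE); rewrite subr0.
    have -> : dv v 0 = 0.
      by have := dvecL hA (-1) sv V0 V0; rewrite scaler0 addr0 rmorphN scaleN1r subrr.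
    rewrite subr0 => h; apply/ltW/h; apply: le_lt_trans (osc_ad_horizontal_le k Vc VE E2) _.
    have c1 : 0 < 1 + nm (c.1.2 : HA) by have := nm_ge0 (c.1.2 : HA); lra.
    have := ler_wpM2r (ltW c1) (ltW hy).
    have := ler_wpM2l (ltW d0') (_ : 1 + nm (c.1.2 : HA) <= 1 + T * (nm x + 1)); lra.
  have := @exp_growth_bound R (fun t => rdot (flow g Z (q * t) v) w)
    (fun t => q * rdot (dv (flow g Z (q * t) v) E) w) T (nm v * nm w) (e * nm w) (ltW T0).
  rewrite mulr0 flow_0 //; apply.
  - move=> t ht.
    have h := hasd_rdot w (flow_hasd Vg Z0 (q * t) sv).
    set u := flow g Z (q * t) v in h *; have su : smv u by apply: flow_smv.
    have -> : rdot u w + q * rdot (dv u E) w = q * rdot (dv u (osc_ad gamma g Z)) w.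
      have -> : osc_ad gamma g Z = X + 1 *: E by rewrite scale1r /E addrC subrK.
      by rewrite (dvecL hA) // scale1r rdotDl hw // mulrDr mulrA qq mul1r.
    move=> e' e0'; have [r r0 hr] := h e' e0'; exists r => // r' hr'.
    have := hr (q * r'); rewrite normrM q1 mul1r => /(_ hr').
    by rewrite -/u mulrDr mulrA [q * r']mulrC.
  - move=> t /small ht; rewrite normrM q1 mul1r; apply: le_trans (rdot_abs _ _) _.
    by rewrite ler_wpM2r ?nm_ge0.
  - by apply: le_trans (rdot_abs _ _) _; rewrite flow_nm.
have orth v : smv v -> rdot v w = 0.
  move=> sv; apply/eqP; rewrite -normr_eq0 eq_le normr_ge0 andbT; apply/ler_addgt0Pr.
  suff h (e : R) : 0 < e -> `|rdot v w| <= 0 + e by exact: h.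
  move=> e0; pose C := nm v * nm w + nm w + 1.
  have vw : 0 <= nm v * nm w by rewrite mulr_ge0 ?nm_ge0.
  have C0 : 0 < C by rewrite /C; have := nm_ge0 w; lra.
  have T0 : 0 < C / e by rewrite divr_gt0.
  have T1 : 0 < 1 + C / e by lra.
  (* With [T = C / e] and accuracy [1 / (T (1 + T))], both terms get the denominator [1 + T], and
     their sum is below [C / T = e]. *)
  have := bound v (C / e) (C / e * (1 + C / e))^-1 sv T0; rewrite invr_gt0 mulr_gt0 // => /(_ isT).
  have CT : C / e * e = C by rewrite divfK // gt_eqF.
  rewrite add0r; move: (C / e) T0 T1 CT => T T0 T1 CT h; apply: le_trans h _.
  have -> : T * ((T * (1 + T))^-1 * nm w) = nm w / (1 + T) by field; rewrite !gt_eqF.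
  rewrite -mulrDl ler_pdivrMr //; move: CT; rewrite /C; lra.
apply: eq_nm => e e0; have [v sv hv] := dense_nm hpi.2 w e0; rewrite subr0.
have [//|nw] := leP (nm w) 0; first by move=> h; apply: le_lt_trans h e0.
apply: le_lt_trans hv; rewrite -(ler_pM2r nw) -expr2 -rdotxx.
by have := rdot_le (w - v) w; rewrite nmBC rdotBl (orth v) // subr0.
Qed.

End Rep.
End Generator.

(** * Part (b): semiboundedness *)

Lemma cone_cont (R : realType) (r t b s : R) : 0 < s -> 0 < t - (2 * s)^-1 * b ^+ 2 + r * s ->
  exists2 d : R, 0 < d & forall t' b' s', `|t' - t| < d -> `|b' - b| < d -> `|s' - s| < d ->
    0 < s' /\ 0 < t' - (2 * s')^-1 * b' ^+ 2 + r * s'.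
Proof.
move=> s0 h.
pose f (p : R * R * R) := p.1.1 - (2 * p.2)^-1 * p.1.2 ^+ 2 + r * p.2.
have c1 : p.1.1 @[p --> (t, b, s)] --> t by apply: (cvg_comp _ _ cvg_fst cvg_fst).
have c2 : p.1.2 @[p --> (t, b, s)] --> b by apply: (cvg_comp _ _ cvg_fst cvg_snd).
have c3 : p.2 @[p --> (t, b, s)] --> s by exact: cvg_snd.
have cf : f p @[p --> (t, b, s)] --> t - (2 * s)^-1 * b ^+ 2 + r * s.
  apply: cvgD; last by apply: cvgMr.
  apply: cvgB => //; apply: cvgM.
    by apply: cvgV; [rewrite mulf_neq0 // gt_eqF | apply: cvgMr].
  by apply: cvgM.
have h1 : nbhs (t, b, s) [set p : R * R * R | 0 < p.2] by exact: (cvgr_gt _ c3 _ s0).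
have h2 : nbhs (t, b, s) [set p | 0 < f p] by exact: (cvgr_gt _ cf _ h).
have [d /= d0 hd] := (nbhs_ballP _ _).1 (filterI h1 h2).
exists d => // t' b' s' ht hb hs; apply: (hd (t', b', s')).
by do 2?split; rewrite /= /ball /= distrC.
Qed.

Section Numeric.
Context (R : realType) (HA : hilbertType R) (A : operator HA) (gamma : R -> HA -> HA).
Hypothesis hA : standard_oscillator A gamma.
Local Notation V := (Csmooth A).
Local Notation VO := (osc_of (A := A) V).
Local Notation P := (@oscP R HA A).
Local Notation Pc := (@cinfP R HA A).
Hypothesis D_dense : forall x k (e : R), V x -> 0 < e ->
  exists2 y, V y & Pc k (im *: A y - x) < e.
Context (K : hilbertType R) (pi : osc A -> K -> K).
Hypothesis hpi : smooth_rep gamma V pi.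
Local Notation smv := (smooth_vectors V pi).
Local Notation dv := (dvec (A := A) pi).
Implicit Types (v w : K) (X Y Z : osc A) (M N : R).

Let urep := hpi.1.
Let sa : selfadjoint A := osc_sa hA.
Let gO := graded_osc hA.

(** Linear in [X], closed under limits and invariant under the adjoint action, none of which is
    visible on [s_pi]; [s_pi_numeric] and [numeric_s_pi] translate between the two. *)
Definition numeric_le X M := forall v, smv v -> rdot (im *: dv v X) v <= M * nm v ^+ 2.

Lemma s_pi_numeric X M : VO X -> (s_pi gamma V pi X <= M%:E)%E -> numeric_le X M.
Proof.
move=> VX; rewrite /s_pi (i_dpi_core hA D_dense pi VX) => h v.
apply: (numeric_le_sup (smv0 hA hpi) (smvL hA hpi) _ _ h).
  by move=> c u w su sw; apply: (dvec_lin hA hpi).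
by move=> u w su sw; apply: (dvec_skew hA hpi).
Qed.

Lemma numeric_s_pi X M : VO X -> 0 < X.2 -> numeric_le X M -> (s_pi gamma V pi X <= M%:E)%E.
Proof.
move=> VX s0 h; rewrite /s_pi (i_dpi_core hA D_dense pi VX).
apply: (spectrum_sup_le (smv0 hA hpi) (smvL hA hpi)) h.
- by move=> c u w su sw; apply: (dvec_lin hA hpi).
- by move=> u w su sw; apply: (dvec_skew hA hpi).
- by move=> b w; apply: (dvec_deficiency hA D_dense hpi VX s0).
Qed.

Lemma numeric_ad g X M : VO g -> VO X -> numeric_le X M -> numeric_le (osc_ad gamma g X) M.
Proof.
move=> Vg VX h v sv; have := h _ (smooth_translate hA hpi sv Vg).
rewrite (dvec_translate hA hpi) // -(repZ urep) // (rep_nm urep) //.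
by rewrite /rdot; case: urep => /(_ g Vg) [_ -> _] _.
Qed.

Lemma numeric_lim X M : VO X ->
  (forall k (e : R), 0 < e -> exists Y, [/\ VO Y, P k (Y - X) < e & numeric_le Y M]) ->
  numeric_le X M.
Proof.
move=> VX h v sv.
suff hh (e : R) : 0 < e -> rdot (im *: dv v X) v <= M * nm v ^+ 2 + e.
  by apply/ler_addgt0Pr.
move=> e0; have c0 : 0 < nm v + 1 by have := nm_ge0 v; lra.
have [k [d d0 hd]] := dvec_cont hA sv VX (divr_gt0 e0 c0).
have [Y [VY hY /(_ v sv) hM]] := h k d d0.
have := hd Y VY hY; rewrite ltr_pdivlMr // => h1.
have := rdot_abs (im *: (dv v Y - dv v X)) v; rewrite ler_norml nm_i => /andP[h2 _].
move: h2; rewrite scalerBr rdotBl; have := nm_ge0 (dv v Y - dv v X).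
lra.
Qed.

Lemma numeric_comb (a b : R) X Y M N : 0 <= a -> 0 <= b -> VO X -> VO Y ->
  numeric_le X M -> numeric_le Y N -> numeric_le (a *: X + b *: Y) (a * M + b * N).
Proof.
move=> a0 b0 VX VY hX hY v sv; have V0 := osc_0_V hA.
have d0 : dv v 0 = 0.
  by have := dvecL hA (-1) sv V0 V0; rewrite scaler0 addr0 rmorphN scaleN1r subrr.
have VaX : VO (a *: X) by apply: (sublinZ (grV gO)).
rewrite (dvecL hA) // -[a *: X]add0r (dvecL hA) // d0 add0r.
rewrite scalerDr !scaleCA rdotDl !rdotZl mulrDl -!mulrA.
have hx := ler_wpM2l a0 (hX v sv); have hy := ler_wpM2l b0 (hY v sv).
exact: lerD hx hy.
Qed.

(* The hypothesis concerns a single element of the plane [x = 0], whose adjoint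
   orbit accumulates at [X]. *)
Lemma numeric_center X M : VO X -> 0 < X.2 ->
  numeric_le (X.1.1 - (2 * X.2)^-1 * nm (X.1.2 : HA) ^+ 2, 0, X.2) M -> numeric_le X M.
Proof.
move=> VX s0 h; apply: numeric_lim => // k e e0.
have [y Vy hy] := osc_ad_approx hA D_dense k VX s0 e0.
have V0 : V 0 := Csmooth0 sa.
by eexists; split; [|exact: hy|]; [apply: (osc_ad_V hA) | apply: numeric_ad].
Qed.

End Numeric.

(** * The cones and their openness *)

Section Cone.
Context (R : realType) (HA : hilbertType R) (A : operator HA) (gamma : R -> HA -> HA).
Hypothesis hA : standard_oscillator A gamma.
Local Notation V := (Csmooth A).
Local Notation VO := (osc_of (A := A) V).
Local Notation P := (@oscP R HA A).
Implicit Types (X Y : osc A).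

Lemma W_pos d X : W d X -> VO X /\ 0 < X.2.
Proof. by case: X => [[t x] s] []. Qed.

Lemma W_center d X : W d X -> W d ((X.1.1 - (2 * X.2)^-1 * nm (X.1.2 : HA) ^+ 2, 0, X.2) : osc A).
Proof.
case: X => [[t x] s] [Vx s0 h] /=; split => //; first exact: (Csmooth0 (osc_sa hA)).
by case: d h => //= r; rewrite !normE -!rmorphXn /= nm0 expr0n mulr0 subr0.
Qed.

Lemma W_near d X : d != -oo%E -> W d X -> exists2 e : R, 0 < e &
  forall Y, VO Y -> P 0 (Y - X) < e -> W d Y.
Proof.
case: d => // [r|] _; case: X => [[t x] s] [Vx s0 h].
  rewrite normE -rmorphXn /= in h.
  have [e e0 he] := cone_cont s0 h.
  exists e => // -[[t' x'] s'] Vx'; rewrite /oscP /sumP /= => hP.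
  have n1 := @cinfP_ge _ _ A 0 (x' - x) 0 isT; rewrite /= in n1.
  have n2 := normr_ge0 (t' - t : R); have n3 := normr_ge0 (s' - s : R); have n4 := nm_ge0 (x' - x : HA).
  have [|||s0' h'] := he t' (nm x') s'; try lra.
    rewrite ltr_norml; have := nm_tri x' x; have := nm_tri x x'; rewrite (nmBC x); lra.
  by split => //=; rewrite normE -rmorphXn.
(* For [d = +oo] only positivity of the last component has to persist. *)
exists s => // -[[t' x'] s'] Vx'; rewrite /oscP /sumP /= => hP; split => //.
have := @cinfP_ge _ _ A 0 (x' - x) 0 isT; have := nm_ge0 (x' - x : HA).
have := normr_ge0 (t' - t : R); have := ler_norm (s - s' : R); rewrite distrC /=; lra.
Qed.

End Cone.

Section Semibounded.
Context (R : realType) (HA : hilbertType R) (A : operator HA) (gamma : R -> HA -> HA).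
Hypothesis hA : standard_oscillator A gamma.
Local Notation V := (Csmooth A).
Local Notation VO := (osc_of (A := A) V).
Local Notation P := (@oscP R HA A).
Local Notation Pc := (@cinfP R HA A).
Hypothesis D_dense : forall x k (e : R), V x -> 0 < e ->
  exists2 y, V y & Pc k (im *: A y - x) < e.
Context (K : hilbertType R) (pi : osc A -> K -> K).
Hypothesis hpi : smooth_rep gamma V pi.
Local Notation smv := (smooth_vectors V pi).
Local Notation dv := (dvec (A := A) pi).
Variable d : \bar R.
Hypothesis d_neq : d != -oo%E.
Hypothesis W_numeric : forall X, W d X -> exists M, numeric_le pi X M.
Implicit Types (v w : K) (X Y Z : osc A) (M N : R).

Let gO := graded_osc hA.
Let V0 : V 0 := Csmooth0 (osc_sa hA).

(** The cone is itself open in the Lie algebra, so a finite bound at each of its points suffices. *)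
Lemma W_BI_interior : W d `<=` BI_interior gamma V pi.
Proof.
move=> X WX; have [VX s0] := W_pos WX; split => //.
have [e e0 he] := W_near d_neq WX.
apply/(gr_nbhs gO _ VX); exists 0, e => // Y VY /(he Y VY) WY; split => //.
have [M hM] := W_numeric WY; have [_ sY] := W_pos WY.
by apply: le_lt_trans (numeric_s_pi hA D_dense hpi VY sY hM) (ltry M).
Qed.

Lemma s_pi_ge X M v : VO X -> smv v -> M * nm v ^+ 2 < rdot (im *: dv v X) v ->
  (M%:E <= s_pi gamma V pi X)%E.
Proof.
move=> VX sv h; rewrite leNgt; apply/negP => /ltW /(s_pi_numeric hA D_dense hpi VX) /(_ v sv).
by rewrite leNgt h.
Qed.

Lemma numeric_le_mono X M N : M <= N -> numeric_le pi X M -> numeric_le pi X N.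
Proof. by move=> MN h v /h /le_trans; apply; rewrite ler_wpM2r // sqr_ge0. Qed.

(** Nonnegative combinations of these two elements fill a neighbourhood of their midpoint inside the
    plane [x = 0]. *)
Lemma W_axis : exists t : R, W d ((t, 0, 1) : osc A) /\ W d ((t + 2, 0, 1) : osc A).
Proof.
case: d d_neq => // [r|] _.
  by exists (1 - r); split; split => //=; rewrite normr0 expr0n /= mulr0 subr0 ?mulr1; lra.
by exists 0.
Qed.

(** Pointwise bounds on the cone give no local uniformity by themselves. The upper bound is made
    uniform by writing the centre of each nearby element as a combination of two fixed ones; the
    lower bound comes from the numerical value at one smooth vector. *)
Lemma W_semibounded : (exists v : K, v != 0) -> semibounded gamma V pi.
Proof.
move=> [u u0]; split => //.
have [v sv hv] : exists2 v, smv v & 0 < nm v.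
  have nu : 0 < nm u.
    by rewrite lt_def nm_ge0 andbT; apply: contraNN u0 => /eqP /nm_eq0 ->.
  have [v sv hv] := dense_nm hpi.2 u nu; exists v => //.
  have := nm_tri u v; rewrite nmBC; lra.
have [t1 [/W_numeric [M1 h1] /W_numeric [M2 h2]]] := W_axis.
have VX (t s : R) : VO (t, 0, s) by exact: V0.
pose X0 : osc A := (t1 + 1, 0, 1).
have [k [e e0 he]] := dvec_cont hA sv (VX (t1 + 1) 1) hv.
(* The perturbation of the derivative costs at most 1 in the quotient; subtracting 2 leaves a strict
   inequality. *)
pose m : R := rdot (im *: dv v X0) v / nm v ^+ 2 - 2.
have lower Y : VO Y -> P k (Y - X0) < e -> (m%:E <= s_pi gamma V pi Y)%E.
  move=> VY /(he Y VY) hY; apply: (s_pi_ge VY sv).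
  have := rdot_abs (im *: (dv v Y - dv v X0)) v; rewrite ler_norml nm_i => /andP[k1 _].
  have k2 := ler_wpM2r (ltW hv) (ltW hY).
  have p2 : 0 < nm v ^+ 2 by rewrite exprn_gt0.
  rewrite /m mulrBl divfK ?gt_eqF //; move: k1; rewrite scalerBr rdotBl.
  move: p2 k2; rewrite !expr2 -/X0; lra.
pose M := `|M1| + `|M2|.
have c0 : 0 < 2 * (`|t1| + 1) by have := normr_ge0 t1; lra.
(* Makes both [e2] and [|t1| e2] at most [1/8], which keeps the coefficients [a] and [b] below in
   the unit interval. *)
have [e2 [e20 e21 he2]] := small_scale (divr_gt0 (@ltr01 R) (ltr0n R 4)) c0.
have upper Y : VO Y -> P 0 (Y - X0) < e2 -> (s_pi gamma V pi Y <= M%:E)%E.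
  case: Y => [[t x] s] VY; rewrite /oscP /sumP /= => hY.
  have a1 := normr_ge0 (t - (t1 + 1) : R); have a2 := normr_ge0 (s - 1 : R).
  have a3 := @cinfP_ge _ _ A 0 (x - 0) 0 isT; rewrite /= [_ - 0]subr0 in a3 hY.
  have a4 := nm_ge0 (x : HA); have a5 := normr_ge0 t1.
  have e8 : e2 <= 8^-1 by have := mulr_ge0 (ltW e20) a5; lra.
  have := ler_norm (s - 1 : R); have := ler_norm (1 - s : R); rewrite distrC => s1 s2.
  have s0 : 0 < s by lra.
  set q := (2 * s)^-1 * nm (x : HA) ^+ 2.
  have q0 : 0 <= q by rewrite mulr_ge0 ?sqr_ge0 // invr_ge0; lra.
  have q1 : q <= 8^-1.
    have : nm (x : HA) ^+ 2 <= 8^-1 ^+ 2 by rewrite !expr2; apply: ler_pM => //; lra.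
    rewrite /q mulrC ler_pdivrMr; lra.
  have [t2 t3] : `|t1 * (s - 1)| <= 8^-1 /\ `|t - (t1 + 1)| <= 8^-1.
    split; last by lra.
    by rewrite normrM; have := ler_wpM2l a5 (_ : `|s - 1 : R| <= e2); lra.
  rewrite !ler_norml in t2 t3; case/andP: t2 => t2 t2'; case/andP: t3 => t3 t3'.
  (* The solution of [a (t1, 0, 1) + b (t1 + 2, 0, 1) = (t - q, 0, s)], where [t - q] is the central
     part of the centre of [Y]. *)
  pose b : R := (t - q - t1 * s) / 2; pose a : R := s - b.
  have b0 : 0 <= b by rewrite /b; lra.
  have b1 : b <= 1 by rewrite /b; lra.
  have a0 : 0 <= a by rewrite /a /b; lra.
  have a1' : a <= 1 by rewrite /a /b; lra.
  apply: (numeric_s_pi hA D_dense hpi) => //; apply: (numeric_center hA D_dense hpi) => //=.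
  have le_M : a * M1 + b * M2 <= M.
    have c (z y : R) : 0 <= z -> z <= 1 -> z * y <= `|y|.
      by move=> z0 z1; apply: le_trans (ler_wpM2l z0 (ler_norm y)) _; rewrite ler_piMl.
    exact: lerD (c _ _ a0 a1') (c _ _ b0 b1).
  apply: (numeric_le_mono le_M); have := numeric_comb hA a0 b0 (VX _ _) (VX _ _) h1 h2.
  congr (numeric_le _ _ _); rewrite -/q.
  rewrite -[LHS]/(a * t1 + b * (t1 + 2), a *: (0 : cinf A) + b *: (0 : cinf A), a * 1 + b * 1).
  by rewrite !scaler0 addr0; congr (_, _, _); rewrite /a /b; field.
pose Q Y := (`|s_pi gamma V pi Y| <= (`|m| + `|M|)%:E)%E.
(* The estimates hold on [VO] only, whereas the witness must be open in the whole ambient space;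
   hence the interior of an implication. *)
exists (interior [set Y | VO Y -> Q Y]), (`|m| + `|M|); split; first exact: open_interior.
  exists X0; split; last exact: VX.
  apply/(gr_nbhs gO _ (VX _ _)); exists k, (Num.min e e2); first by rewrite lt_min e0.
  move=> Y VY; rewrite lt_min => /andP[y1 y2].
  have l := lower Y VY y1.
  have := upper Y VY (le_lt_trans (gr_mono gO _ (leq0n k)) y2); move: l; rewrite /Q.
  case: (s_pi _ _ _ _) => //= r; rewrite !lee_fin => l1 l2.
  have := ler_norm M; have := ler_norm (- m); rewrite normrN => l3 l4.
  by rewrite ler_norml; have := normr_ge0 m; have := normr_ge0 M; lra.
by move=> X /interior_subset.
Qed.

End Semibounded.

Lemma D_range_dense (R : realType) (HA : hilbertType R) (A : operator HA) (gamma : R -> HA -> HA)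
  (L : set HA) : standard_oscillator A gamma -> L `<=` Csmooth A ->
  cinf_dense (A := A) L (Csmooth A) -> (forall x, L x -> L (im *: A x)) ->
  cinf_dense (A := A) [set im *: A x | x in L] L ->
  forall x k (e : R), Csmooth A x -> 0 < e ->
    exists2 y, L y & cinfP k (im *: A y - x : cinf A) < e.
Proof.
move=> hA LV Ld LD Dd x k e Vx e0; have e2 : 0 < e / 2 by rewrite divr_gt0.
have gc := graded_cinf (osc_sa hA).
have [l Ll hl] := cinf_dense_approx hA k (@subset_refl _ _) LV Ld Vx e2.
have MV : [set im *: A x | x in L] `<=` Csmooth A by move=> _ [y Ly <-]; apply/LV/LD.
have [_ [y Ly <-] hy] := cinf_dense_approx hA k LV MV Dd Ll e2.
exists y => //; rewrite [ltRHS]splitr.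
have Vy : Csmooth A (im *: A y) by apply/MV; exists y.
exact: le_lt_trans (grB_tri gc k Vy Vx (LV _ Ll)) (ltrD hy hl).
Qed.

(** The smooth vectors agree and exp keeps [R x L x R] inside the subgroup, where both
    representations coincide. The graphs are therefore equal, and with them the spectra. *)
Lemma i_dpi_ext (R : realType) (HA : hilbertType R) (A : operator HA) (gamma : R -> HA -> HA)
  (L : set HA) (K : hilbertType R) (piL pi : osc A -> K -> K) (X : osc A) :
  real_subspace L -> (forall X, osc_of (A := A) L X -> osc_of (A := A) L (osc_exp gamma X)) ->
  smooth_vectors (Csmooth A) pi = smooth_vectors L piL ->
  (forall g, osc_of (A := A) L g -> pi g = piL g) -> osc_of (A := A) L X ->
  i_dpi gamma L piL X = i_dpi gamma (Csmooth A) pi X.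
Proof.
move=> L_sub L_exp sv hext LX; rewrite /i_dpi; congr image.
rewrite /dpi sv; congr mkset; apply/funext => p; congr (_ /\ real_deriv0 _ _).
apply/funext => t; rewrite hext //; apply: L_exp.
exact: (sublinZ (sublin_osc A L_sub)).
Qed.

Theorem corollary4p15 (R : realType)
  (HA : hilbertType R) (A : operator HA) (gamma : R -> HA -> HA)
  (hA : standard_oscillator A gamma)
  (L : set HA) (L_sub : real_subspace L) (L_smooth : L `<=` Csmooth A)
  (L_dense : cinf_dense (A := A) L (Csmooth A))
  (L_D : forall x, L x -> L ((0 +i* 1) *: A x))
  (L_gamma : forall t x, L x -> L (gamma t x))
  (L_exp : forall X, osc_of (A := A) L X -> osc_of (A := A) L (osc_exp gamma X))
  (K : hilbertType R) (piL : osc A -> K -> K)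
  (hpiL : smooth_rep gamma L piL) :
  exists pi : osc A -> K -> K,
    [/\ smooth_rep gamma (Csmooth A) pi,
        forall g, osc_of L g -> pi g = piL g,
        forall pi' : osc A -> K -> K,
          smooth_rep gamma (Csmooth A) pi' ->
          (forall g, osc_of L g -> pi' g = piL g) ->
          forall g, osc_of (Csmooth A) g -> pi' g = pi g
      & (exists v : K, v != 0) ->
        cinf_dense (A := A) [set (0 +i* 1) *: A x | x in L] L ->
        forall d : \bar R, d != -oo%E ->
          W d `&` osc_of L `<=` BI_interior gamma L piL ->
          semibounded gamma (Csmooth A) pi /\
          W d `<=` BI_interior gamma (Csmooth A) pi].
Proof.
have [pi ext] := extension_exists hA L_sub L_smooth L_dense L_gamma hpiL; exists pi.
have hpi := ext_smooth_rep hA L_sub L_smooth L_dense L_gamma hpiL ext.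
have hext g : osc_of L g -> pi g = piL g.
  by move=> Lg; apply/funext => v; apply: (ext_eq hA L_smooth L_dense hpiL ext).
split => //; first exact: (ext_unique hA L_smooth L_dense ext).
move=> K0 Dd d dn hW.
have D_dense x k (e : R) : Csmooth A x -> 0 < e ->
    exists2 y, Csmooth A y & cinfP k (im *: A y - x : cinf A) < e.
  move=> Vx e0; have [y Ly hy] := D_range_dense hA L_smooth L_dense L_D Dd k Vx e0.
  by exists y => //; apply: L_smooth.
have numW X : W d X -> exists M, numeric_le pi X M.
  move=> WX; have [VX s0] := W_pos WX; have WZ := W_center hA WX.
  set Z : osc A := (_, 0, X.2) in WZ.
  (* The centre of [X] has zero component in [V_A], so it lies in the small Lie algebra whatever [X]
     is. *)
  have LZ : osc_of L Z by case: L_sub.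
  have [VZ sZ] := W_pos WZ.
  have [_ /nbhs_singleton/(_ LZ)[_]] := hW Z (conj WZ LZ).
  have sv := ext_smooth_vectors hA L_sub L_smooth L_dense L_gamma hpiL ext.
  rewrite /s_pi (i_dpi_ext L_sub L_exp sv hext LZ) -/(s_pi gamma (Csmooth A) pi Z) => fin.
  have [M hM] : exists M : R, (s_pi gamma (Csmooth A) pi Z <= M%:E)%E.
    (* The supremum is [-oo] when the spectrum has no real point; any real bound serves in that
       case. *)
    by move: fin; case: (s_pi _ _ _ _) => // [r|] _; [exists r | exists 0; apply: leNye].
  exists M; apply: (numeric_center hA D_dense hpi VX s0).
  exact: (s_pi_numeric hA D_dense hpi VZ hM).
by split; [exact: (W_semibounded hA D_dense hpi dn numW K0) | exact: (W_BI_interior hA D_dense hpi dn numW)].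
Qed.
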